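(* Assume that $\rho_{\min}>\gamma_{\max}^{1/2}$, that $h_n'(0)=0$ for all $n\in\mathbb{N}$, and that $K_2:=\sup_{n}\|h_n''\|_\infty<\infty$. If there exists a constant $z>2$ such that $\gamma_{\min}\geq z$, then there exists a constant $C_0$ depending only on $z,K_0,K_2$ such that if $$\rho_{\min}^2\gamma_{\max}^{-1}>C_0,$$ then there exist constants $C_1>0$ depending only on $z$, $C_2>0$ depending only on $z,K_0,K_2,\gamma_{\max}$, $C_3>0$ depending only on $z,K_0$, and $C_4>0$ depending only on $z,K_0,\rho_{\max}$ such that, if $y_t$ is the solution of $dy_t=d\omega_t-\nabla\Gamma(y_t)\,dt$, $y_0=0$, and $t\geq C_3$, then $$C_1\,t\,\gamma_{p(t)}^2\leq\mathbb{E}\big[(y_t\cdot e_2)^2\big]\leq C_2\,t\,\gamma_{p(t)}^2$$ and $$C_4\,t^{1+\nu(t)}\leq\mathbb{E}\big[(y_t\cdot e_2)^2\big]\leq C_2\,t^{1+\nu(t)},$$ with $$p(t):=\sup\Big\{n\in\mathbb{N}\,:\,16(1+K_0^2)\big(1-(\gamma_{\min}-1)^{-1}\big)^{-2}R_n^2<t\Big\}$$ and $$\nu(t):=\ln\gamma_{p(t)}\big/\ln R_{p(t)}.$$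
   Context: Let $\mathbb{N}=\{0,1,2,\dots\}$. Let $(r_n)_{n\ge 0}$ be integers with $r_0=1$, $\rho_{\min}=\inf_{n\ge1}r_n\ge 2$, $\rho_{\max}=\sup_{n\ge1}r_n<\infty$, and $R_n=\prod_{k=0}^n r_k$. Let $(\gamma_n)_{n\ge0}$ be reals with $\gamma_0=1$, $\gamma_{\min}=\inf_{n\ge0}\gamma_{n+1}/\gamma_n>1$, $\gamma_{\max}=\sup_{n\ge0}\gamma_{n+1}/\gamma_n<\infty$. Let $h_n:\mathbb{R}\to\mathbb{R}$ ($n\ge 0$) be smooth functions of period $1$ with $h_n(0)=0$, $\int_0^1\big(h_n(x)-\int_0^1h_n(y)dy\big)^2dx=1$, $K_0=\sup_n(\sup h_n-\inf h_n)<\infty$ and $\sup_n\|h_n'\|_\infty<\infty$. Put $h(x_1)=\sum_{n=0}^\infty\gamma_nh_n(x_1/R_n)$ (under the assumptions of the claim this is a well-defined $C^2$ function, with $|h'(x)|\le K_2(1-\gamma_{\max}/\rho_{\min}^2)^{-1}|x|$), and $\Gamma(x_1,x_2)=\begin{pmatrix}0&h(x_1)\\-h(x_1)&0\end{pmatrix}$. Let $\omega_t$ be a standard Brownian motion in $\mathbb{R}^2$ started at $0$, and let $(e_1,e_2)$ be the canonical basis. In the equation $dy_t=d\omega_t-\nabla\Gamma(y_t)\,dt$, $y_0=0$, $\nabla\Gamma$ denotes the divergence of the matrix $\Gamma$; explicitly $y_t\cdot e_1=\omega_t\cdot e_1$ and $y_t\cdot e_2=\omega_t\cdot e_2+\int_0^t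 h'(\omega_s\cdot e_1)\,ds$. *)

(* Defs.v *)
From HB Require Import structures.
From mathcomp Require Import all_boot all_order all_algebra.
From mathcomp Require Import all_classical all_reals all_analysis.
Set Implicit Arguments.
Unset Strict Implicit.
Unset Printing Implicit Defensive.
Import Order.TTheory GRing.Theory Num.Theory.
Import numFieldNormedType.Exports.
Local Open Scope ring_scope.
Local Open Scope classical_set_scope.

(* On [realType], [sup] and [inf] default to 0 on sets without a genuine
   supremum/infimum. Below they are only applied to sets that are bounded,
   either by an explicit hypothesis or because a smooth periodic function and
   its derivatives are bounded. *)

Section ScalarFunctions.
Context {R : realType}.
Implicit Type f : R -> R.

Definition smooth f := forall (n : nat) (x : R), derivable f^`(n) x 1.

Definition sup_norm f : R := sup (range (fun x => `|f x|)).

Definition oscillation f : R := sup (range f) - inf (range f).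

Definition mean01 f : R := \int[lebesgue_measure]_(x in `[0%R, 1%R]) f x.

Definition variance01 f : R := mean01 (fun x => (f x - mean01 f) ^+ 2).

End ScalarFunctions.

Section ShearFlow.
Context {R : realType}.
Variables (r : nat -> int) (gamma : nat -> R) (h : nat -> R -> R).

Definition ratio_set : set R := [set (r n)%:~R | n in [set n | (1 <= n)%N]].
Definition rho_min : R := inf ratio_set.
Definition rho_max : R := sup ratio_set.

Definition scale (n : nat) : R := \prod_(0 <= k < n.+1) (r k)%:~R.

Definition gamma_ratio_set : set R := range (fun n => gamma n.+1 / gamma n).
Definition gamma_min : R := inf gamma_ratio_set.
Definition gamma_max : R := sup gamma_ratio_set.

Definition K_0 : R := sup (range (fun n => oscillation (h n))).
Definition K_2 : R := sup (range (fun n => sup_norm (h n)^`(2))).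

Record shear_flow_assumptions : Prop := ShearFlowAssumptions {
  shear_r0 : r 0%N = 1;
  shear_rho_min : 2 <= rho_min;
  shear_rho_max : has_ubound ratio_set;
  shear_gamma0 : gamma 0%N = 1;
  shear_gamma_min : 1 < gamma_min;
  shear_gamma_max : has_ubound gamma_ratio_set;
  shear_smooth : forall n, smooth (h n);
  shear_periodic : forall n, periodic (h n) 1;
  shear_h0 : forall n, h n 0 = 0;
  shear_variance : forall n, variance01 (h n) = 1;
  shear_K0 : has_ubound (range (fun n => oscillation (h n)));
  shear_K1 : has_ubound (range (fun n => sup_norm (h n)^`())) }.

Definition potential (x : R) : R :=
  limn (series (fun n => gamma n * h n (x / scale n))).

(* Coordinates are numbered from 0: [e_1] and [e_2] of the mathematics are the
   indices [0] and [1] of 'I_2. *)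
Definition stream_matrix (x : 'rV[R]_2) : 'M[R]_2 :=
  \matrix_(i, j) (if (i == 0) && (j == 1) then potential (x 0 0)
                  else if (i == 1) && (j == 0) then - potential (x 0 0)
                  else 0).

Definition threshold : R :=
  16 * (1 + K_0 ^+ 2) * (1 - (gamma_min - 1)^-1) ^- 2.

(* The set is bounded since [scale n >= 2 ^ n]. [supremum] returns the default
   0 if it is empty, i.e. for [t <= threshold]. *)
Definition scale_index (t : R) : nat :=
  supremum 0%N [set n : nat | threshold * scale n ^+ 2 < t].

(* When [scale_index t = 0] the quotient is [ln 1 / ln 1], which is 0 here as
   [x / 0 = 0]. *)
Definition anomalous_exponent (t : R) : R :=
  ln (gamma (scale_index t)) / ln (scale (scale_index t)).

End ShearFlow.

(* The divergence acts along rows: its i-th component is the sum over j of the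
   partial derivative of the (i, j) entry along the j-th coordinate. For
   [stream_matrix] it is the vector (0, - potential'). *)
Definition divergence {R : realType} {n : nat}
    (G : 'rV[R]_n -> 'M[R]_n) (x : 'rV[R]_n) : 'rV[R]_n :=
  \row_i \sum_j 'D_(delta_mx 0 j) (fun u => G u i j : R) x.

Section Processes.
Context {R : realType} {d : measure_display} {T : measurableType d}.
Variable P : probability T R.

(* The events [B i] range over all measurable sets, including [setT], so this
   covers every subfamily. *)
Definition mutually_independent {I : finType} (X : I -> T -> R) : Prop :=
  forall B : I -> set R, (forall i, measurable (B i)) ->
    P (\bigcap_(i in [set: I]) (X i @^-1` B i)) =
    (\prod_i fine (P (X i @^-1` B i)))%:E.

(* Times are reals; only the values at nonnegative times are constrained. *)
Record brownian_motion {n : nat} (omega : R -> T -> 'rV[R]_n) : Prop :=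
  BrownianMotion {
  bm_measurable : forall (t : R) i, 0 <= t ->
    measurable_fun [set: T] (fun w => omega t w 0 i);
  bm_start : forall w, omega 0 w = 0;
  bm_continuous : forall w,
    {within `[0, +oo[, continuous (fun t => omega t w)};
  bm_gaussian : forall (s t : R) i, 0 <= s -> s < t ->
    forall B : set R, measurable B ->
      P ((fun w => omega t w 0 i - omega s w 0 i) @^-1` B) =
      normal_prob 0 (Num.sqrt (t - s)) B;
  (* joint independence over disjoint time intervals and over coordinates *)
  bm_independent : forall (m : nat) (t : nat -> R),
    0 <= t 0%N -> {homo t : k l / (k <= l)%N >-> k <= l} ->
    mutually_independent (fun (ki : 'I_m * 'I_n) (w : T) =>
      omega (t ki.1.+1) w 0 ki.2 - omega (t ki.1) w 0 ki.2) }.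

(* dy_t = d omega_t - (div G)(y_t) dt, y_0 = 0: the noise is additive, so the
   equation is an ordinary integral equation along each path. *)
Record solves_sde {n : nat} (G : 'rV[R]_n -> 'M[R]_n)
    (omega y : R -> T -> 'rV[R]_n) : Prop := SolvesSde {
  sde_start : forall w, y 0 w = 0;
  sde_continuous : forall w, {within `[0, +oo[, continuous (fun t => y t w)};
  sde_integral : forall w (t : R) i, 0 <= t ->
    y t w 0 i = omega t w 0 i
      - \int[lebesgue_measure]_(s in `[0, t]) divergence G (y s w) 0 i }.

End Processes.

(* Main.v *)
Require Import Defs.
From HB Require Import structures.
From mathcomp Require Import all_boot all_order all_algebra.
From mathcomp Require Import all_classical all_reals all_analysis.
From mathcomp Require Import measurable_realfun.
From mathcomp Require Import ring lra.
Import Order.TTheory GRing.Theory Num.Theory.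
Import numFieldNormedType.Exports.
Local Open Scope ring_scope.
Local Open Scope classical_set_scope.

Set Implicit Arguments.
Unset Strict Implicit.
Unset Printing Implicit Defensive.

(** Write [b], [W] for the two coordinates of the Brownian motion, [k = h'] and
    [q = R_p]: then [y . e_2 = W_t + X] with [X] the integral of [k (b_s)] over
    [[0, t]]. Split [k = g' + v'], where [g] is the centred sum of the levels
    [n <= p], a [q]-periodic function with [gamma_p]-sized root mean square [c],
    and [v] is the sum of the remaining levels, with [|v''|] tiny since the
    scales are well separated. If [F' = 2 g], Ito's formula reads
    [X = F(b_t) - F(0) - 2 int g(b) db + int v'(b) ds].

    Upper bound: [F] is bounded by a multiple of [q c <= c sqrt t], the Ito
    isometry controls the martingale, and [|v'(x)| <= sup |v''| * |x|].

    Lower bound: by Cauchy-Schwarz it suffices to correlate [W_t + X] with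
    [Z = int_{t/2}^t g(b) db]. The martingale contributes [- 2 E Z^2], [W] is
    orthogonal to [Z], [F] is too small to compensate, and the contribution of
    [v] is [2 int E (g(b_s) (v(b_t) - v(b_s))) ds] by Stein's identity. Applying
    Stein's identity twice more moves the derivatives from [g = G'' / 2] to [v],
    which bounds it by [t * q^2 c * sup |v''|]. Finally [E Z^2] is comparable to
    [c^2 t], since for [s >= q^2] the law of [b_s] is spread over many periods
    of [g].

    No stochastic integral is constructed: everything is done on a finite time
    grid, where Ito's formula holds up to an [L^2] error of order the square
    root of the mesh, and Fatou's lemma passes to the limit. *)

(** * Calculus on the real line *)

(** The obstacle in the lower bound is that [v] is unbounded. From [|v''| <= L] and
    [v(0) = v'(0) = 0] it only inherits a bound of order [L x^2], so estimating [E (g(b_s) v(b_t))]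
    by absolute values costs about [c L t]. As [t] may reach a multiple of [R_{p+1}^2], this can be
    as large as [c gamma_{p+1}] and exceed [c^2]. Moving derivatives replaces [t] by [q^2], and [q^2
    L <= 2 K_2 gamma_p gamma_max / rho_min^2] is what [C0] makes small. The price is that [g] needs
    two bounded antiderivatives: the levels are centred to make [F] periodic, and [F] is centred
    again to make [G] periodic. The integrations by parts divide by [s], hence the restriction to
    [s >= t/2].

    That [c] is comparable to [gamma_p] rests on [gamma_min > 2]: the lower levels together have
    root mean square at most [gamma_p / (gamma_min - 1) < gamma_p].

    The limit in the mesh is asymmetric. Fatou's lemma transfers upper bounds only, so the lower
    bound compares the integral with one fixed grid sum, at the cost of a factor 2. *)

Section Calculus.
Context {R : realType}.
Implicit Types f F g : R -> R.
Notation mu := (@lebesgue_measure R).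

(** Relating two functions, rather than applying the derivative operator, lets derivatives be
    assembled rule by rule and rewritten with [der_eq], with derivability carried along. *)
Definition der F f := forall x : R, is_derive x 1 F (f x).

Lemma der_continuous F f : der F f -> continuous F.
Proof.
by move=> dF x; apply/differentiable_continuous/derivable1_diffP; case: (dF x).
Qed.

Lemma derE F f x : der F f -> F^`() x = f x.
Proof. by move=> dF; rewrite derive1E; have [_ ->] := dF x. Qed.

Lemma der_cst c : der (fun=> c) (fun=> 0).
Proof. by move=> x; exact: is_derive_cst. Qed.

Lemma der_id : der (fun x => x) (fun=> 1).
Proof. by move=> x; exact: is_derive_id. Qed.

Lemma derD F f G g : der F f -> der G g ->
  der (fun x => F x + G x) (fun x => f x + g x).
Proof. by move=> dF dG x; apply: is_deriveD; [exact: dF|exact: dG]. Qed.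

Lemma derN F f : der F f -> der (fun x => - F x) (fun x => - f x).
Proof. by move=> dF x; apply: is_deriveN; exact: dF. Qed.

Lemma derB F f G g : der F f -> der G g ->
  der (fun x => F x - G x) (fun x => f x - g x).
Proof. by move=> dF dG; apply: derD => //; exact: derN. Qed.

Lemma derM F f G g : der F f -> der G g ->
  der (fun x => F x * G x) (fun x => f x * G x + F x * g x).
Proof.
move=> dF dG x; apply: is_derive_eq; first exact: (is_deriveM (dF x) (dG x)).
by rewrite /GRing.scale/= addrC; congr (_ + _); rewrite mulrC.
Qed.

Lemma derZ c F f : der F f -> der (fun x => c * F x) (fun x => c * f x).
Proof.
move=> dF x; have := derM (der_cst c) dF x.
by rewrite mul0r add0r.
Qed.

Lemma der_comp F f G g : der F f -> der G g ->
  der (fun x => F (G x)) (fun x => f (G x) * g x).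
Proof. by move=> dF dG x; exact: (is_derive1_comp (dF _) (dG _)). Qed.

Lemma der_shift F f y : der F f -> der (fun x => F (x + y)) (fun x => f (x + y)).
Proof.
move=> dF x; have := der_comp dF (derD der_id (der_cst y)) x.
by rewrite addr0 mulr1.
Qed.

Lemma der_eq F f g : der F f -> f =1 g -> der F g.
Proof. by move=> dF fg x; rewrite -fg. Qed.

Lemma der_sum (I : Type) (r : seq I) (p : pred I) (F f : I -> R -> R) :
  (forall i, der (F i) (f i)) ->
  der (fun x => \sum_(i <- r | p i) F i x) (fun x => \sum_(i <- r | p i) f i x).
Proof.
move=> dF; elim: r => [|i r IH].
  have e (G : I -> R -> R) : (fun x => \sum_(i <- [::] | p i) G i x) = (fun=> 0).
    by apply/funext => x; rewrite big_nil.
  by rewrite !e; exact: der_cst.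
have e (G : I -> R -> R) : (fun x => \sum_(j <- i :: r | p j) G j x) =
    (fun x => if p i then G i x + \sum_(j <- r | p j) G j x
              else \sum_(j <- r | p j) G j x).
  by apply/funext => x; rewrite big_cons.
by rewrite !e; case: (p i) => //; exact: derD.
Qed.

Lemma der_scale c F f : der F f -> der (fun x => F (x / c)) (fun x => f (x / c) / c).
Proof.
move=> dF x.
have := der_comp dF (derM der_id (der_cst c^-1)) x.
by rewrite mulr0 addr0 mul1r.
Qed.

Lemma der_MVT F f x y : der F f ->
  exists2 c, (x <= c <= y) || (y <= c <= x) & F y - F x = f c * (y - x).
Proof.
move=> dF; wlog xy : x y / x <= y => [H|].
  have [|/ltW yx] := leP x y; first exact: H.
  have [c cyx e] := H y x yx; exists c; first by rewrite orbC.
  by rewrite -opprB e -mulrN opprB.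
have [|c] := MVT_segment xy (fun z _ => dF z).
  exact/continuous_subspaceT/der_continuous.
by rewrite in_itv/= => cxy e; exists c => //; rewrite cxy.
Qed.

Lemma between_norm (x y c : R) : (x <= c <= y) || (y <= c <= x) ->
  `|c| <= Num.max `|x| `|y| /\ `|c - x| <= `|y - x|.
Proof.
move=> /orP[]/andP[c1 c2].
  split; last by rewrite !ger0_norm; lra.
  rewrite le_max; have [c0|c0] := leP 0 c.
    by apply/orP; right; rewrite (ger0_norm c0) (le_trans c2)// ler_norm.
  by apply/orP; left; rewrite (ltr0_norm c0) ler_normr; apply/orP; right; lra.
split; last by rewrite !ler0_norm; lra.
rewrite le_max; have [c0|c0] := leP 0 c.
  by apply/orP; left; rewrite (ger0_norm c0) (le_trans c2)// ler_norm.
by apply/orP; right; rewrite (ltr0_norm c0) ler_normr; apply/orP; right; lra.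
Qed.

Lemma der_lipschitz F f M : der F f -> (forall x, `|f x| <= M) ->
  forall x y, `|F y - F x| <= M * `|y - x|.
Proof.
move=> dF fM x y; have [c _ ->] := der_MVT x y dF.
by rewrite normrM ler_wpM2r.
Qed.

Lemma der_linear_growth F f L : der F f -> (forall x, `|f x| <= L) -> F 0 = 0 ->
  forall x, `|F x| <= L * `|x|.
Proof.
move=> dF fL F0 x; have := der_lipschitz dF fL 0 x.
by rewrite F0 !subr0.
Qed.

Lemma der_const F f c : der F f -> (forall x, f x = 0) -> F 0 = c ->
  forall x, F x = c.
Proof.
move=> dF f0 <- x; have [y _] := der_MVT 0 x dF.
by rewrite f0 mul0r => /eqP; rewrite subr_eq0 => /eqP.
Qed.

Lemma continuous_itv_integrable f a b : continuous f ->
  mu.-integrable `[a, b] (EFin \o f).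
Proof.
move=> cf; apply: continuous_compact_integrable; first exact: segment_compact.
exact: continuous_subspaceT.
Qed.

Lemma der_FTC F f a b : der F f -> continuous f -> a <= b ->
  \int[mu]_(x in `[a, b]) f x = F b - F a.
Proof.
move=> dF cf; rewrite le_eqVlt => /predU1P[->|ab].
  by rewrite set_itv1 Rintegral_set1 subrr.
have cF := der_continuous dF.
rewrite /Rintegral (continuous_FTC2 (F := F)) => //.
- exact: continuous_subspaceT.
- split => [x _||]; first by have [] := dF x.
  + exact/cvg_at_right_filter/cF.
  + exact/cvg_at_left_filter/cF.
- by move=> x _; exact: derE.
Qed.

(** An integral from a base point is differentiated to the right of that point. Since integrals over
    reversed intervals vanish, [I 0 x - I x 0] is a signed integral, and near any [x] it agrees with
    [I a x - I a 0] for a base point [a] below both 0 and [x]. *)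
Lemma primitive f : continuous f -> exists F, der F f /\ F 0 = 0.
Proof.
move=> cf.
pose I a x : R := \int[mu]_(t in `[a, x]) f t.
have dI (a x : R) : a < x -> is_derive x 1 (I a) (f x).
  move=> ax; have xx1 : x < x + 1 by rewrite ltrDl.
  have [d1 e] := @continuous_FTC1_closed R f a x (x + 1) xx1
    (continuous_itv_integrable _ _ cf) ax (cf x).
  by rewrite derive1E in e; exact: (DeriveDef d1 e).
have IE (a c x : R) : a <= c -> c <= x -> I a x = I a c + I c x.
  move=> ac cx; rewrite /I.
  have := @Rintegral_itvB R f (BLeft a) (BRight x) c (continuous_itv_integrable _ _ cf).
  rewrite !bnd_simp => /(_ ac cx).
  rewrite Rintegral_itv_obnd_cbnd; last first.
    apply: integrableS (continuous_itv_integrable c x cf) => //.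
    exact: subset_itv_oc_cc.
  by move=> <-; rewrite addrC subrK.
have I0 (a b : R) : b < a -> I a b = 0.
  by move=> ba; rewrite /I set_itv_ge ?Rintegral_set0// bnd_simp -ltNge.
have I00 a : I a a = 0 by rewrite /I set_itv1 Rintegral_set1.
pose F x := I 0 x - I x 0.
have FE (a x : R) : a <= 0 -> a <= x -> F x = I a x - I a 0.
  move=> a0 ax; rewrite /F; have [x0|x0|<-] := ltrgtP 0 x.
  - by rewrite (IE a 0 x) ?(ltW x0)// (I0 x 0)//; ring.
  - by rewrite (IE a x 0) ?(ltW x0)// (I0 0 x)//; ring.
  - by rewrite I00; ring.
exists F; split; last by rewrite (FE 0 0)// subrr.
move=> x; pose a := Num.min 0 x - 1.
have a0 : a < 0 by rewrite /a ltrBlDl addrC ltr_pwDr//= ge_min lexx.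
have ax : a < x by rewrite /a ltrBlDl addrC ltr_pwDr//= ge_min lexx orbT.
have H : is_derive x 1 (fun y => I a y - I a 0) (f x).
  rewrite -[f x]subr0; apply: is_deriveB; first exact: dI.
apply: near_eq_is_derive H.
near=> y; apply/esym/FE; first exact: ltW.
by near: y; apply: filterS (lt_nbhsr ax) => z /ltW.
Unshelve. all: by end_near. Qed.

End Calculus.

(** * Moments and independence *)

Section Moments.
Context {R : realType} {d : measure_display} {T : measurableType d}.
Variable P : probability T R.
Implicit Types (Y Z : T -> R).

Definition Ex Y : R := \int[P]_w Y w.

(* All absolute moments are finite: every random variable below is of this kind,
   so that sums and products remain integrable without further side conditions. *)
Definition moments Y : Prop := measurable_fun setT Y /\
  forall m, P.-integrable setT (EFin \o (fun w => `|Y w| ^+ m)).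

Lemma integrable_bound Y Z : measurable_fun setT Y ->
  P.-integrable setT (EFin \o Z) -> (forall w, `|Y w| <= Z w) ->
  P.-integrable setT (EFin \o Y).
Proof.
move=> mY iZ YZ; apply: le_integrable iZ => //; first exact/measurable_EFinP.
by move=> w _ /=; rewrite lee_fin (le_trans (YZ w))// ler_norm.
Qed.

Lemma integrable_addf Y Z : P.-integrable setT (EFin \o Y) ->
  P.-integrable setT (EFin \o Z) ->
  P.-integrable setT (EFin \o (fun w => Y w + Z w)).
Proof. by move=> iY iZ; exact: (integrableD measurableT iY iZ). Qed.

Lemma integrable_scalef (c : R) Y : P.-integrable setT (EFin \o Y) ->
  P.-integrable setT (EFin \o (fun w => c * Y w)).
Proof. by move=> iY; exact: (integrableZl measurableT c iY). Qed.

Lemma moments_cst (c : R) : moments (fun=> c).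
Proof.
split=> // m; apply/integrableP; split; first exact/measurable_EFinP.
under eq_integral do rewrite /=.
by rewrite integral_cst//= probability_setT mule1 ltry.
Qed.

Lemma moments_meas Y : moments Y -> measurable_fun setT Y.
Proof. by case. Qed.

Lemma moments_int Y : moments Y -> P.-integrable setT (EFin \o Y).
Proof.
move=> [mY iY]; apply: (integrable_bound mY (iY 1%N)) => w.
by rewrite expr1.
Qed.

Lemma momentsW Y Z : measurable_fun setT Y -> moments Z ->
  (forall w, `|Y w| <= `|Z w|) -> moments Y.
Proof.
move=> mY [mZ iZ] YZ; split=> // m.
apply: (integrable_bound _ (iZ m)).
  by apply: measurable_funX; exact: measurableT_comp.
by move=> w; rewrite normrX normr_id lerXn2r ?nnegrE.
Qed.

Lemma exprD_le (a b : R) m : 0 <= a -> 0 <= b ->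
  (a + b) ^+ m <= 2 ^+ m * (a ^+ m + b ^+ m).
Proof.
wlog ab : a b / a <= b => [H a0 b0|a0 b0].
  have [ab|/ltW ba] := leP a b; first exact: H.
  by rewrite addrC [X in _ <= _ * X]addrC; apply: H.
rewrite (@le_trans _ _ ((2 * b) ^+ m))//.
  by rewrite lerXn2r ?nnegrE ?addr_ge0 ?mulr_ge0//; lra.
by rewrite exprMn ler_wpM2l ?exprn_ge0// lerDr exprn_ge0.
Qed.

Lemma momentsD Y Z : moments Y -> moments Z -> moments (fun w => Y w + Z w).
Proof.
move=> [mY iY] [mZ iZ]; split; first exact: measurable_funD.
move=> m; apply: (@integrable_bound _ (fun w => 2 ^+ m * (`|Y w| ^+ m + `|Z w| ^+ m))).
- apply: measurable_funX; apply: measurableT_comp => //.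
  exact: measurable_funD.
- exact/integrable_scalef/integrable_addf.
move=> w; rewrite normrX normr_id (le_trans _ (exprD_le _ _ _))//.
by rewrite lerXn2r ?nnegrE ?addr_ge0// ler_normD.
Qed.

Lemma momentsM Y Z : moments Y -> moments Z -> moments (fun w => Y w * Z w).
Proof.
move=> [mY iY] [mZ iZ]; split; first exact: measurable_funM.
move=> m; apply: (@integrable_bound _ (fun w => `|Y w| ^+ (m * 2) + `|Z w| ^+ (m * 2))).
- apply: measurable_funX; apply: measurableT_comp => //.
  exact: measurable_funM.
- exact/integrable_addf.
move=> w; rewrite normrX normr_id normrM exprMn !exprM.
set x := _ ^+ m; set y := _ ^+ m; nra.
Qed.

Lemma momentsZ (c : R) Y : moments Y -> moments (fun w => c * Y w).
Proof. by move=> mY; apply: momentsM => //; exact: moments_cst. Qed.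

Lemma momentsN Y : moments Y -> moments (fun w => - Y w).
Proof.
move=> mY; apply: (momentsW _ mY); last by move=> w; rewrite normrN.
by apply: measurableT_comp => //; case: mY.
Qed.

Lemma momentsB Y Z : moments Y -> moments Z -> moments (fun w => Y w - Z w).
Proof. by move=> mY mZ; apply: momentsD => //; exact: momentsN. Qed.

Lemma momentsX Y m : moments Y -> moments (fun w => Y w ^+ m).
Proof.
move=> mY; elim: m => [|m IH]; first exact: moments_cst.
under eq_fun do rewrite exprS.
exact: momentsM.
Qed.

Lemma moments_norm Y : moments Y -> moments (fun w => `|Y w|).
Proof.
move=> mY; apply: (momentsW _ mY); last by move=> w; rewrite normr_id.
by apply: measurableT_comp => //; case: mY.
Qed.

Lemma moments_sum (I : Type) (r : seq I) (p : pred I) (Y : I -> T -> R) :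
  (forall i, p i -> moments (Y i)) -> moments (fun w => \sum_(i <- r | p i) Y i w).
Proof.
move=> mY; elim: r => [|i r IH].
  by under eq_fun do rewrite big_nil; exact: moments_cst.
under eq_fun do rewrite big_cons.
by case pi: (p i) => //; apply: momentsD => //; exact: mY.
Qed.

Definition polygrowth (f : R -> R) :=
  exists C m, 0 <= C /\ forall x, `|f x| <= C * (1 + `|x|) ^+ m.

Lemma moments_comp (f : R -> R) Y : measurable_fun setT f -> polygrowth f ->
  moments Y -> moments (fun w => f (Y w)).
Proof.
move=> mf [C [m [C0 fC]]] mY.
apply: (@momentsW _ (fun w => C * (1 + `|Y w|) ^+ m)).
- by apply: measurableT_comp => //; case: mY.
- apply/momentsZ/momentsX/momentsD; first exact: moments_cst.
  exact: moments_norm.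
- by move=> w; rewrite [leRHS]ger0_norm ?fC// mulr_ge0// exprn_ge0// addr_ge0.
Qed.

Lemma Ex_cst c : Ex (fun=> c) = c.
Proof. by rewrite /Ex Rintegral_cst//= probability_setT mulr1. Qed.

Lemma ExD Y Z : moments Y -> moments Z ->
  Ex (fun w => Y w + Z w) = Ex Y + Ex Z.
Proof. by move=> mY mZ; rewrite /Ex RintegralD//; exact: moments_int. Qed.

Lemma ExB Y Z : moments Y -> moments Z ->
  Ex (fun w => Y w - Z w) = Ex Y - Ex Z.
Proof. by move=> mY mZ; rewrite /Ex RintegralB//; exact: moments_int. Qed.

Lemma ExZ c Y : moments Y -> Ex (fun w => c * Y w) = c * Ex Y.
Proof. by move=> mY; rewrite /Ex RintegralZl//; exact: moments_int. Qed.

Lemma Ex_ge0 Y : (forall w, 0 <= Y w) -> 0 <= Ex Y.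
Proof. by move=> Y0; exact: Rintegral_ge0. Qed.

Lemma Ex_le Y Z : moments Y -> moments Z -> (forall w, Y w <= Z w) ->
  Ex Y <= Ex Z.
Proof. by move=> mY mZ YZ; apply: le_Rintegral => //; exact: moments_int. Qed.

Lemma Ex_sum (I : Type) (r : seq I) (p : pred I) (Y : I -> T -> R) :
  (forall i, p i -> moments (Y i)) ->
  Ex (fun w => \sum_(i <- r | p i) Y i w) = \sum_(i <- r | p i) Ex (Y i).
Proof.
move=> mY; elim: r => [|i r IH].
  by rewrite big_nil; under eq_fun do rewrite big_nil; exact: Ex_cst.
rewrite big_cons -IH; under eq_fun do rewrite big_cons.
case pi: (p i) => //; rewrite ExD//; first exact: mY.
exact: moments_sum.
Qed.

Lemma Ex_EFin Y : moments Y -> expectation P Y = (Ex Y)%:E.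
Proof.
move=> mY; rewrite /Ex /Rintegral fineK; first by rewrite unlock.
exact/integrable_fin_num/moments_int.
Qed.

Lemma Ex_cauchy_schwarz Y Z : moments Y -> moments Z ->
  Ex (fun w => Y w * Z w) ^+ 2 <= Ex (fun w => Y w ^+ 2) * Ex (fun w => Z w ^+ 2).
Proof.
move=> mY mZ.
set a := Ex (fun w => Y w ^+ 2); set b := Ex (fun w => Z w ^+ 2).
set c := Ex _.
have H (x y : R) : 0 <= x ^+ 2 * a + 2 * x * y * c + y ^+ 2 * b.
  rewrite -ExZ; last exact: momentsX.
  rewrite -ExZ; last exact: momentsM.
  rewrite -ExZ; last exact: momentsX.
  rewrite -ExD; [|exact/momentsZ/momentsX|exact/momentsZ/momentsM].
  rewrite -ExD; [|apply: momentsD; [exact/momentsZ/momentsX|exact/momentsZ/momentsM]|exact/momentsZ/momentsX].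
  apply: Ex_ge0 => w.
  rewrite (_ : _ + _ = (x * Y w + y * Z w) ^+ 2); last by ring.
  exact: sqr_ge0.
have b0 : 0 <= b by apply: Ex_ge0 => w; exact: sqr_ge0.
have a0 : 0 <= a by apply: Ex_ge0 => w; exact: sqr_ge0.
(* If [b = 0] and [c <> 0], the form is affine in [y] and the chosen [y] gives it the value -1.
   Otherwise the vector [(b, - c)] yields the discriminant. *)
have [b00|bn0] := eqVneq b 0.
  have [->|c0] := eqVneq c 0; first by rewrite expr0n/= mulr_ge0.
  have := H 1 (- (a + 1) / (2 * c)).
  rewrite b00 (_ : _ + _ = -1); first lra.
  by field.
have bp : 0 < b by rewrite lt0r bn0.
have := H b (- c).
rewrite (_ : _ + _ = b * (a * b - c ^+ 2)); last by ring.
by rewrite pmulr_rge0// subr_ge0.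
Qed.

Lemma Ex_norm_le Y : moments Y -> `|Ex Y| <= Ex (fun w => `|Y w|).
Proof. by move=> mY; apply: le_normr_Rintegral => //; exact: moments_int. Qed.

Lemma Ex_sqrD_le Y Z : moments Y -> moments Z ->
  Ex (fun w => (Y w + Z w) ^+ 2) <=
  2 * (Ex (fun w => Y w ^+ 2) + Ex (fun w => Z w ^+ 2)).
Proof.
move=> mY mZ; rewrite -ExD; [|exact: momentsX..].
rewrite -ExZ; last by apply: momentsD; exact: momentsX.
apply: Ex_le.
- by apply: momentsX; exact: momentsD.
- by apply/momentsZ/momentsD; exact: momentsX.
move=> w; have := sqr_ge0 (Y w - Z w); nra.
Qed.

(** Cauchy-Schwarz against the constant sequence 1. Multiplied by [N], the induction step comes down
    to [(s - N a_n)^2 >= 0]; hence the separate case [N = 0]. *)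
Lemma sqr_sum_le n (a : nat -> R) :
  (\sum_(0 <= i < n) a i) ^+ 2 <= n%:R * \sum_(0 <= i < n) a i ^+ 2.
Proof.
elim: n => [|n IH]; first by rewrite !big_geq// expr0n mul0r.
rewrite !big_nat_recr//=.
set s := \sum_(_ <= _ < _) _ in IH *; set q := \sum_(_ <= _ < _) _ in IH *.
have q0 : 0 <= q by apply: sumr_ge0 => i _; exact: sqr_ge0.
rewrite -natr1; set N := n%:R in IH *.
have N0 : 0 <= N by rewrite ler0n.
have [N00|Nn] := eqVneq N 0.
  have -> : s = 0.
    by apply/eqP; rewrite -sqrf_eq0 eq_le sqr_ge0 andbT (le_trans IH)// N00 mul0r.
  rewrite N00; nra.
have Np : 0 < N by rewrite lt0r Nn.
rewrite -subr_ge0 -(pmulr_rge0 _ Np).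
have := sqr_ge0 (s - N * a n).
nra.
Qed.

Lemma Ex_sqr_sum_le n (Y : nat -> T -> R) c : (forall i, moments (Y i)) ->
  (forall i, (i < n)%N -> Ex (fun w => Y i w ^+ 2) <= c) ->
  Ex (fun w => (\sum_(0 <= i < n) Y i w) ^+ 2) <= n%:R ^+ 2 * c.
Proof.
move=> mY Yc.
apply: (@le_trans _ _ (Ex (fun w => n%:R * \sum_(0 <= i < n) Y i w ^+ 2))).
  apply: Ex_le.
  - by apply/momentsX/moments_sum.
  - by apply/momentsZ/moments_sum => i _; exact: momentsX.
  - by move=> w; exact: sqr_sum_le.
rewrite ExZ; last by apply/moments_sum => i _; exact: momentsX.
rewrite Ex_sum; last by move=> i _; exact: momentsX.
rewrite expr2 -mulrA ler_wpM2l//.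
apply: (@le_trans _ _ (\sum_(0 <= i < n) c)).
  by apply: ler_sum_nat => i /andP[_ ?]; exact: Yc.
by rewrite sumr_const_nat subn0 mulr_natl.
Qed.

End Moments.

(** * Independence: from rectangles to joint laws *)

Section Independence.
Context {R : realType} {d : measure_display} {T : measurableType d}.
Variable P : probability T R.

Definition indep d1 d2 (T1 : measurableType d1) (T2 : measurableType d2)
    (X : T -> T1) (Y : T -> T2) : Prop :=
  forall A B, measurable A -> measurable B ->
    P (X @^-1` A `&` Y @^-1` B) = (P (X @^-1` A) * P (Y @^-1` B))%E.

Lemma measurable_preimage d1 (T1 : measurableType d1) (X : T -> T1) A :
  measurable_fun setT X -> measurable A -> measurable (X @^-1` A).
Proof. by move=> mX mA; rewrite -[_ @^-1` _]setTI; exact: mX. Qed.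

Section Transfer.
Context d1 d2 (T1 : measurableType d1) (T2 : measurableType d2).

Lemma indep_law (X : {mfun T >-> T1}) (Y : {mfun T >-> T2})
    (XY : {mfun T >-> (T1 * T2)%type}) : (forall w, XY w = (X w, Y w)) ->
  indep X Y -> forall A, measurable A ->
  (distribution P X \x distribution P Y)%E A = distribution P XY A.
Proof.
move=> XYE iXY A mA.
apply: product_measure_unique => // {mA}A B mA mB.
rewrite /distribution /= /pushforward /= -iXY//; congr (P _).
by apply/seteqP; split => w /=; rewrite XYE.
Qed.

(* Conditioning on [X]: identities proved with [X] frozen hold jointly. *)
Lemma indep_Ex_eq (X : T -> T1) (Y : T -> T2) (F G : T1 * T2 -> R) :
  measurable_fun setT X -> measurable_fun setT Y -> indep X Y ->
  measurable_fun setT F -> measurable_fun setT G ->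
  (forall x, moments P (fun w => F (x, Y w))) ->
  (forall x, moments P (fun w => G (x, Y w))) ->
  moments P (fun w => F (X w, Y w)) -> moments P (fun w => G (X w, Y w)) ->
  (forall x, Ex P (fun w => F (x, Y w)) = Ex P (fun w => G (x, Y w))) ->
  Ex P (fun w => F (X w, Y w)) = Ex P (fun w => G (X w, Y w)).
Proof.
move=> mX mY iXY mF mG F1 G1 F2 G2 FG.
pose X' : {mfun T >-> T1} := mfun_Sub (mem_set mX).
pose Y' : {mfun T >-> T2} := mfun_Sub (mem_set mY).
have mXY : measurable_fun setT (fun w => (X w, Y w)).
  exact: measurable_fun_pair.
pose XY : {mfun T >-> (T1 * T2)%type} := mfun_Sub (mem_set mXY).
have law := @indep_law X' Y' XY (fun=> erefl) iXY.
have intE (H : T1 * T2 -> R) : measurable_fun setT H ->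
    (forall x, moments P (fun w => H (x, Y w))) ->
    moments P (fun w => H (X w, Y w)) ->
    (\int[P]_w (H (X w, Y w))%:E = \int[distribution P X']_x \int[P]_w (H (x, Y w))%:E)%E.
  move=> mH H1 H2.
  transitivity (\int[distribution P XY]_z (H z)%:E)%E.
    rewrite integral_distribution//; first exact/measurable_EFinP.
    exact: (moments_int H2).
  transitivity (\int[distribution P X' \x distribution P Y']_z (H z)%:E)%E.
    by apply: eq_measure_integral => A mA _; apply: esym; exact: law.
  have iH : (distribution P X' \x distribution P Y')%E.-integrable setT (EFin \o H).
    apply/integrableP; split; first exact/measurable_EFinP.
    have -> : (\int[distribution P X' \x distribution P Y']_z `|(EFin \o H) z| =
              \int[distribution P XY]_z `|(EFin \o H) z|)%E.
      by apply: eq_measure_integral => A mA _; exact: law.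
    rewrite ge0_integral_distribution//=; last first.
      by apply/measurable_EFinP/measurableT_comp.
    by have /integrableP[] := moments_int H2.
  rewrite -integral12_prod_meas1//; apply: eq_integral => x _.
  rewrite /fubini_F integral_distribution//.
    by apply/measurable_EFinP; apply: measurableT_comp.
  exact: (moments_int (H1 x)).
rewrite /Ex /Rintegral !intE//; congr fine; apply: eq_integral => x _.
have := FG x; rewrite /Ex /Rintegral => /eqP; rewrite -eqe !fineK.
- by move=> /eqP.
- exact/integrable_fin_num/moments_int.
- exact/integrable_fin_num/moments_int.
Qed.

(** Both sides are finite measures in [A], and rectangles form a generating class stable under
    intersection. With [c] the probability of an event, this peels one variable off a product rule
    known on rectangles. *)
Lemma rectangle_ext (X : T -> T1) (Y : T -> T2) (E E' : set T) (c : R) :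
  measurable_fun setT X -> measurable_fun setT Y -> measurable E ->
  measurable E' -> 0 <= c ->
  (forall A B, measurable A -> measurable B ->
     P (X @^-1` A `&` Y @^-1` B `&` E) =
     (c%:E * P (X @^-1` A `&` Y @^-1` B `&` E'))%E) ->
  forall A : set (T1 * T2), measurable A ->
  P ((fun w => (X w, Y w)) @^-1` A `&` E) =
  (c%:E * P ((fun w => (X w, Y w)) @^-1` A `&` E'))%E.
Proof.
move=> mX mY mE mE' c0 H A mA.
have mXY : measurable_fun setT (fun w => (X w, Y w)).
  exact: measurable_fun_pair.
pose XY w := (X w, Y w).
pose pf (m : {measure set T -> \bar R}) : {measure set (T1 * T2) -> \bar R} :=
  measure_function_pushforward__canonical__measure_function_Measure m mXY.
pose m1 := pf (mrestr P mE).
pose m2 : {measure set (T1 * T2) -> \bar R} := mscale (NngNum c0) (pf (mrestr P mE')).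
pose C : set (set (T1 * T2)) :=
  [set C | exists A, measurable A /\ exists B, measurable B /\ C = A `*` B].
suff : m1 A = m2 A by [].
apply: (measure_unique C (fun=> setT)) => //.
- rewrite measurable_prod_measurableType //; congr (<<s _ >>).
  rewrite predeqE; split => [[A' mA' [B mB <-]]|[A' [mA' [B [mB ->]]]]].
    by exists A'; split => //; exists B.
  by exists A' => //; exists B.
- move=> /= _ _ [X1 [mX1 [X2 [mX2 ->]]]] [Y1 [mY1 [Y2 [mY2 ->]]]].
  rewrite -setXI; exists (X1 `&` Y1); split; first exact: measurableI.
  by exists (X2 `&` Y2); split => //; exact: measurableI.
- by move=> _; exists setT; split => //; exists setT; split => //; rewrite setXTT.
- exact: bigcup_const.
- by move=> _ [A' [mA' [B [mB ->]]]]; exact: H.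
- move=> _; rewrite /m1 /= /pushforward /mrestr/=.
  apply: (@le_lt_trans _ _ 1%E); last exact: ltry.
  by rewrite preimage_setT setTI; exact: probability_le1.
Qed.

End Transfer.

Lemma indep_comp d1 d2 d3 (T1 : measurableType d1) (T2 : measurableType d2)
    (T3 : measurableType d3) (X : T -> T1) (Y : T -> T2) (f : T1 -> T3) :
  measurable_fun setT f -> indep X Y -> indep (f \o X) Y.
Proof.
move=> mf iXY A B mA mB; rewrite comp_preimage; apply: iXY => //.
by rewrite -[_ @^-1` _]setTI; exact: mf.
Qed.

Section FourVariables.
Variables X1 X2 X3 X4 : T -> R.
Hypotheses (m1 : measurable_fun setT X1) (m2 : measurable_fun setT X2)
  (m3 : measurable_fun setT X3) (m4 : measurable_fun setT X4).
Hypothesis rect : forall A B C D : set R, measurable A -> measurable B ->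
  measurable C -> measurable D ->
  P (X1 @^-1` A `&` X2 @^-1` B `&` X3 @^-1` C `&` X4 @^-1` D) =
  (P (X1 @^-1` A) * P (X2 @^-1` B) * P (X3 @^-1` C) * P (X4 @^-1` D))%E.

Lemma rect_split (A B C D : set R) : measurable A -> measurable B ->
  measurable C -> measurable D ->
  P (X1 @^-1` A `&` X2 @^-1` B `&` X3 @^-1` C `&` X4 @^-1` D) =
  (P (X1 @^-1` A `&` X2 @^-1` B `&` X3 @^-1` C) * P (X4 @^-1` D))%E.
Proof.
move=> mA mB mC mD; rewrite rect//; congr (_ * _)%E.
have := rect mA mB mC measurableT.
by rewrite preimage_setT setIT probability_setT mule1 => ->.
Qed.

(** [rectangle_ext] is used twice, the event on [X4] entering through [E]: first for the pair of
    [(X1, X2)] and [X3], then for [X1] and [X2], with the event on [X3] moved into both [E] and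
    [E']. *)
Lemma indep_triple :
  indep (fun w => ((X1 w, X2 w), X3 w)) X4.
Proof.
move=> A D mA mD; rewrite muleC.
have mD' : measurable (X4 @^-1` D) by exact: measurable_preimage.
have pD : P (X4 @^-1` D) = (fine (P (X4 @^-1` D)))%:E.
  by rewrite fineK// fin_num_measure.
have pD0 : 0 <= fine (P (X4 @^-1` D)) by rewrite fine_ge0.
have := @rectangle_ext _ _ _ _ (fun w => (X1 w, X2 w)) X3 _ setT _
  (measurable_fun_pair m1 m2) m3 mD' measurableT pD0.
rewrite -pD => /(_ _ A mA); rewrite setIT; apply => {mA}A C mA mC.
rewrite setIT -setIA.
have mC' : measurable (X3 @^-1` C) by exact: measurable_preimage.
have := @rectangle_ext _ _ _ _ X1 X2 (X3 @^-1` C `&` X4 @^-1` D) (X3 @^-1` C) _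
  m1 m2 (measurableI _ _ mC' mD') mC' pD0.
rewrite -pD => /(_ _ A mA); apply => {mA}A B mA mB.
by rewrite setIA rect_split// muleC.
Qed.

End FourVariables.
End Independence.

(** * Gaussian variables and Stein's identity *)

Section GaussianDensity.
Context {R : realType}.
Notation mu := (@lebesgue_measure R).

(** Indexed by the variance, not the standard deviation: increments of Brownian motion have the
    elapsed time as variance. *)
Definition gpdf (s x : R) : R := normal_pdf 0 (Num.sqrt s) x.

Lemma gpdfE s x : 0 < s ->
  gpdf s x = normal_peak (Num.sqrt s) * expR (- (x ^+ 2 / (2 * s))).
Proof.
move=> s0; rewrite /gpdf normal_pdfE ?gt_eqF ?sqrtr_gt0//.
rewrite /normal_fun subr0 sqr_sqrtr ?ltW//; congr (_ * expR _).
by rewrite mulNr -mulr_natl.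
Qed.

Lemma gpdf_ge0 s x : 0 <= gpdf s x. Proof. exact: normal_pdf_ge0. Qed.

Lemma continuous_gpdf s : 0 < s -> continuous (gpdf s).
Proof. by move=> s0; apply: continuous_normal_pdf; rewrite gt_eqF ?sqrtr_gt0. Qed.

Lemma der_gpdf s : 0 < s -> der (gpdf s) (fun x => - (x / s) * gpdf s x).
Proof.
move=> s0 x.
have -> : gpdf s = fun x => normal_peak (Num.sqrt s) * expR (- (x ^+ 2 / (2 * s))).
  by apply/funext => y; exact: gpdfE.
have d1 : der (fun x : R => - (x * x * (2 * s)^-1)) (fun x => - (x / s)).
  apply: (der_eq (derN (derM (derM (@der_id R) (@der_id R)) (der_cst _)))) => y.
  by field; rewrite gt_eqF.
have d2 : der (@expR R) (@expR R) by move=> y; exact: is_derive_expR.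
rewrite mulrCA [_ * expR _]mulrC.
exact: (derZ _ (der_comp d2 d1)).
Qed.

(** With [y = x^2 / (4 s)] the density contains [exp(- y)] twice. One factor is the density of
    variance [2 s] up to normalisation; the other absorbs the polynomial through
    [y^(m+1) / (m+1)! <= exp y]. *)
Lemma gpdf_growth s m : 0 < s ->
  exists2 C, 0 <= C & forall x, (1 + `|x|) ^+ m * gpdf s x <= C * gpdf (2 * s) x.
Proof.
move=> s0.
have pk0 u : 0 < u -> 0 < @normal_peak R (Num.sqrt u).
  by move=> u0; rewrite normal_peak_gt0// gt_eqF// sqrtr_gt0.
have s20 : 0 < 2 * s by rewrite mulr_gt0.
pose A := 2 ^+ m * (1 + (1 + (4 * s) ^+ m.+1 * m.+1`!%:R)).
have A0 : 0 <= A.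
  by rewrite mulr_ge0 ?exprn_ge0// !addr_ge0// mulr_ge0 ?exprn_ge0 ?mulr_ge0 ?ltW.
exists (A * normal_peak (Num.sqrt s) / normal_peak (Num.sqrt (2 * s))).
  by rewrite divr_ge0 ?normal_peak_ge0// mulr_ge0 ?normal_peak_ge0.
move=> x; rewrite !gpdfE//.
rewrite [leRHS](_ : _ = normal_peak (Num.sqrt s) *
  (A * expR (- (x ^+ 2 / (2 * (2 * s)))))); last first.
  move: (pk0 _ s20); set b := normal_peak (Num.sqrt (2 * s)) => b0.
  by field; rewrite gt_eqF.
rewrite mulrCA ler_pM2l ?pk0//.
pose y := x ^+ 2 / (4 * s).
have y0 : 0 <= y by rewrite divr_ge0 ?sqr_ge0 ?mulr_ge0 ?ltW.
have -> : x ^+ 2 / (2 * s) = y + y by rewrite /y; field; rewrite gt_eqF.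
have -> : x ^+ 2 / (2 * (2 * s)) = y by rewrite /y; field; rewrite gt_eqF.
rewrite opprD expRD mulrA ler_pM2r ?expR_gt0//.
rewrite -(ler_pM2r (expR_gt0 y)) -mulrA -expRD addNr expR0 mulr1.
have e1 : 1 <= expR y by rewrite -expR0 ler_expR.
have e2 : y ^+ m.+1 / m.+1`!%:R <= expR y.
  by apply: le_trans (expR_ge1Dxn m y0); rewrite lerDr.
have f0 : 0 < (m.+1)`!%:R :> R by rewrite ltr0n fact_gt0.
have e3 : x ^+ 2 ^+ m.+1 <= (4 * s) ^+ m.+1 * m.+1`!%:R * expR y.
  have -> : x ^+ 2 = 4 * s * y by rewrite /y; field; rewrite gt_eqF.
  rewrite exprMn -mulrA ler_pM2l ?exprn_gt0 ?mulr_gt0//.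
  by rewrite mulrC -ler_pdivrMr.
have e4 : `|x| ^+ m <= 1 + x ^+ 2 ^+ m.+1.
  have [x1|/ltW x1] := leP `|x| 1.
    by rewrite (@le_trans _ _ 1)// ?exprn_ile1// lerDl exprn_ge0 ?sqr_ge0.
  rewrite -real_normK ?num_real// -exprM (@le_trans _ _ (`|x| ^+ (2 * m.+1)))//.
    by rewrite ler_weXn2l// (leq_trans (leqnSn m))// leq_pmull.
  by rewrite lerDr.
apply: (@le_trans _ _ (2 ^+ m * (1 + `|x| ^+ m))).
  by rewrite -[X in X + `|x| ^+ m](expr1n _ m); exact: exprD_le.
rewrite /A -mulrA ler_wpM2l ?exprn_ge0// mulrDl mulrDl !mul1r.
by rewrite lerD// (le_trans e4)// lerD.
Qed.

Lemma integrable_gpdf_polygrowth s f : 0 < s -> measurable_fun setT f ->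
  polygrowth f -> mu.-integrable setT (EFin \o (fun x => f x * gpdf s x)).
Proof.
move=> s0 mf [C [m [C0 fC]]]; have [D D0 DP] := gpdf_growth m s0.
have mp : measurable_fun setT (gpdf s) by exact: measurable_normal_pdf.
apply: (@le_integrable _ _ _ mu _ _ _ (EFin \o (fun x => C * D * gpdf (2 * s) x))) => //.
- by apply/measurable_EFinP; exact: measurable_funM.
- move=> x _ /=; rewrite lee_fin [leRHS]ger0_norm ?mulr_ge0 ?gpdf_ge0//.
  rewrite normrM (ger0_norm (gpdf_ge0 _ _)) -mulrA.
  apply: (@le_trans _ _ (C * (1 + `|x|) ^+ m * gpdf s x)).
    by rewrite ler_wpM2r ?gpdf_ge0.
  by rewrite -mulrA ler_wpM2l.
- exact: (integrableZl measurableT (C * D) (integrable_normal_pdf 0 (Num.sqrt (2 * s)))).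
Qed.

(** The Radon-Nikodym derivative of the normal law and [normal_pdf] have equal integrals over every
    measurable set, so they agree almost everywhere. *)
Lemma ge0_integral_normal_prob (sigma : R) (f : R -> \bar R) :
  measurable_fun setT f -> (forall x, 0 <= f x)%E ->
  (\int[normal_prob 0 sigma]_x f x =
   \int[mu]_x (f x * (normal_pdf 0 sigma x)%:E))%E.
Proof.
move=> mf f0.
rewrite -(@Radon_Nikodym_SigmaFinite.change_of_variables _ _ _ _ mu)//; last first.
  exact: normal_prob_dominates.
apply: ae_eq_integral => //.
- apply: emeasurable_funM => //; apply: (measurable_int mu).
  exact/Radon_Nikodym_SigmaFinite.f_integrable/normal_prob_dominates.
- by apply: emeasurable_funM => //; apply/measurable_EFinP; exact: measurable_normal_pdf.
- apply: ae_eqe_mul2l => /=.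
  apply: integral_ae_eq => //=.
  + exact/Radon_Nikodym_SigmaFinite.f_integrable/normal_prob_dominates.
  + by apply/measurable_EFinP; exact: measurable_normal_pdf.
  + by move=> E _ mE; rewrite -Radon_Nikodym_SigmaFinite.f_integral//; exact: normal_prob_dominates.
Qed.

End GaussianDensity.

Section GaussianVariables.
Context {R : realType}.
Notation mu := (@lebesgue_measure R).

(** By dominated convergence the integral is the limit of [F n - F (- n)], which is at most
    [2 K / (1 + n)] in absolute value. *)
Lemma Rintegral_der_eq0 (F f : R -> R) K : der F f -> continuous f ->
  mu.-integrable setT (EFin \o f) -> (forall x, `|F x| <= K / (1 + `|x|)) ->
  \int[mu]_x f x = 0.
Proof.
move=> dF cf intf FK.
have mf : measurable_fun setT f by exact: continuous_measurable_fun.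
pose J n : set R := `[- n%:R, n%:R]%classic.
pose fn n x := (EFin \o (f \_ (J n))) x.
have [] := @dominated_convergence _ _ _ mu setT measurableT fn (EFin \o f) (abse \o (EFin \o f)).
- move=> n; apply/measurable_EFinP.
  apply/(measurable_restrictT f (measurable_itv _)).
  exact: measurable_funTS.
- exact/measurable_EFinP.
- apply/aeW => x _; apply: cvg_near_cst.
  near=> n; rewrite /fn /= patchE ifT// inE /J /= in_itv/= -ler_norml.
  by near: n; exact: nbhs_infty_ger.
- by have := integrable_abse intf.
- apply/aeW => x n _; rewrite /fn /= lee_fin patchE; case: ifP => // _.
  by rewrite normr0.
move=> _ _ cv.
have E n : (\int[mu]_x fn n x = (F n%:R - F (- n%:R))%:E)%E.
  rewrite -(der_FTC dF cf); last by have := ler0n R n; lra.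
  rewrite /Rintegral fineK; last first.
    by apply: integrable_fin_num => //; exact: continuous_itv_integrable.
  rewrite [RHS]integral_mkcond; apply: eq_integral => x _.
  by rewrite /fn /= restrict_EFin.
have c0 : (\int[mu]_x fn n x)%E @[n --> \oo] --> 0%:E.
  under eq_fun do rewrite E.
  apply: cvg_EFin; first exact: nearW.
  apply/cvgr0Pnorm_le => e e0; near=> n.
  have nK : 2 * K / e <= n%:R by near: n; exact: nbhs_infty_ger.
  rewrite ler_pdivrMr// in nK.
  have FK1 := FK n%:R; have FK2 := FK (- n%:R).
  rewrite normrN in FK2; rewrite (ger0_norm (ler0n _ _)) in FK1 FK2.
  have Ke : K / (1 + n%:R) <= e / 2 by rewrite ler_pdivrMr ?ltr_wpDr//; lra.
  by rewrite (le_trans (ler_normB _ _))//; lra.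
have := cvg_unique _ cv c0.
by rewrite /Rintegral => ->.
Unshelve. all: by end_near. Qed.

Context {d : measure_display} {T : measurableType d}.
Variable P : probability T R.

(** The condition [0 < s] excludes point masses, so increments over an interval of length 0 are
    treated apart. *)
Definition gaussian (Y : T -> R) (s : R) : Prop :=
  [/\ 0 < s, measurable_fun setT Y & forall B, measurable B ->
      P (Y @^-1` B) = normal_prob 0 (Num.sqrt s) B].

Lemma gaussian_ge0_integral Y s (f : R -> R) : gaussian Y s ->
  measurable_fun setT f -> (forall x, 0 <= f x) ->
  (\int[P]_w (f (Y w))%:E = \int[mu]_x (f x * gpdf s x)%:E)%E.
Proof.
move=> [s0 mY YE] mf f0.
have mY' : @measurable_fun _ _ T (measurableTypeR R) setT Y by exact: mY.
pose Y' : {mfun T >-> measurableTypeR R} := @mfun_Sub _ _ T (measurableTypeR R) Y (mem_set mY').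
have mf' : measurable_fun setT (EFin \o f) by exact/measurable_EFinP.
transitivity (\int[distribution P Y']_x (EFin \o f) x)%E.
  by rewrite ge0_integral_distribution//= => y; rewrite lee_fin.
transitivity (\int[normal_prob 0 (Num.sqrt s)]_x (EFin \o f) x)%E.
  by apply: eq_measure_integral => A mA _; exact: YE.
rewrite ge0_integral_normal_prob//= => y; by rewrite lee_fin.
Qed.

Lemma gaussian_moments Y s : gaussian Y s -> moments P Y.
Proof.
move=> gY; have [s0 mY _] := gY; split=> // m.
apply/integrableP; split.
  by apply/measurable_EFinP/measurable_funX; exact: measurableT_comp.
have mf : measurable_fun setT (fun x : R => `|x| ^+ m).
  by apply/measurable_funX.
under eq_integral do rewrite /= normrX normr_id.
rewrite (gaussian_ge0_integral gY mf) => [|x]; last exact: exprn_ge0.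
have pg : polygrowth (fun x : R => `|x| ^+ m).
  exists 1, m; split => // x; rewrite normrX normr_id mul1r.
  by rewrite lerXn2r ?nnegrE ?addr_ge0// lerDr.
have /integrableP[_] := integrable_gpdf_polygrowth s0 mf pg.
apply: le_lt_trans; apply: ge0_le_integral => //=.
- by move=> x _; rewrite lee_fin mulr_ge0 ?gpdf_ge0// exprn_ge0.
- by apply/measurable_EFinP; apply: measurable_funM => //; exact: measurable_normal_pdf.
- apply/measurable_EFinP; apply: measurableT_comp => //.
  by apply: measurable_funM => //; exact: measurable_normal_pdf.
- by move=> x _; rewrite lee_fin ler_norm.
Qed.

Lemma gaussian_ge0_Ex Y s (f : R -> R) : gaussian Y s ->
  measurable_fun setT f -> (forall x, 0 <= f x) ->
  Ex P (fun w => f (Y w)) = \int[mu]_x (f x * gpdf s x).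
Proof. by move=> gY mf f0; rewrite /Ex /Rintegral (gaussian_ge0_integral gY). Qed.

(** A polynomial majorant [g] of [|f|] makes [f + g] nonnegative; the formula for [g] is then
    subtracted. *)
Lemma gaussian_Ex Y s (f : R -> R) : gaussian Y s ->
  measurable_fun setT f -> polygrowth f ->
  Ex P (fun w => f (Y w)) = \int[mu]_x (f x * gpdf s x).
Proof.
move=> gY mf pf; have [s0 mY _] := gY; have mY' := gaussian_moments gY.
have [C [m [C0 fC]]] := pf.
pose g (x : R) := C * (1 + `|x|) ^+ m.
have g0 x : 0 <= g x by rewrite mulr_ge0// exprn_ge0// addr_ge0.
have mg : measurable_fun setT g.
  by apply: measurable_funM => //; apply/measurable_funX/measurable_funD.
have pg : polygrowth g.
  by exists C, m; split => // x; rewrite ger0_norm.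
have gf0 x : 0 <= f x + g x.
  have := fC x; rewrite ler_norml => /andP[+ _].
  by rewrite -/(g x); lra.
have mfY : moments P (fun w => f (Y w)) by exact: moments_comp.
have mgY : moments P (fun w => g (Y w)) by exact: moments_comp.
transitivity (Ex P (fun w => f (Y w) + g (Y w)) - Ex P (fun w => g (Y w))).
  by rewrite ExD// addrK.
rewrite (@gaussian_ge0_Ex _ _ (fun x => f x + g x) gY)//; last exact: measurable_funD.
rewrite (@gaussian_ge0_Ex _ _ g gY)//.
under eq_Rintegral do rewrite mulrDl.
by rewrite RintegralD// ?addrK//; exact: integrable_gpdf_polygrowth.
Qed.

Lemma polygrowthD (f g : R -> R) : polygrowth f -> polygrowth g ->
  polygrowth (fun x => f x + g x).
Proof.
move=> [C [m [C0 fC]]] [D [n [D0 gD]]]; exists (C + D), (m + n)%N.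
split=> [|x]; first exact: addr_ge0.
have x1 : 1 <= 1 + `|x| by rewrite lerDl.
rewrite (le_trans (ler_normD _ _))// mulrDl lerD//.
  by rewrite (le_trans (fC x))// ler_wpM2l// ler_weXn2l// leq_addr.
by rewrite (le_trans (gD x))// ler_wpM2l// ler_weXn2l// leq_addl.
Qed.

Lemma polygrowthM (f g : R -> R) : polygrowth f -> polygrowth g ->
  polygrowth (fun x => f x * g x).
Proof.
move=> [C [m [C0 fC]]] [D [n [D0 gD]]]; exists (C * D), (m + n)%N.
split=> [|x]; first exact: mulr_ge0.
by rewrite normrM exprD mulrACA ler_pM.
Qed.

Lemma polygrowth_cst (c : R) : polygrowth (fun=> c).
Proof. by exists `|c|, 0%N; split => // x; rewrite expr0 mulr1. Qed.

Lemma polygrowth_id : polygrowth (fun x : R => x).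
Proof. by exists 1, 1%N; split => // x; rewrite expr1 mul1r lerDr. Qed.

Lemma polygrowthX (f : R -> R) m : polygrowth f -> polygrowth (fun x => f x ^+ m).
Proof.
move=> pf; elim: m => [|m IH]; first exact: polygrowth_cst.
by under eq_fun do rewrite exprS; exact: polygrowthM.
Qed.

Lemma polygrowth_bounded (f : R -> R) M : (forall x, `|f x| <= M) -> polygrowth f.
Proof.
move=> fM; exists M, 0%N; split => [|x]; last by rewrite expr0 mulr1.
exact: le_trans (fM 0).
Qed.

Lemma polygrowth_shift (f : R -> R) y : polygrowth f -> polygrowth (fun x => f (x + y)).
Proof.
move=> [C [m [C0 fC]]]; exists (C * (1 + `|y|) ^+ m), m; split => [|x].
  by rewrite mulr_ge0// exprn_ge0// addr_ge0.
rewrite (le_trans (fC _))// -mulrA ler_wpM2l// -exprMn.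
rewrite lerXn2r ?nnegrE ?mulr_ge0 ?addr_ge0//.
have := ler_normD x y; have := normr_ge0 x; have := normr_ge0 y; nra.
Qed.

(** The density [rho] satisfies [rho' = - x rho / s], so [(f rho)' = f' rho - x f rho / s] has
    integral 0. The extra power [m.+1] in [gpdf_growth] supplies the decay [1 / (1 + |x|)] of
    [f rho]. *)
Lemma gaussian_stein Y s (f f' : R -> R) : gaussian Y s -> der f f' ->
  continuous f' -> polygrowth f -> polygrowth f' ->
  Ex P (fun w => Y w * f (Y w)) = s * Ex P (fun w => f' (Y w)).
Proof.
move=> gY df cf' pf pf'; have [s0 mY _] := gY.
have cf := der_continuous df.
have mf := continuous_measurable_fun cf.
have mf' := continuous_measurable_fun cf'.
have pxf : polygrowth (fun x => x * f x) by apply: polygrowthM => //; exact: polygrowth_id.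
have mxf : measurable_fun setT (fun x : R => x * f x) by exact: measurable_funM.
rewrite (gaussian_Ex gY mxf pxf) (gaussian_Ex gY mf' pf').
have i1 := integrable_gpdf_polygrowth s0 mxf pxf.
have i2 := integrable_gpdf_polygrowth s0 mf' pf'.
have i3 : mu.-integrable setT (EFin \o (fun x => s^-1 * (x * f x * gpdf s x))).
  exact: (integrableZl measurableT s^-1 i1).
have dg := der_gpdf s0.
pose q x := f' x * gpdf s x - s^-1 * (x * f x * gpdf s x).
have dq : der (fun x => f x * gpdf s x) q.
  by apply: (der_eq (derM df dg)) => x; rewrite /q; ring.
have cq : continuous q.
  move=> x; apply: cvgB; apply: cvgM; [exact: cf'|exact: continuous_gpdf|exact: cvg_cst|].
  by apply: cvgM; [apply: cvgM; [exact: cvg_id|exact: cf]|exact: continuous_gpdf].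
have iq : mu.-integrable setT (EFin \o q) by exact: (integrableB measurableT i2 i3).
have [C [m [C0 fC]]] := pf.
have [D D0 DP] := gpdf_growth m.+1 s0.
have s20 : 0 < 2 * s by rewrite mulr_gt0.
have := @Rintegral_der_eq0 _ q (C * (D * normal_peak (Num.sqrt (2 * s)))) dq cq iq.
rewrite RintegralB// RintegralZl// => H.
suff: s^-1 * \int[mu]_x (x * f x * gpdf s x) = \int[mu]_x (f' x * gpdf s x).
  by move=> <-; rewrite mulVKf// gt_eqF.
apply/eqP; rewrite eq_sym -subr_eq0; apply/eqP/H => x.
have x0 : 0 < 1 + `|x| by rewrite ltr_wpDr.
rewrite ler_pdivlMr// normrM (ger0_norm (gpdf_ge0 _ _)).
apply: (@le_trans _ _ (C * ((1 + `|x|) ^+ m.+1 * gpdf s x))).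
  rewrite exprSr (mulrC (_ ^+ m)) -!mulrA mulrCA mulrA mulrA.
  rewrite [leRHS](_ : _ = (1 + `|x|) * (C * (1 + `|x|) ^+ m * gpdf s x)); last ring.
  rewrite [leLHS](_ : _ = (1 + `|x|) * (`|f x| * gpdf s x)); last ring.
  by rewrite ler_pM2l// ler_wpM2r ?gpdf_ge0.
rewrite ler_wpM2l// (le_trans (DP x))// ler_wpM2l//.
by apply: normal_pdf_ub; rewrite gt_eqF// sqrtr_gt0.
Qed.

End GaussianVariables.

Section GaussianMoments.
Context {R : realType} {d : measure_display} {T : measurableType d}.
Variable P : probability T R.
Notation mu := (@lebesgue_measure R).

(** Stein's identity for each frozen value of [X], then [indep_Ex_eq]. *)
Lemma indep_stein d1 (T1 : measurableType d1) (X : T -> T1) (Y : T -> R) s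
    (F F' : T1 -> R -> R) :
  measurable_fun setT X -> gaussian P Y s -> indep P X Y ->
  (forall x, der (F x) (F' x)) -> (forall x, continuous (F' x)) ->
  (forall x, polygrowth (F x)) -> (forall x, polygrowth (F' x)) ->
  measurable_fun setT (fun z : T1 * R => F z.1 z.2) ->
  measurable_fun setT (fun z : T1 * R => F' z.1 z.2) ->
  moments P (fun w => F (X w) (Y w)) -> moments P (fun w => F' (X w) (Y w)) ->
  Ex P (fun w => Y w * F (X w) (Y w)) = s * Ex P (fun w => F' (X w) (Y w)).
Proof.
move=> mX gY iXY dF cF' pF pF' mF mF' MF MF'.
have [s0 mY _] := gY; have MY := gaussian_moments gY.
have mFx x : measurable_fun setT (F x) by exact: (continuous_measurable_fun (der_continuous (dF x))).
have mFx' x : measurable_fun setT (F' x) by exact: (continuous_measurable_fun (cF' x)).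
rewrite -ExZ//.
apply: (@indep_Ex_eq _ _ _ P _ _ _ _ X Y (fun z => z.2 * F z.1 z.2)
  (fun z => s * F' z.1 z.2)) => //=.
- exact: measurable_funM.
- exact: measurable_funM.
- by move=> x; apply: momentsM => //; exact: (moments_comp (mFx x)).
- by move=> x; apply: momentsZ; exact: (moments_comp (mFx' x)).
- exact: momentsM.
- exact: momentsZ.
- move=> x; rewrite ExZ; last exact: (moments_comp (mFx' x)).
  exact: gaussian_stein.
Qed.

Lemma indep_Ex_mul d1 (T1 : measurableType d1) (X : T -> T1) (Y : T -> R)
    (f : T1 -> R) (phi : R -> R) :
  measurable_fun setT X -> measurable_fun setT Y -> indep P X Y ->
  measurable_fun setT f -> measurable_fun setT phi ->
  moments P (fun w => f (X w)) -> moments P (fun w => phi (Y w)) ->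
  Ex P (fun w => f (X w) * phi (Y w)) =
  Ex P (fun w => f (X w)) * Ex P (fun w => phi (Y w)).
Proof.
move=> mX mY iXY mf mphi Mf Mphi.
rewrite mulrC -ExZ//.
apply: (@indep_Ex_eq _ _ _ P _ _ _ _ X Y (fun z => f z.1 * phi z.2)
  (fun z => Ex P (fun w => phi (Y w)) * f z.1)) => //=.
- by apply: measurable_funM; exact: measurableT_comp.
- by apply: measurable_funM => //; exact: measurableT_comp.
- by move=> x; exact: momentsZ.
- by move=> x; exact: moments_cst.
- exact: momentsM.
- exact: momentsZ.
- by move=> x; rewrite ExZ// Ex_cst mulrC.
Qed.

Variables (Y : T -> R) (s : R).
Hypothesis gY : gaussian P Y s.

Lemma gaussian_pow n :
  Ex P (fun w => Y w ^+ n.+2) = s * n.+1%:R * Ex P (fun w => Y w ^+ n).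
Proof.
have MY := gaussian_moments gY.
have d1 : der (fun x : R => x ^+ n.+1) (fun x => n.+1%:R * x ^+ n).
  elim: n => [|n IH].
    apply: (der_eq (f := fun=> 1)); last by move=> x; rewrite expr0 mulr1.
    by have := @der_id R; congr der; apply/funext => x; rewrite expr1.
  have := derM (@der_id R) IH; under eq_fun do rewrite -exprS.
  move=> H; apply: (der_eq H) => x.
  by rewrite -[n.+2%:R]natr1 !exprS; ring.
have pX m : polygrowth (fun x : R => x ^+ m) by apply: polygrowthX; exact: polygrowth_id.
have cX : continuous (fun x : R => n.+1%:R * x ^+ n).
  by move=> x; apply: cvgM; [exact: cvg_cst|exact: exprn_continuous].
have pcX : polygrowth (fun x : R => n.+1%:R * x ^+ n).
  by apply: polygrowthM => //; exact: polygrowth_cst.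
have := gaussian_stein gY d1 cX (pX _) pcX.
rewrite ExZ; last exact: momentsX.
by rewrite mulrA => <-; congr Ex; apply/funext => w; rewrite -exprS.
Qed.

Lemma gaussian_mean : Ex P Y = 0.
Proof.
have := gaussian_stein gY (@der_cst R 1) (fun x => cvg_cst 0)
  (polygrowth_cst 1) (polygrowth_cst 0).
by rewrite Ex_cst mulr0 => <-; congr Ex; apply/funext => w; rewrite mulr1.
Qed.

Lemma gaussian_var : Ex P (fun w => Y w ^+ 2) = s.
Proof.
rewrite gaussian_pow mulr1 (_ : (fun w => _) = fun=> 1) ?Ex_cst ?mulr1//.
Qed.

Lemma gaussian_pow4 : Ex P (fun w => Y w ^+ 4) = 3 * s ^+ 2.
Proof. by rewrite gaussian_pow gaussian_var; ring. Qed.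

Lemma gaussian_pow6 : Ex P (fun w => Y w ^+ 6) = 15 * s ^+ 3.
Proof. by rewrite gaussian_pow gaussian_pow4; ring. Qed.

(* On [[- sqrt s, sqrt s]] the density of [Y] is at least [1 / (6 sqrt s)], and whole
   periods of [f] fill at least half of this interval. *)
Lemma gaussian_periodic_lb (F f : R -> R) (q c M : R) : 0 < q -> q ^+ 2 <= s ->
  der F f -> continuous f -> (forall x, 0 <= f x <= M) ->
  (forall x, F (x + q) = F x + c) -> c / q / 6 <= Ex P (fun w => f (Y w)).
Proof.
move=> q0 qs dF cf fM Fq.
have [s0 mY _] := gY.
have fM' x : `|f x| <= M by have /andP[H1 H2] := fM x; rewrite (ger0_norm H1).
have f0 x : 0 <= f x by have /andP[] := fM x.
have mf := continuous_measurable_fun cf.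
rewrite (gaussian_Ex gY mf (polygrowth_bounded fM')).
have Fn n x : F (x + n%:R * q) = F x + n%:R * c.
  elim: n => [|n IH]; first by rewrite !mul0r !addr0.
  by rewrite -natr1 !mulrDl !mul1r addrA Fq IH addrA.
pose r := Num.sqrt s.
have r0 : 0 < r by rewrite sqrtr_gt0.
have qr : q <= r.
  have : q ^+ 2 <= r ^+ 2 by rewrite sqr_sqrtr// ltW.
  by rewrite ler_sqr ?nnegrE ?(ltW q0) ?(ltW r0).
pose n := Num.truncn (r / q).
have nr : n%:R * q <= r.
  by rewrite -ler_pdivlMr// truncn_le divr_ge0// ltW.
have nr2 : r <= 2 * (n%:R * q).
  have n1 : 1 <= n%:R :> R.
    by rewrite ler1n /n truncn_gt0 ler_pdivlMr ?mul1r.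
  have : r / q < n.+1%:R by exact: truncnS_gt.
  rewrite ltr_pdivrMr// -natr1 => H.
  have : q <= n%:R * q by rewrite ler_peMl// ltW.
  lra.
pose a := n%:R * q.
have a0 : 0 <= a by rewrite mulr_ge0// ltW.
pose k := gpdf s r.
have k0 : 0 <= k by exact: gpdf_ge0.
have c0 : 0 <= c.
  have -> : c = F q - F 0 by rewrite -[q]add0r Fq; ring.
  rewrite -(der_FTC dF cf (ltW q0)).
  by apply: Rintegral_ge0.
have pk x : - a <= x <= a -> k <= gpdf s x.
  rewrite -ler_norml => xa; rewrite /k !gpdfE//.
  rewrite ler_pM2l ?normal_peak_gt0 ?gt_eqF// ler_expR lerN2.
  rewrite ler_pM2r ?invr_gt0 ?mulr_gt0//.
  rewrite -[x ^+ 2]real_normK ?num_real// lerXn2r ?nnegrE ?(ltW r0)//.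
  exact: le_trans nr.
(* The product is [exp(-1/2) / sqrt(2 pi)]; the factors are at least [1/2] and, as [pi <= 4],
   [1/3]. *)
have kr : 1 / 6 <= k * r.
  rewrite /k gpdfE// sqr_sqrtr ?(ltW s0)//.
  have -> : s / (2 * s) = 2^-1 by field; rewrite gt_eqF.
  have e2 : 1 / 2 <= expR (- 2^-1 : R) by have := expR_ge1Dx (- 2^-1 : R); lra.
  have p3 : 1 / 3 <= normal_peak r * r.
    rewrite /normal_peak sqr_sqrtr ?(ltW s0)// [leRHS]mulrC.
    rewrite ler_pdivlMr ?sqrtr_gt0; last by rewrite mulrn_wgt0// mulr_gt0// pi_gt0.
    rewrite -ler_sqr ?nnegrE ?mulr_ge0 ?sqrtr_ge0//.
    rewrite exprMn !sqr_sqrtr ?(ltW s0)//; last first.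
      by rewrite mulrn_wge0// mulr_ge0// ?pi_ge0// ltW.
    have p4 : pi <= 4 :> R by have := pihalf_lt2 R; lra.
    have : s * pi <= s * 4 by rewrite ler_wpM2l// ltW.
    rewrite mulr2n; lra.
  rewrite mulrAC.
  apply: (@le_trans _ _ (1 / 3 * (1 / 2))); first lra.
  by apply: ler_pM => //; lra.
(* The interval [[-a, a]] consists of [2 n] periods, so the integral of [f] over it is [2 n c]. *)
apply: (@le_trans _ _ (\int[mu]_x ((fun x => k * f x) \_ `[- a, a]) x)).
  rewrite -Rintegral_mkcond RintegralZl//; last exact: continuous_itv_integrable.
  rewrite (der_FTC dF cf); last lra.
  have -> : F a - F (- a) = 2 * n%:R * c.
    have := Fn n 0; have := Fn n (- a); rewrite -/a addNr add0r => -> ->; ring.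
  rewrite mulrAC ler_pdivrMr//.
  rewrite [leRHS](_ : _ = c * (k * (2 * (n%:R * q)))); last ring.
  rewrite -[c / 6]/(c * (6^-1)) ler_wpM2l//.
  have : k * r <= k * (2 * (n%:R * q)) by rewrite ler_wpM2l.
  lra.
apply: le_Rintegral => //.
- have ik : mu.-integrable `[- a, a] (EFin \o (fun x => k * f x)).
    by apply: continuous_itv_integrable => x; apply: cvgM; [exact: cvg_cst|exact: cf].
  have [H _] := @integrable_mkcond _ _ _ mu _ (EFin \o (fun x => k * f x)) (measurable_itv `[- a, a]%R).
  by have := H ik; rewrite restrict_EFin.
- exact: integrable_gpdf_polygrowth (polygrowth_bounded fM').
move=> x _; rewrite patchE; case: ifPn => [|_].
  by rewrite inE /= in_itv/= => xa; rewrite mulrC ler_wpM2l// pk.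
by rewrite mulr_ge0// gpdf_ge0.
Qed.

End GaussianMoments.

(** * Planar Brownian motion *)

Section MutualIndependence.
Context {R : realType} {d : measure_display} {T : measurableType d}.
Variable P : probability T R.

(** Mutual independence is applied to events [E i] that are [setT] outside the four chosen indices,
    so that all other factors are 1. *)
Lemma mutual_indep_triple (I : finType) (X : I -> T -> R) (i1 i2 i3 i4 : I) :
  (forall i, measurable_fun setT (X i)) -> mutually_independent P X ->
  uniq [:: i1; i2; i3; i4] ->
  indep P (fun w => ((X i1 w, X i2 w), X i3 w)) (X i4).
Proof.
move=> mX iX /=; rewrite !inE !negb_or !andbT.
move=> /andP[/and3P[n12 n13 n14] /andP[/andP[n23 n24] n34]].
apply: indep_triple => // A B C D mA mB mC mD.
pose E i := if i == i1 then A else if i == i2 then B else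
  if i == i3 then C else if i == i4 then D else setT.
have mE i : measurable (E i) by rewrite /E; do 4 (case: ifP => // _).
have E1 : E i1 = A by rewrite /E eqxx.
have E2 : E i2 = B by rewrite /E eq_sym (negbTE n12) eqxx.
have E3 : E i3 = C by rewrite /E eq_sym (negbTE n13) eq_sym (negbTE n23) eqxx.
have E4 : E i4 = D.
  by rewrite /E eq_sym (negbTE n14) eq_sym (negbTE n24) eq_sym (negbTE n34) eqxx.
have := iX E mE.
have -> : \bigcap_(i in [set: I]) X i @^-1` E i =
    X i1 @^-1` A `&` X i2 @^-1` B `&` X i3 @^-1` C `&` X i4 @^-1` D.
  apply/seteqP; split => [w H|w [[[H1 H2] H3] H4] i _].
    have H1 := H i1 Logic.I; have H2 := H i2 Logic.I.
    have H3 := H i3 Logic.I; have H4 := H i4 Logic.I.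
    by rewrite E1 in H1; rewrite E2 in H2; rewrite E3 in H3; rewrite E4 in H4.
  rewrite /preimage /= /E; case: eqP => [->//|_]; case: eqP => [->//|_].
  by case: eqP => [->//|_]; case: eqP => [->//|_].
move=> ->.
have fin i : measurable (X i @^-1` E i) by exact: measurable_preimage.
rewrite (bigD1 i1)//= (bigD1 i2)//=; last by rewrite eq_sym.
rewrite (bigD1 i3)//=; last by rewrite !(eq_sym i3) n13.
rewrite (bigD1 i4)//=; last by rewrite !(eq_sym i4) n14 n24.
rewrite big1 ?mulr1; last first.
  move=> i /andP[/andP[/andP[j1 j2] j3] j4].
  rewrite /E (negbTE j1) (negbTE j2) (negbTE j3) (negbTE j4).
  by rewrite preimage_setT probability_setT.
by rewrite E1 E2 E3 E4 !EFinM !fineK ?muleA// fin_num_measure// -?E1 -?E2 -?E3 -?E4.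
Qed.

End MutualIndependence.

Section Brownian.
Context {R : realType} {d : measure_display} {T : measurableType d}.
Variable P : probability T R.
Variable omega : R -> T -> 'rV[R]_2.
Hypothesis bm : brownian_motion P omega.

Definition bpath (t : R) (w : T) : R := omega t w 0 0.
Definition wpath (t : R) (w : T) : R := omega t w 0 1.

(* Increments over the four intervals between these times encode the past, the
   present and the future in [bm_independent]. *)
Let seq5 (s s' u u' : R) (k : nat) : R := nth u' [:: 0; s; s'; u; u'] k.

Lemma bm_homo (s s' u u' : R) : 0 <= s -> s <= s' -> s' <= u -> u <= u' ->
  {homo seq5 s s' u u' : k l / (k <= l)%N >-> k <= l}.
Proof.
move=> h1 h2 h3 h4; apply: homo_leq => [x|y x z|]; first exact: lexx.
  exact: le_trans.
by case=> [|[|[|[|[|i]]]]] //=; rewrite /seq5 /= ?nth_nil ?lexx.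
Qed.

Lemma bm_coord_measurable t i : 0 <= t -> measurable_fun setT (fun w => omega t w 0 i).
Proof. by move=> t0; exact: (bm_measurable bm). Qed.

Lemma bpath_measurable t : 0 <= t -> measurable_fun setT (bpath t).
Proof. exact: bm_coord_measurable. Qed.

Lemma bm0 w i : omega 0 w 0 i = 0.
Proof. by rewrite (bm_start bm) mxE. Qed.

Lemma bm_gaussian_inc s t i : 0 <= s -> s < t ->
  gaussian P (fun w => omega t w 0 i - omega s w 0 i) (t - s).
Proof.
move=> s0 st; split; first by rewrite subr_gt0.
  apply: measurable_funB; apply: bm_coord_measurable => //.
  by rewrite (le_trans s0)// ltW.
by move=> B mB; exact: (bm_gaussian bm).
Qed.

Lemma bm_gaussian_coord t i : 0 < t -> gaussian P (fun w => omega t w 0 i) t.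
Proof.
move=> t0; have := bm_gaussian_inc i (lexx 0) t0.
rewrite subr0; congr (gaussian P _ _); apply/funext => w.
by rewrite bm0 subr0.
Qed.

Lemma bm_moments t i : 0 <= t -> moments P (fun w => omega t w 0 i).
Proof.
rewrite le_eqVlt => /predU1P[<-|t0]; last exact: (gaussian_moments (bm_gaussian_coord i t0)).
by under eq_fun do rewrite bm0; exact: moments_cst.
Qed.

Lemma bm_inc_mean s t i : 0 <= s -> s <= t ->
  Ex P (fun w => omega t w 0 i - omega s w 0 i) = 0.
Proof.
move=> s0; rewrite le_eqVlt => /predU1P[<-|st]; last exact: (gaussian_mean (bm_gaussian_inc i s0 st)).
by under eq_fun do rewrite subrr; exact: Ex_cst.
Qed.

Lemma bm_indep_inc (s s' u u' : R) (i1 i2 i3 i4 : 'I_4 * 'I_2) :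
  0 <= s -> s <= s' -> s' <= u -> u <= u' ->
  uniq [:: i1; i2; i3; i4] ->
  let X (ki : 'I_4 * 'I_2) w := omega (seq5 s s' u u' ki.1.+1) w 0 ki.2 -
      omega (seq5 s s' u u' ki.1) w 0 ki.2 in
  indep P (fun w => ((X i1 w, X i2 w), X i3 w)) (X i4).
Proof.
move=> h1 h2 h3 h4 un X; apply: mutual_indep_triple => //.
  have hs := bm_homo h1 h2 h3 h4.
  have s0 k : 0 <= seq5 s s' u u' k by apply: (hs 0%N k).
  by move=> i; apply: measurable_funB; exact: bm_coord_measurable.
exact: (bm_independent bm (lexx 0) (bm_homo h1 h2 h3 h4)).
Qed.

Let o4 k : 'I_4 := inord k.

(** The three variables on the left are sums of the increments over [[0, s]], [[s, s']] and
    [[s', u]]. This is what makes centred terms at different grid times orthogonal. *)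
Lemma bpath_indep_past s s' u u' : 0 <= s -> s <= s' -> s' <= u -> u <= u' ->
  indep P (fun w => ((bpath s w, bpath s' w - bpath s w), bpath u w))
    (fun w => bpath u' w - bpath u w).
Proof.
move=> h1 h2 h3 h4.
have := @bm_indep_inc s s' u u' (o4 0, ord0) (o4 1, ord0) (o4 2, ord0) (o4 3, ord0) h1 h2 h3 h4.
rewrite /= /o4 !inordK//= => /(_ _) H.
pose f (z : R * R * R) := ((z.1.1, z.1.2), z.1.1 + z.1.2 + z.2).
have mf : measurable_fun setT f.
  have m1 : measurable_fun setT (fun z : R * R * R => z.1.1) by exact: measurableT_comp.
  have m2 : measurable_fun setT (fun z : R * R * R => z.1.2) by exact: measurableT_comp.
  apply: measurable_fun_pair; first exact: measurable_fun_pair.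
  by apply: measurable_funD => //; exact: measurable_funD.
have := indep_comp mf (H _); rewrite !inE !xpair_eqE !eqxx !andbT -!val_eqE /= !inordK//=.
move=> /(_ isT); congr indep; apply/funext => w; rewrite /f /= !bm0 !subr0.
by congr (_, _, _); rewrite /bpath; ring.
Qed.

Lemma bpath_indep_now u u' : 0 <= u -> u <= u' ->
  indep P (bpath u) (fun w => bpath u' w - bpath u w).
Proof.
move=> h1 h2; have H := bpath_indep_past h1 (lexx u) (lexx u) h2.
have mf : measurable_fun setT (fun z : R * R * R => z.2) by exact: measurable_snd.
exact: (indep_comp mf H).
Qed.

Lemma bpath_indep_mid s s' t : 0 <= s -> s <= s' -> s' <= t ->
  indep P (fun w => (bpath s w, bpath t w - bpath s' w))
    (fun w => bpath s' w - bpath s w).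
Proof.
move=> h1 h2 h3.
(* Index 3 is the empty interval [[t, t]], a filler for the third variable on the left. *)
have := @bm_indep_inc s s' t t (o4 0, ord0) (o4 2, ord0) (o4 3, ord0) (o4 1, ord0) h1 h2 h3 (lexx t).
rewrite /= /o4 !inordK//= => /(_ _) H.
have mf : measurable_fun setT (fun z : R * R * R => z.1) by exact: measurable_fst.
have := indep_comp mf (H _); rewrite !inE !xpair_eqE !eqxx !andbT -!val_eqE /= !inordK//=.
move=> /(_ isT); congr indep; apply/funext => w; rewrite /= !bm0 !subr0//.
Qed.

(** [W_t] is cut at [s] and [s'], since independence is given for increments along a common grid;
    each piece is centred and independent of the two variables of the first coordinate. *)
Lemma wpath_Ex_orthogonal s s' t (f : R * R -> R) : 0 <= s -> s <= s' -> s' <= t ->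
  measurable_fun setT f -> moments P (fun w => f (bpath s w, bpath s' w - bpath s w)) ->
  Ex P (fun w => f (bpath s w, bpath s' w - bpath s w) * wpath t w) = 0.
Proof.
move=> h10 h20 h30 mf Mf.
pose Y w := f (bpath s w, bpath s' w - bpath s w).
have s'0 : 0 <= s' by rewrite (le_trans h10).
have t0 : 0 <= t by rewrite (le_trans s'0).
have E k (kl : (k < 3)%N) : Ex P (fun w => Y w *
    (omega (seq5 s s' t t k.+1) w 0 1 - omega (seq5 s s' t t k) w 0 1)) = 0.
  have := @bm_indep_inc s s' t t (o4 0, ord0) (o4 1, ord0) (o4 3, ord0) (o4 k, 1) h10 h20 h30 (lexx t).
  have k4 : (k < 4)%N by exact: ltn_trans kl _.
  rewrite /= /o4 !inordK//= => /(_ _) H.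
  have mf' : measurable_fun setT (fun z : R * R * R => z.1) by exact: measurable_fst.
  have := indep_comp mf' (H _); rewrite !inE !xpair_eqE !eqxx !andbT -!val_eqE /= !inordK//=.
  rewrite ?andbF /= => /(_ isT) Hk.
  have [k0 k1] : 0 <= seq5 s s' t t k /\ seq5 s s' t t k <= seq5 s s' t t k.+1.
    by case: k kl k4 {H Hk} => [|[|[|//]]] _ _.
  have Mk : moments P (fun w => omega (seq5 s s' t t k.+1) w 0 1 - omega (seq5 s s' t t k) w 0 1).
    by apply: momentsB; apply: bm_moments => //; exact: le_trans k1.
  have mb u : 0 <= u -> measurable_fun setT (bpath u) by exact: bpath_measurable.
  have Hi : indep P (fun w => (bpath s w, bpath s' w - bpath s w))
     (fun w => omega (seq5 s s' t t k.+1) w 0 1 - omega (seq5 s s' t t k) w 0 1).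
    move: Hk; congr indep; apply/funext => w; rewrite /= !bm0 !subr0//.
  rewrite /Y (@indep_Ex_mul _ _ _ P _ _ (fun w => (bpath s w, bpath s' w - bpath s w)) _ f id _ _ Hi)//.
  - by rewrite bm_inc_mean// mulr0.
  - by apply: measurable_fun_pair; [exact: mb|apply: measurable_funB; exact: mb].
  - by case: Mk.
transitivity (Ex P (fun w =>
   Y w * (omega s w 0 1 - omega 0 w 0 1) + Y w * (omega s' w 0 1 - omega s w 0 1) +
   Y w * (omega t w 0 1 - omega s' w 0 1))).
  by congr Ex; apply/funext => w; rewrite bm0 /Y /wpath; ring.
have mm u : 0 <= u -> moments P (fun w => omega u w 0 1) by exact: bm_moments.
have MY : moments P Y by [].
rewrite !ExD.
- by rewrite (E 0%N)// (E 1%N)// (E 2%N)// !addr0.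
- by apply: momentsM => //; apply: momentsB; exact: mm.
- by apply: momentsM => //; apply: momentsB; exact: mm.
- by apply: momentsD; apply: momentsM => //; apply: momentsB; exact: mm.
- by apply: momentsM => //; apply: momentsB; exact: mm.
Qed.

End Brownian.

(** * Continuous functions of polynomial growth *)

Section Nice.
Context {R : realType} {d : measure_display} {T : measurableType d}.
Variable P : probability T R.
Implicit Types f g : R -> R.

(** Enough for measurability and for composition with variables having all moments; stable under
    sums, products and, by [nice_der], antiderivatives. *)
Definition nice f := continuous f /\ polygrowth f.

Lemma nice_meas f : nice f -> measurable_fun setT f.
Proof. by move=> [cf _]; exact: continuous_measurable_fun. Qed.

Lemma nice_cst (c : R) : nice (fun=> c).
Proof. by split; [move=> x; exact: cvg_cst|exact: polygrowth_cst]. Qed.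

Lemma nice_id : nice (fun x => x).
Proof. by split; [move=> x; exact: cvg_id|exact: polygrowth_id]. Qed.

Lemma niceD f g : nice f -> nice g -> nice (fun x => f x + g x).
Proof.
move=> [cf pf] [cg pg]; split; last exact: polygrowthD.
by move=> x; apply: cvgD; [exact: cf|exact: cg].
Qed.

Lemma niceM f g : nice f -> nice g -> nice (fun x => f x * g x).
Proof.
move=> [cf pf] [cg pg]; split; last exact: polygrowthM.
by move=> x; apply: cvgM; [exact: cf|exact: cg].
Qed.

Lemma niceX f m : nice f -> nice (fun x => f x ^+ m).
Proof.
move=> nf; elim: m => [|m IH]; first exact: nice_cst.
by under eq_fun do rewrite exprS; exact: niceM.
Qed.

Lemma niceZ c f : nice f -> nice (fun x => c * f x).
Proof. by move=> nf; apply: niceM => //; exact: nice_cst. Qed.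

Lemma niceB f g : nice f -> nice g -> nice (fun x => f x - g x).
Proof.
move=> nf ng; have := niceD nf (niceZ (-1) ng).
by under eq_fun do rewrite mulN1r.
Qed.

Lemma nice_der f f' : der f f' -> polygrowth f' -> nice f.
Proof.
move=> df [C [m [C0 fC]]]; split; first exact: (der_continuous df).
exists (`|f 0| + C), m.+1; split => [|x]; first exact: addr_ge0.
have [c cx e] := der_MVT 0 x df.
have [c1 c2] := between_norm cx.
rewrite normr0 (max_idPr (normr_ge0 _)) in c1.
have -> : f x = f 0 + f' c * (x - 0) by rewrite -e addrC subrK.
rewrite subr0 mulrDl (le_trans (ler_normD _ _))// lerD//.
  by rewrite ler_peMr// exprn_ege1// lerDl.
rewrite normrM exprSr mulrA ler_pM//; last by rewrite lerDr.
rewrite (le_trans (fC c))// ler_wpM2l// lerXn2r ?nnegrE ?addr_ge0//.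
by rewrite lerD2l.
Qed.

Lemma nice_lipschitz f B : (forall x y, `|f x - f y| <= B * `|x - y|) -> nice f.
Proof.
move=> fB.
have B0 : 0 <= B by have := fB 1 0; rewrite subr0 normr1 mulr1; exact: le_trans.
split.
  move=> x; apply/cvgrPdist_le => e e0; near=> y.
  rewrite (le_trans (fB _ _))//.
  apply: (@le_trans _ _ ((B + 1) * `|x - y|)); first by rewrite ler_wpM2r// lerDl.
  rewrite mulrC -ler_pdivlMr ?ltr_wpDl//.
  near: y; apply: cvgr_dist_le; first exact: cvg_id.
  by rewrite divr_gt0// ltr_wpDl.
exists (`|f 0| + B), 1%N; split => [|x]; first exact: addr_ge0.
have := fB x 0; rewrite subr0 expr1 => H.
have := ler_normD (f x - f 0) (f 0); rewrite subrK => H1.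
have := normr_ge0 x; have := normr_ge0 (f 0); nra.
Unshelve. all: by end_near. Qed.

Lemma nice_moments f Y : nice f -> moments P Y -> moments P (fun w => f (Y w)).
Proof. by move=> nf mY; apply: moments_comp => //; [exact: nice_meas|case: nf]. Qed.

Lemma nice_shift f y : nice f -> nice (fun x => f (x + y)).
Proof.
move=> [cf pf]; split; last exact: polygrowth_shift.
move=> x; apply: (continuous_comp (f := fun x => x + y)); last exact: cf.
by apply: cvgD; [exact: cvg_id|exact: cvg_cst].
Qed.

End Nice.

(** * Ito's formula on a time grid *)

Section DiscreteIto.
Context {R : realType} {d : measure_display} {T : measurableType d}.
Variable P : probability T R.
Variable omega : R -> T -> 'rV[R]_2.
Hypothesis bm : brownian_motion P omega.

Notation b := (bpath omega).

Lemma bpath_moments t : 0 <= t -> moments P (b t).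
Proof. exact: (bm_moments bm). Qed.

Lemma bpath_Ex_sqr t : 0 <= t -> Ex P (fun w => b t w ^+ 2) = t.
Proof.
rewrite le_eqVlt => /predU1P[<-|t0]; last exact: (gaussian_var (bm_gaussian_coord bm 0 t0)).
rewrite (_ : (fun w => _) = fun=> 0) ?Ex_cst//; apply/funext => w.
by rewrite /bpath (bm0 bm) expr0n.
Qed.

Lemma bpath_Ex_sqr_inc s t : 0 <= s -> s <= t ->
  Ex P (fun w => (b t w - b s w) ^+ 2) = t - s.
Proof.
move=> s0; rewrite le_eqVlt => /predU1P[<-|st]; last first.
  exact: (gaussian_var (bm_gaussian_inc bm 0 s0 st)).
by under eq_fun do rewrite subrr expr0n; rewrite Ex_cst subrr.
Qed.

Variable delta : R.
Hypothesis delta0 : 0 < delta.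

Definition gpt (i : nat) : R := i%:R * delta.
Definition bgrid (i : nat) (w : T) : R := b (gpt i) w.
Definition dgrid (i : nat) (w : T) : R := bgrid i.+1 w - bgrid i w.

Lemma gpt_ge0 i : 0 <= gpt i. Proof. by rewrite mulr_ge0// ltW. Qed.

Lemma gpt_le i j : (i <= j)%N -> gpt i <= gpt j.
Proof. by move=> ij; rewrite ler_pM2r// ler_nat. Qed.

Lemma gptS i : gpt i.+1 - gpt i = delta.
Proof. by rewrite /gpt -natr1; ring. Qed.

Lemma gpt_ltS i : gpt i < gpt i.+1.
Proof. by rewrite -subr_gt0 gptS. Qed.

Lemma bgrid_moments i : moments P (bgrid i).
Proof. exact/bpath_moments/gpt_ge0. Qed.

Lemma dgrid_gaussian i : gaussian P (dgrid i) delta.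
Proof.
have := bm_gaussian_inc bm 0 (gpt_ge0 i) (gpt_ltS i).
by rewrite gptS.
Qed.

Lemma dgrid_moments i : moments P (dgrid i).
Proof. exact: gaussian_moments (dgrid_gaussian i). Qed.

Lemma grid_Ex_mul (f phi : R -> R) i : nice f -> nice phi ->
  Ex P (fun w => f (bgrid i w) * phi (dgrid i w)) =
  Ex P (fun w => f (bgrid i w)) * Ex P (fun w => phi (dgrid i w)).
Proof.
move=> nf nphi.
have mb := moments_meas (bgrid_moments i); have md := moments_meas (dgrid_moments i).
rewrite (@indep_Ex_mul _ _ _ P _ _ (bgrid i) (dgrid i) f phi)//.
- exact: (bpath_indep_now bm (gpt_ge0 i) (ltW (gpt_ltS i))).
- exact: nice_meas.
- exact: nice_meas.
- exact: (nice_moments nf (bgrid_moments i)).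
- exact: (nice_moments nphi (dgrid_moments i)).
Qed.

(** The increment at the later time [j] is independent of everything else in the product, so the
    centred factor [phi (dgrid j w)] splits off. *)
Lemma grid_Ex_cross (f g phi : R -> R) i j : nice f -> nice g -> nice phi ->
  (i < j)%N -> Ex P (fun w => phi (dgrid j w)) = 0 ->
  Ex P (fun w => f (bgrid i w) * phi (dgrid i w) * (g (bgrid j w) * phi (dgrid j w))) = 0.
Proof.
move=> nf ng nphi ij phi0.
have mbi := bgrid_moments i; have mdi := dgrid_moments i.
have mbj := bgrid_moments j; have mdj := dgrid_moments j.
pose X w := ((bgrid i w, dgrid i w), bgrid j w).
pose h (z : R * R * R) := f z.1.1 * phi z.1.2 * g z.2.
have mX : measurable_fun setT X.
  apply: measurable_fun_pair; last exact: (moments_meas mbj).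
  by apply: measurable_fun_pair; [exact: (moments_meas mbi)|exact: (moments_meas mdi)].
have mh : measurable_fun setT h.
  have m1 : measurable_fun setT (fun z : R * R * R => z.1.1) by exact: measurableT_comp.
  have m2 : measurable_fun setT (fun z : R * R * R => z.1.2) by exact: measurableT_comp.
  have mf := nice_meas nf; have mg := nice_meas ng; have mphi := nice_meas nphi.
  apply: measurable_funM; last exact: (measurableT_comp mg measurable_snd).
  by apply: measurable_funM; [exact: (measurableT_comp mf m1)|exact: (measurableT_comp mphi m2)].
have Mh : moments P (fun w => h (X w)).
  by apply: momentsM; [apply: momentsM|]; exact: nice_moments.
have Mp : moments P (fun w => phi (dgrid j w)) by exact: nice_moments.
rewrite (_ : (fun w => _) = fun w => h (X w) * phi (dgrid j w)); last first.
  by apply/funext => w; rewrite /h /X /=; ring.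
rewrite (@indep_Ex_mul _ _ _ P _ _ X (dgrid j) h phi) ?phi0 ?mulr0//.
- exact: (moments_meas mdj).
- exact: (bpath_indep_past bm (gpt_ge0 i) (ltW (gpt_ltS i)) (gpt_le ij) (ltW (gpt_ltS j))).
- exact: nice_meas.
Qed.

(** Used for [phi = id], where it is the Ito isometry, and for [phi(x) = x^2 - delta], where it
    measures the fluctuation of the quadratic variation. *)
Lemma grid_Ex_sum_mul (f g : nat -> R -> R) (phi : R -> R) v n :
  (forall i, nice (f i)) -> (forall i, nice (g i)) -> nice phi ->
  (forall i, Ex P (fun w => phi (dgrid i w)) = 0) ->
  (forall i, Ex P (fun w => phi (dgrid i w) ^+ 2) = v) ->
  Ex P (fun w => (\sum_(0 <= i < n) f i (bgrid i w) * phi (dgrid i w)) *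
                 (\sum_(0 <= i < n) g i (bgrid i w) * phi (dgrid i w))) =
  v * \sum_(0 <= i < n) Ex P (fun w => f i (bgrid i w) * g i (bgrid i w)).
Proof.
move=> nf ng nphi phi0 phi2.
pose F (h : nat -> R -> R) i w := h i (bgrid i w) * phi (dgrid i w).
have mF h i : (forall i, nice (h i)) -> moments P (F h i).
  move=> nh; apply: momentsM; apply: nice_moments => //; first exact: bgrid_moments.
  exact: dgrid_moments.
elim: n => [|n IH].
  rewrite big_geq// mulr0 -[RHS](Ex_cst P); congr Ex; apply/funext => w.
  by rewrite !big_geq// mulr0.
rewrite big_nat_recr//= mulrDr -IH.
have mS h : (forall i, nice (h i)) -> moments P (fun w => \sum_(0 <= i < n) F h i w).
  by move=> nh; apply: moments_sum => i _; exact: mF.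
have cross h k : (forall i, nice (h i)) -> (forall i, nice (k i)) ->
    Ex P (fun w => (\sum_(0 <= i < n) F h i w) * F k n w) = 0.
  move=> nh nk; under eq_fun do rewrite big_distrl /=.
  rewrite Ex_sum; last by move=> i _; apply: momentsM; exact: mF.
  rewrite big_nat big1// => i /andP[_ iltn].
  by rewrite /F grid_Ex_cross.
transitivity (Ex P (fun w =>
    (\sum_(0 <= i < n) F f i w) * (\sum_(0 <= i < n) F g i w) +
    ((\sum_(0 <= i < n) F f i w) * F g n w +
    ((\sum_(0 <= i < n) F g i w) * F f n w + F f n w * F g n w)))).
  by congr Ex; apply/funext => w; rewrite !big_nat_recr//= /F; ring.
have m1 := mS _ nf; have m2 := mS _ ng; have m3 := mF _ n nf; have m4 := mF _ n ng.
rewrite !ExD; [|by repeat first [exact: m1|exact: m2|exact: m3|exact: m4|apply: momentsD|apply: momentsM]..].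
rewrite !cross// !add0r; congr (_ + _).
rewrite mulrC -(phi2 n) -(@grid_Ex_mul (fun x => f n x * g n x) (fun x => phi x ^+ 2)).
- by congr Ex; apply/funext => w; rewrite /F; ring.
- exact: niceM.
- exact: niceX.
Qed.

Lemma dgrid_mean i : Ex P (dgrid i) = 0.
Proof. exact: (gaussian_mean (dgrid_gaussian i)). Qed.

Lemma dgrid_var i : Ex P (fun w => dgrid i w ^+ 2) = delta.
Proof. exact: (gaussian_var (dgrid_gaussian i)). Qed.

(** A left-point sum, hence a discrete martingale. The integrand may depend on the index so that it
    can be switched off on the first half of the time interval. *)
Definition stoch_sum (f : nat -> R -> R) n w :=
  \sum_(0 <= i < n) f i (bgrid i w) * dgrid i w.

Definition time_sum (k : R -> R) n w := delta * \sum_(0 <= i < n) k (bgrid i w).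

Lemma stoch_sum_moments f n : (forall i, nice (f i)) -> moments P (stoch_sum f n).
Proof.
move=> nf; apply: moments_sum => i _; apply: momentsM; last exact: dgrid_moments.
by apply: nice_moments => //; exact: bgrid_moments.
Qed.

Lemma time_sum_moments k n : nice k -> moments P (time_sum k n).
Proof.
move=> nk; apply: momentsZ; apply: moments_sum => i _.
by apply: nice_moments => //; exact: bgrid_moments.
Qed.

Lemma stoch_sum_isometry f g n : (forall i, nice (f i)) -> (forall i, nice (g i)) ->
  Ex P (fun w => stoch_sum f n w * stoch_sum g n w) =
  delta * \sum_(0 <= i < n) Ex P (fun w => f i (bgrid i w) * g i (bgrid i w)).
Proof.
move=> nf ng; apply: (@grid_Ex_sum_mul f g id delta n nf ng nice_id dgrid_mean).
exact: dgrid_var.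
Qed.

(** [k] is half of [H''], so this is Taylor's formula of order two. Two mean value steps bound the
    remainder, with the Lipschitz constant of [k] in place of a third derivative. *)
Lemma taylor2_lipschitz (H f k : R -> R) B x y : der H (fun x => 2 * f x) -> der f k ->
  (forall x y, `|k x - k y| <= B * `|x - y|) ->
  `|H (x + y) - H x - 2 * f x * y - k x * y ^+ 2| <= 2 * B * `|y| ^+ 3.
Proof.
move=> dH df kB.
have B0 : 0 <= B by have := kB 1 0; rewrite subr0 normr1 mulr1; exact: le_trans.
pose r z := H (z + x) - H x - 2 * f x * z - k x * (z * z).
pose r' z := 2 * (f (z + x) - f x - k x * z).
have dr : der r r'.
  apply: (der_eq (derB (derB (derB (der_shift x dH) (der_cst (H x)))
    (derZ (2 * f x) (@der_id R))) (derZ (k x) (derM (@der_id R) (@der_id R))))).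
  by move=> z; rewrite /r'; ring.
have r'B z : `|r' z| <= 2 * B * `|z| ^+ 2.
  have [c cz e] := der_MVT x (z + x) df.
  have [_ c2] := between_norm cz.
  rewrite addrK in c2; rewrite addrK in e.
  rewrite /r' e -mulrBl !normrM (ger0_norm (ler0n _ _)) -mulrA ler_pM2l//.
  rewrite expr2 mulrA ler_wpM2r// (le_trans (kB _ _))// ler_wpM2l//.
have [c cy e] := der_MVT 0 y dr.
have [c1 _] := between_norm cy; rewrite normr0 (max_idPr (normr_ge0 _)) in c1.
have r0 : r 0 = 0 by rewrite /r add0r; ring.
rewrite r0 !subr0 in e.
rewrite (_ : _ - _ = r y); last by rewrite /r (addrC y); ring.
rewrite e normrM exprSr mulrA ler_wpM2r// (le_trans (r'B c))// ler_wpM2l ?mulr_ge0//.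
by rewrite lerXn2r ?nnegrE.
Qed.

(** [2 k0^2 + 2 B^2 t] bounds [E k(b_s)^2] for [s <= t]. The first term comes from the quadratic
    variation, the second from the Taylor remainders, with [120 = 2 * 4 * 15]: 2 from splitting a
    square, 4 from [(2 B)^2], 15 from the sixth Gaussian moment. *)
Definition ito_const (B k0 t : R) : R :=
  4 * t * (2 * k0 ^+ 2 + 2 * B ^+ 2 * t) + 120 * B ^+ 2 * t ^+ 2.

Lemma lipschitz_bpath_Ex_sqr (k : R -> R) B t : 0 <= t ->
  (forall x y, `|k x - k y| <= B * `|x - y|) ->
  Ex P (fun w => k (b t w) ^+ 2) <= 2 * k 0 ^+ 2 + 2 * B ^+ 2 * t.
Proof.
move=> t0 kB; have nk := nice_lipschitz kB.
have mb := bpath_moments t0.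
apply: (@le_trans _ _ (Ex P (fun w => 2 * k 0 ^+ 2 + 2 * B ^+ 2 * b t w ^+ 2))).
  apply: Ex_le.
  - by apply/momentsX/nice_moments.
  - by apply: momentsD; [exact: moments_cst|exact/momentsZ/momentsX].
  move=> w; have := kB (b t w) 0; rewrite subr0 => H.
  have : (k (b t w) - k 0) ^+ 2 <= B ^+ 2 * b t w ^+ 2.
    rewrite -exprMn -real_normK ?num_real// -[leRHS]real_normK ?num_real//.
    by rewrite normrM lerXn2r ?nnegrE ?mulr_ge0// (le_trans H)// ler_wpM2r// ler_norm.
  have := sqr_ge0 (k (b t w) - 2 * k 0); nra.
rewrite ExD; [|exact: moments_cst|exact/momentsZ/momentsX].
by rewrite Ex_cst ExZ ?bpath_Ex_sqr//; exact: momentsX.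
Qed.

(* The normalisation [H' = 2 f] absorbs the factor [1 / 2] of Ito's formula. *)
Lemma discrete_ito (H f k : R -> R) B n : der H (fun x => 2 * f x) -> der f k ->
  (forall x y, `|k x - k y| <= B * `|x - y|) ->
  Ex P (fun w => (H (bgrid n w) - H 0 - 2 * stoch_sum (fun=> f) n w - time_sum k n w) ^+ 2)
   <= delta * ito_const B (k 0) (gpt n).
Proof.
move=> dH df kB.
have nk := nice_lipschitz kB.
have nf : nice f by apply: (nice_der df); case: nk.
have nH : nice H by apply: (nice_der dH); case: (niceZ 2 nf).
have B0 : 0 <= B by have := kB 1 0; rewrite subr0 normr1 mulr1; exact: le_trans.
pose phi x := x ^+ 2 - delta.
have nphi : nice phi by apply: niceB; [exact/niceX/nice_id|exact: nice_cst].
pose A w := \sum_(0 <= i < n) k (bgrid i w) * phi (dgrid i w).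
pose rho i w := H (bgrid i.+1 w) - H (bgrid i w) - 2 * f (bgrid i w) * dgrid i w
  - k (bgrid i w) * dgrid i w ^+ 2.
have mb := bgrid_moments; have md := dgrid_moments.
have mA : moments P A by apply: moments_sum => i _; apply: momentsM; exact: nice_moments.
have mrho i : moments P (rho i).
  have mH j : moments P (fun w => H (bgrid j w)) by exact: nice_moments.
  apply: momentsB; last by apply: momentsM; [exact: nice_moments|exact: momentsX].
  apply: momentsB; first exact: momentsB.
  by apply: momentsM => //; apply: momentsZ; exact: nice_moments.
have mR : moments P (fun w => \sum_(0 <= i < n) rho i w) by exact: moments_sum.
(* Telescoping. [A] is the cost of replacing [dgrid i w ^+ 2] by [delta] in the second-order term;
   the [rho i] are the Taylor remainders. *)
have decomp w : H (bgrid n w) - H 0 - 2 * stoch_sum (fun=> f) n w - time_sum k n w =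
    A w + \sum_(0 <= i < n) rho i w.
  rewrite /A /stoch_sum /time_sum; elim: n {A mA mR} => [|m IH].
    rewrite !big_geq// !mulr0 !subr0 addr0 /bgrid /bpath /gpt mul0r (bm0 bm); ring.
  rewrite !big_nat_recr//= /rho /phi.
  move: IH; set s1 := \sum_(0 <= i < m) _; set s2 := \sum_(0 <= i < m) _.
  set s3 := \sum_(0 <= i < m) _; set s4 := \sum_(0 <= i < m) _ => IH.
  rewrite addrACA -IH; ring.
under eq_fun do rewrite decomp.
apply: (le_trans (Ex_sqrD_le mA mR)).
have tn := gpt_ge0 n.
have c0 : 0 <= 2 * k 0 ^+ 2 + 2 * B ^+ 2 * gpt n.
  by have := mulr_ge0 (sqr_ge0 B) tn; have := sqr_ge0 (k 0); lra.
have EA : Ex P (fun w => A w ^+ 2) <= 2 * delta * gpt n * (2 * k 0 ^+ 2 + 2 * B ^+ 2 * gpt n).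
  rewrite (_ : (fun w => _) = fun w => A w * A w); last by apply/funext => w; rewrite expr2.
  rewrite (@grid_Ex_sum_mul (fun=> k) (fun=> k) phi (2 * delta ^+ 2))//; last 2 first.
  - move=> i; rewrite /phi ExB ?dgrid_var ?Ex_cst ?subrr//; first exact: momentsX.
    exact: moments_cst.
  - move=> i; rewrite /phi.
    transitivity (Ex P (fun w => dgrid i w ^+ 4 + (- (2 * delta) * dgrid i w ^+ 2 + delta ^+ 2))).
      by congr Ex; apply/funext => w; ring.
    have m2 m : moments P (fun w => dgrid i w ^+ m) by exact: momentsX.
    have mc : moments P (fun=> delta ^+ 2) by exact: moments_cst.
    rewrite ExD//; last by apply: momentsD => //; exact: momentsZ.
    rewrite ExD//; last exact: momentsZ.
    rewrite ExZ// Ex_cst dgrid_var (gaussian_pow4 (dgrid_gaussian i)); ring.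
  rewrite [leRHS](_ : _ = 2 * delta ^+ 2 * (n%:R * (2 * k 0 ^+ 2 + 2 * B ^+ 2 * gpt n))); last first.
    by rewrite /gpt; ring.
  rewrite ler_wpM2l ?mulr_ge0 ?(ltW delta0)//.
  apply: (@le_trans _ _ (\sum_(0 <= i < n) (2 * k 0 ^+ 2 + 2 * B ^+ 2 * gpt n))).
    apply: ler_sum_nat => i /andP[_ iltn].
    rewrite (_ : (fun w => _) = fun w => k (bgrid i w) ^+ 2); last by apply/funext => w; rewrite expr2.
    apply: (le_trans (lipschitz_bpath_Ex_sqr (gpt_ge0 i) kB)).
    by rewrite lerD2l ler_wpM2l ?mulr_ge0 ?exprn_ge0// gpt_le// ltnW.
  by rewrite sumr_const_nat subn0 -[leLHS]mulr_natl.
have ER : Ex P (fun w => (\sum_(0 <= i < n) rho i w) ^+ 2) <= n%:R ^+ 2 * (60 * B ^+ 2 * delta ^+ 3).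
  apply: Ex_sqr_sum_le => // i _.
  apply: (@le_trans _ _ (Ex P (fun w => 4 * B ^+ 2 * dgrid i w ^+ 6))).
    apply: Ex_le; [exact: momentsX|exact/momentsZ/momentsX|].
    move=> w; have := taylor2_lipschitz (bgrid i w) (dgrid i w) dH df kB.
    rewrite {1}/dgrid [bgrid i w + _]addrC subrK -/(rho i w) => rB.
    rewrite -real_normK ?num_real//.
    apply: (@le_trans _ _ ((2 * B * `|dgrid i w| ^+ 3) ^+ 2)).
      by rewrite lerXn2r ?nnegrE ?mulr_ge0 ?exprn_ge0.
    rewrite (_ : dgrid i w ^+ 6 = `|dgrid i w| ^+ 6); last by rewrite -normrX ger0_norm// (exprM _ 2 3) exprn_ge0// sqr_ge0.
    by rewrite (_ : _ ^+ 2 = 4 * B ^+ 2 * `|dgrid i w| ^+ 6)//; ring.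
  rewrite ExZ; last exact: momentsX.
  rewrite (gaussian_pow6 (dgrid_gaussian i)) [leLHS](_ : _ = 60 * B ^+ 2 * delta ^+ 3)//; ring.
apply: (le_trans (ler_wpM2l _ (lerD EA ER))) => //.
rewrite /ito_const [leRHS](_ : _ = 2 * (2 * delta * gpt n * (2 * k 0 ^+ 2 + 2 * B ^+ 2 * gpt n) +
    n%:R ^+ 2 * (60 * B ^+ 2 * delta ^+ 3)))// /gpt; ring.
Qed.

End DiscreteIto.

(** * Integrals along Brownian paths *)

Section Riemann.
Context {R : realType}.
Notation mu := (@lebesgue_measure R).

Lemma continuous_heine (phi : R -> R) (a b e : R) : continuous phi -> 0 < e ->
  exists2 eta, 0 < eta & forall x y, a <= x <= b -> `|y - x| < eta ->
    `|phi y - phi x| <= e.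
Proof.
move=> cphi e0.
have cK : compact `[a, b] by exact: segment_compact.
pose Q (eta : R) x := forall y, `|y - x| < eta -> `|phi y - phi x| <= e.
have near_cov := (compact_near_coveringP `[a, b]).1 cK R (0^'+) Q _.
have /near_cov : forall x, `[a, b] x -> \forall x' \near x & i \near 0^'+, Q i x'.
  move=> x _.
  have e2 : 0 < e / 2 by rewrite divr_gt0.
  have /cvgrPdist_le/(_ _ e2)/nbhs_ballP[r r0 rP] := cphi x.
  have r2 : 0 < r / 2 by rewrite divr_gt0.
  near=> z eta => y yz.
  have xz : `|x - z| < r / 2 by near: z; exact: nbhsx_ballx.
  have er : eta < r / 2 by near: eta; exact: nbhs_right_lt.
  have H1 : `|phi x - phi z| <= e / 2 by apply: rP; apply: (lt_trans xz); lra.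
  have H2 : `|phi x - phi y| <= e / 2.
    apply: rP; change (`|x - y| < r).
    apply: (le_lt_trans (ler_distD z x y)); rewrite (distrC z y) (splitr r).
    by apply: ltrD => //; exact: lt_trans er.
  by have := ler_distD (phi x) (phi y) (phi z); rewrite (distrC (phi y) (phi x)); lra.
move=> H; near (0 : R)^'+ => eta; exists eta => //.
have HQ : `[a, b] `<=` Q eta by near: eta; exact: H.
by move=> x y xab; apply: (HQ x); rewrite /= in_itv.
Unshelve. all: by end_near. Qed.

Lemma riemann_sum_cvg (phi : R -> R) (t e : R) : continuous phi -> 0 < t -> 0 < e ->
  exists2 eta, 0 < eta & forall n, (0 < n)%N -> t / n%:R < eta ->
    `|\int[mu]_(u in `[0, t]) phi u -
      t / n%:R * \sum_(0 <= i < n) phi (i%:R * (t / n%:R))| <= e.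
Proof.
move=> cphi t0 e0; have [F [dF _]] := primitive cphi.
have et : 0 < e / t by rewrite divr_gt0.
have [eta eta0 H] := continuous_heine 0 t cphi et.
exists eta => // n n0 dn; set dl := t / n%:R in dn *.
have nR : 0 < n%:R :> R by rewrite ltr0n.
have dl0 : 0 < dl by rewrite divr_gt0.
have nd : n%:R * dl = t by rewrite /dl mulrC divfK// gt_eqF.
rewrite (der_FTC dF cphi (ltW t0)).
have -> : F t - F 0 = \sum_(0 <= i < n) (F (i.+1%:R * dl) - F (i%:R * dl)).
  by rewrite (telescope_sumr (fun i => F (i%:R * dl)))// nd mul0r.
rewrite mulr_sumr -sumrB (le_trans (ler_norm_sum _ _ _))//.
apply: (@le_trans _ _ (\sum_(0 <= i < n) dl * (e / t))); last first.
  rewrite sumr_const_nat subn0 -mulr_natl mulrA nd mulrC divfK// gt_eqF//.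
apply: ler_sum_nat => i /andP[_ iltn].
have [c ci ->] := der_MVT (i%:R * dl) (i.+1%:R * dl) dF.
have dE : i.+1%:R * dl - i%:R * dl = dl by rewrite -natr1; ring.
rewrite dE mulrC -mulrBr normrM (gtr0_norm dl0) ler_pM2l//.
have [_] := between_norm ci; rewrite dE (gtr0_norm dl0) => ci2.
apply: H; last exact: le_lt_trans dn.
rewrite mulr_ge0 ?(ltW dl0)//= -nd ler_pM2r// ler_nat ltnW//.
Qed.

End Riemann.

Section PathIntegral.
Context {R : realType} {d : measure_display} {T : measurableType d}.
Variable P : probability T R.
Notation mu := (@lebesgue_measure R).

(** The limit is not known to have moments, hence the extended-real integral in the conclusion. *)
Lemma fatou_sqr (Y : nat -> T -> R) (Z : T -> R) (c : R) :
  (forall q, moments P (Y q)) -> (forall w, Y q w @[q --> \oo] --> Z w) ->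
  (forall q, Ex P (fun w => Y q w ^+ 2) <= c) ->
  measurable_fun setT Z /\ (\int[P]_w (Z w ^+ 2)%:E <= c%:E)%E.
Proof.
move=> MY YZ Yc.
have mY q : measurable_fun setT (Y q) by case: (MY q).
have mZ : measurable_fun setT Z.
  by apply: (@measurable_fun_cvg _ _ _ setT Y) => // w _; exact: YZ.
split => //.
pose f q w := (Y q w ^+ 2)%:E.
have cf w : f q w @[q --> \oo] --> (Z w ^+ 2)%:E.
  apply: cvg_EFin; first exact: nearW.
  by rewrite /f /=; apply: cvgM; exact: YZ.
have mf q : measurable_fun setT (f q) by apply/measurable_EFinP; exact: measurable_funX.
have f0 q w : [set: T] w -> (0 <= f q w)%E by move=> _; rewrite lee_fin sqr_ge0.
have := fatou P measurableT mf f0.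
under eq_integral do rewrite (cvg_limn_einf_sup (cf _)).1.
move=> /le_trans; apply.
rewrite limn_einf_lim; apply: lime_le; first exact: is_cvg_einfs.
apply: nearW => q; apply: ge_ereal_inf.
exists (\int[P]_w f q w)%E; first by exists q => //=.
have := Ex_EFin (momentsX 2 (MY q)); rewrite unlock /f => ->.
by rewrite lee_fin.
Qed.

End PathIntegral.

Section BrownianPathIntegral.
Context {R : realType} {d : measure_display} {T : measurableType d}.
Variable P : probability T R.
Variable omega : R -> T -> 'rV[R]_2.
Hypothesis bm : brownian_motion P omega.
Notation mu := (@lebesgue_measure R).
Notation b := (bpath omega).
Variables (k : R -> R) (B t : R).
Hypothesis kB : forall x y, `|k x - k y| <= B * `|x - y|.
Hypothesis t0 : 0 < t.

Definition path_int (w : T) : R := \int[mu]_(u in `[0, t]) k (b u w).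

(* Clamping the time extends the path continuously to negative times, where
   [omega] is unconstrained. *)
Lemma bpath_clamp_continuous w : continuous (fun u : R => b (Num.max 0 u) w).
Proof.
move=> x.
have /subspace_continuousP cw : {within `[0, +oo[, continuous (fun t => omega t w)} by exact: (bm_continuous bm).
have x0 : `[0, +oo[%classic (Num.max 0 x) by rewrite /= in_itv/= andbT le_max lexx.
apply: (@continuous_comp _ _ _ (fun u : R => omega (Num.max 0 u) w) (fun M : 'rV[R]_2 => M 0 0)); last exact: coord_continuous.
apply: (cvg_comp (fun u : R => Num.max 0 u) (fun u => omega u w)); last exact: (cw _ x0).
move=> A /= /(nbhs_ballP _ _)[e e0 eA].
near=> y; apply: eA; last by rewrite /= in_itv/= andbT le_max lexx.
rewrite /ball /=.
apply: (@le_lt_trans _ _ `|x - y|).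
  have [x1|x1] := leP 0 x; have [y1|y1] := leP 0 y => //.
  - by rewrite subr0 !ger0_norm; lra.
  - by rewrite sub0r normrN ger0_norm// ltr0_norm; lra.
  - by rewrite subrr normr0.
near: y; exact: cvgr_dist_lt.
Unshelve. all: by end_near. Qed.

Lemma path_int_riemann w e : 0 < e -> exists2 eta, 0 < eta &
  forall n, (0 < n)%N -> t / n%:R < eta ->
  `|path_int w - time_sum omega (t / n%:R) k n w| <= e.
Proof.
move=> e0; pose phi u := k (b (Num.max 0 u) w).
have [ck _] := nice_lipschitz kB.
have cphi : continuous phi.
  move=> x; apply: (@continuous_comp _ _ _ (fun u : R => b (Num.max 0 u) w) k); last exact: ck.
  exact: bpath_clamp_continuous.
have [eta eta0 H] := riemann_sum_cvg cphi t0 e0; exists eta => // n n0 tn.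
have := H n n0 tn; congr (`|_ - _| <= e).
  apply: eq_Rintegral => u; rewrite inE /= in_itv/= => /andP[u0 _].
  by rewrite /phi (max_idPr u0).
rewrite /time_sum; congr (_ * _); apply: eq_bigr => i _.
by rewrite /phi /bgrid /gpt (max_idPr _)// mulr_ge0// divr_ge0// ltW.
Qed.

(** The grids refine a fixed grid of [n] cells, so that [time_sum_refine] compares all of them with
    it, uniformly in [q]. *)
Lemma path_int_cvg n w : (0 < n)%N ->
  time_sum omega (t / (n * q.+1)%:R) k (n * q.+1) w @[q --> \oo] --> path_int w.
Proof.
move=> n0; apply/cvgrPdist_le => e e0.
have [eta eta0 H] := path_int_riemann w e0.
near=> q; apply: H; first by rewrite muln_gt0 n0.
have nq : 0 < (n * q.+1)%:R :> R by rewrite ltr0n muln_gt0 n0.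
rewrite ltr_pdivrMr// -ltr_pdivrMl//.
apply: (@lt_le_trans _ _ q.+1%:R); last by rewrite ler_nat leq_pmull.
apply: (@le_lt_trans _ _ q%:R); last by rewrite ltr_nat.
by near: q; exact: nbhs_infty_ger.
Unshelve. all: by end_near. Qed.

Lemma sum_divn (f : nat -> R) n q : (0 < q)%N ->
  \sum_(0 <= j < n * q) f (j %/ q)%N = q%:R * \sum_(0 <= i < n) f i.
Proof.
move=> q0; elim: n => [|n IH]; first by rewrite mul0n !big_geq// mulr0.
rewrite big_nat_recr//= mulrDr -IH mulSn addnC.
rewrite (big_cat_nat (n := n * q)) ?leq_addr//=; congr (_ + _).
rewrite -{1}[(n * q)%N]add0n big_addn addKn.
rewrite (eq_big_nat _ _ (F2 := fun=> f n)); last first.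
  by move=> i /andP[_ iq]; rewrite divnDr ?dvdn_mull// mulnK// divn_small// add0n.
by rewrite sumr_const_nat subn0 mulr_natl.
Qed.

(** The fine grid point [j] lies less than one coarse cell after the coarse point [j %/ q]; the
    Lipschitz bound turns the variance of that increment into an error independent of [q]. *)
Lemma time_sum_refine n q : (0 < n)%N -> (0 < q)%N ->
  Ex P (fun w => (time_sum omega (t / (n * q)%:R) k (n * q) w -
                  time_sum omega (t / n%:R) k n w) ^+ 2) <= t ^+ 2 * (B ^+ 2 * (t / n%:R)).
Proof.
move=> n0 q0; have nk := nice_lipschitz kB.
have nR : 0 < n%:R :> R by rewrite ltr0n.
have qR : 0 < q%:R :> R by rewrite ltr0n.
have nqR : 0 < (n * q)%:R :> R by rewrite ltr0n muln_gt0 n0.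
set dl := t / n%:R; set dq := t / (n * q)%:R.
have dl0 : 0 < dl by rewrite divr_gt0.
have dq0 : 0 < dq by rewrite divr_gt0.
have dE : dl = q%:R * dq.
  by rewrite /dl /dq natrM; field; rewrite !gt_eqF.
pose Y j w := k (bgrid omega dq j w) - k (bgrid omega dl (j %/ q) w).
have MY j : moments P (Y j).
  by apply: momentsB; apply: nice_moments => //; exact: (bgrid_moments bm).
have E w : time_sum omega dq k (n * q) w - time_sum omega dl k n w =
    dq * \sum_(0 <= j < n * q) Y j w.
  rewrite /time_sum /Y dE -mulrA mulrCA -(sum_divn (fun i => k (bgrid omega (q%:R * dq) i w)))//.
  by rewrite sumrB mulrBr mulrCA.
under eq_fun do rewrite E exprMn.
rewrite ExZ; last by apply: momentsX; apply: moments_sum.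
have bound j : (j < n * q)%N -> Ex P (fun w => Y j w ^+ 2) <= B ^+ 2 * dl.
  move=> _.
  have m1 := bgrid_moments bm dq0 j; have m2 := bgrid_moments bm dl0 (j %/ q).
  apply: (@le_trans _ _ (Ex P (fun w => B ^+ 2 * (bgrid omega dq j w - bgrid omega dl (j %/ q) w) ^+ 2))).
    apply: Ex_le; [exact: momentsX|exact/momentsZ/momentsX/momentsB|].
    move=> w; rewrite -exprMn -real_normK ?num_real// -[leRHS]real_normK ?num_real//.
    by rewrite lerXn2r ?nnegrE// (le_trans (kB _ _))// normrM ler_wpM2r// ler_norm.
  rewrite ExZ; last exact/momentsX/momentsB.
  rewrite ler_wpM2l ?sqr_ge0//.
  have jq : gpt dq j - gpt dl (j %/ q) = (j %% q)%:R * dq.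
    by rewrite /gpt dE {1}(divn_eq j q) natrD natrM; ring.
  rewrite /bgrid (bpath_Ex_sqr_inc bm); last 2 first.
  - exact: gpt_ge0.
  - by rewrite -subr_ge0 jq mulr_ge0// ltW.
  by rewrite jq dE ler_pM2r// ler_nat ltnW// ltn_pmod.
have := Ex_sqr_sum_le MY bound.
move=> /(ler_wpM2l (exprn_ge0 2 (ltW dq0))) /le_trans; apply.
have dqn : dq * (n * q)%:R = t by rewrite /dq divfK// gt_eqF.
by rewrite -[in leRHS]dqn [leLHS](_ : _ = (dq * (n * q)%:R) ^+ 2 * (B ^+ 2 * dl))//; ring.
Qed.

Lemma path_int_msd_le (W : T -> R) n c : moments P W -> (0 < n)%N ->
  (forall q, Ex P (fun w =>
    (W w + time_sum omega (t / (n * q.+1)%:R) k (n * q.+1) w) ^+ 2) <= c) ->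
  (\int[P]_w ((W w + path_int w) ^+ 2)%:E <= c%:E)%E.
Proof.
move=> MW n0 H; have nk := nice_lipschitz kB.
pose Y q w := W w + time_sum omega (t / (n * q.+1)%:R) k (n * q.+1) w.
apply: (@fatou_sqr _ _ _ P Y (fun w => W w + path_int w) c _ _ _).2.
- move=> q; apply: momentsD => //; apply: (time_sum_moments bm) => //.
  by rewrite divr_gt0// ltr0n muln_gt0 n0.
- by move=> w; apply: cvgD; [exact: cvg_cst|exact: path_int_cvg].
- by move=> q; exact: H.
Qed.

(** Fatou's lemma points the wrong way here. It is applied to the difference between [path_int] and
    one fixed grid sum [S], and [(W + S)^2 / 2 <= (W + path_int)^2 + (path_int - S)^2] transfers the
    bound. *)
Lemma path_int_msd_ge (W : T -> R) n : moments P W -> (0 < n)%N ->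
  ((Ex P (fun w => (W w + time_sum omega (t / n%:R) k n w) ^+ 2) / 2
    - t ^+ 2 * (B ^+ 2 * (t / n%:R)))%:E <=
   \int[P]_w ((W w + path_int w) ^+ 2)%:E)%E.
Proof.
move=> MW n0; have nk := nice_lipschitz kB.
pose S w := time_sum omega (t / n%:R) k n w.
pose c := t ^+ 2 * (B ^+ 2 * (t / n%:R)).
have tn m : (0 < m)%N -> 0 < t / m%:R by move=> m0; rewrite divr_gt0// ltr0n.
have MS m : (0 < m)%N -> moments P (time_sum omega (t / m%:R) k m).
  by move=> m0; apply: (time_sum_moments bm) => //; exact: tn.
have [mD D] : measurable_fun setT (fun w => path_int w - S w) /\
    (\int[P]_w ((path_int w - S w) ^+ 2)%:E <= c%:E)%E.
  apply: (@fatou_sqr _ _ _ P (fun q w => time_sum omega (t / (n * q.+1)%:R) k (n * q.+1) w - S w)).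
  - by move=> q; apply: momentsB; apply: MS => //; rewrite muln_gt0 n0.
  - by move=> w; apply: cvgB; [exact: path_int_cvg|exact: cvg_cst].
  - by move=> q; exact: time_sum_refine.
have mS : measurable_fun setT S by case: (MS n n0).
have mW : measurable_fun setT W by case: MW.
have mX : measurable_fun setT path_int.
  rewrite (_ : path_int = fun w => (path_int w - S w) + S w); first exact: measurable_funD.
  by apply/funext => w; rewrite subrK.
have mV : measurable_fun setT (fun w => (W w + path_int w) ^+ 2).
  by apply: measurable_funX; exact: measurable_funD.
have mD2 : measurable_fun setT (fun w => (path_int w - S w) ^+ 2) by exact: measurable_funX.
have key : (\int[P]_w ((W w + S w) ^+ 2 / 2)%:E <=
    \int[P]_w ((W w + path_int w) ^+ 2)%:E + \int[P]_w ((path_int w - S w) ^+ 2)%:E)%E.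
  rewrite -ge0_integralD//; last 4 first.
  - by move=> w _; rewrite lee_fin sqr_ge0.
  - exact/measurable_EFinP.
  - by move=> w _; rewrite lee_fin sqr_ge0.
  - exact/measurable_EFinP.
  apply: ge0_le_integral => //.
  - by move=> w _; rewrite lee_fin divr_ge0// sqr_ge0.
  - apply/measurable_EFinP; apply: measurable_funM => //; apply: measurable_funX.
    exact: measurable_funD.
  - by apply/measurable_EFinP; exact: measurable_funD.
  - move=> w _; rewrite lee_fin.
    have := sqr_ge0 ((W w + path_int w) + (path_int w - S w)); nra.
have MWS : moments P (fun w => W w + S w) by apply: momentsD => //; exact: MS.
have eE : (\int[P]_w ((W w + S w) ^+ 2 / 2)%:E = (Ex P (fun w => (W w + S w) ^+ 2) / 2)%:E)%E.
  have M2 : moments P (fun w => (W w + S w) ^+ 2 / 2).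
    by apply: momentsM; [exact: momentsX|exact: moments_cst].
  have := Ex_EFin M2; rewrite unlock => ->; congr EFin.
  rewrite [RHS]mulrC -ExZ; last exact: momentsX.
  by congr Ex; apply/funext => w; rewrite mulrC.
rewrite EFinB leeBlDr//; rewrite -/S -eE; apply: (le_trans key).
by rewrite leeD2l.
Qed.

End BrownianPathIntegral.

(** * Mean square displacement *)

Section BrownianStein.
Context {R : realType} {d : measure_display} {T : measurableType d}.
Variable P : probability T R.
Variable omega : R -> T -> 'rV[R]_2.
Hypothesis bm : brownian_motion P omega.
Notation b := (bpath omega).

Lemma indep_sym d1 d2 (T1 : measurableType d1) (T2 : measurableType d2)
    (X : T -> T1) (Y : T -> T2) : indep P X Y -> indep P Y X.
Proof. by move=> iXY A B mA mB; rewrite setIC muleC; exact: iXY. Qed.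

(* [b t] is the increment over [[s, s']] plus a variable independent of it, so Stein's
   identity applies conditionally on [b s] and on the increment after [s']. *)
Lemma bpath_stein_mid (g H H' : R -> R) s s' t : 0 <= s -> s < s' -> s' <= t ->
  nice g -> nice H -> nice H' -> der H H' ->
  Ex P (fun w => g (b s w) * (b s' w - b s w) * H (b t w)) =
  (s' - s) * Ex P (fun w => g (b s w) * H' (b t w)).
Proof.
move=> s0 ss' s't ng nH nH' dH.
have s'0 : 0 <= s' by rewrite (le_trans s0)// ltW.
have t0 : 0 <= t by rewrite (le_trans s'0).
have Mb u : 0 <= u -> moments P (b u) by exact: (bpath_moments bm).
pose X w := (b s w, b t w - b s' w).
pose Y w := b s' w - b s w.
pose F (h : R -> R) (x : R * R) y := g x.1 * h (y + (x.1 + x.2)).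
have eb w : Y w + ((X w).1 + (X w).2) = b t w by rewrite /X /Y /=; ring.
have mF h : nice h -> measurable_fun setT (fun z : (R * R) * R => F h z.1 z.2).
  move=> nh; have mg := nice_meas ng; have mh := nice_meas nh.
  have m1 : measurable_fun setT (fun z : R * R * R => z.1.1) by exact: measurableT_comp.
  have m2 : measurable_fun setT (fun z : R * R * R => z.1.2) by exact: measurableT_comp.
  apply: measurable_funM; first exact: (measurableT_comp mg m1).
  apply: (measurableT_comp mh); apply: measurable_funD => //; exact: measurable_funD.
have MF h : nice h -> moments P (fun w => F h (X w) (Y w)).
  move=> nh; under eq_fun do rewrite /F eb.
  by apply: momentsM; apply: nice_moments => //; exact: Mb.
have nF h x : nice h -> nice (F h x).
  by move=> nh; apply: niceZ; exact: nice_shift.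
have := @indep_stein _ _ _ P _ _ X Y (s' - s) (F H) (F H') _
  (bm_gaussian_inc bm 0 s0 ss') (bpath_indep_mid bm s0 (ltW ss') s't).
move=> H0.
transitivity (Ex P (fun w => Y w * F H (X w) (Y w))).
  by congr Ex; apply/funext => w; rewrite /F eb /X /Y /=; ring.
rewrite H0.
- by congr (_ * Ex _ _); apply/funext => w; rewrite /F eb.
- apply: measurable_fun_pair; first by case: (Mb s).
  by apply: measurable_funB; [case: (Mb t)|case: (Mb s')].
- by move=> x; apply: derZ; exact: der_shift.
- by move=> x; case: (nF H' x nH').
- by move=> x; case: (nF H x nH).
- by move=> x; case: (nF H' x nH').
- exact: mF.
- exact: mF.
- exact: MF.
- exact: MF.
Qed.

(** [b t] is [b s] plus an independent increment; with that increment frozen, both factors are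
    functions of [b s] and the product rule gives the two terms. *)
Lemma bpath_stein_shift (F f u u' : R -> R) s t : 0 < s -> s <= t ->
  nice F -> nice f -> nice u -> nice u' -> der F f -> der u u' ->
  Ex P (fun w => b s w * (F (b s w) * u (b t w))) =
  s * (Ex P (fun w => f (b s w) * u (b t w)) + Ex P (fun w => F (b s w) * u' (b t w))).
Proof.
move=> s0 st nF nf nu nu' dF du.
have t0 : 0 <= t by rewrite (le_trans (ltW s0)).
have Mb r : 0 <= r -> moments P (b r) by exact: (bpath_moments bm).
have Ms := Mb s (ltW s0); have Mt := Mb t t0.
pose X w := b t w - b s w.
have eb w : b s w + X w = b t w by rewrite /X; ring.
pose K (p q : R -> R) (x y : R) := p y * q (y + x).
have mK p q : nice p -> nice q -> measurable_fun setT (fun z : R * R => K p q z.1 z.2).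
  move=> np nq; have mp := nice_meas np; have mq := nice_meas nq.
  apply: measurable_funM; first exact: (measurableT_comp mp measurable_snd).
  by apply: (measurableT_comp mq); exact: measurable_funD.
have MK p q : nice p -> nice q -> moments P (fun w => K p q (X w) (b s w)).
  move=> np nq; under eq_fun do rewrite /K eb.
  by apply: momentsM; exact: nice_moments.
have nK p q x : nice p -> nice q -> nice (K p q x).
  by move=> np nq; apply: niceM => //; exact: nice_shift.
have := @indep_stein _ _ _ P _ _ X (b s) s (K F u) (fun x y => K f u x y + K F u' x y) _
  (bm_gaussian_coord bm 0 s0) (indep_sym (bpath_indep_now bm (ltW s0) st)).
move=> H0.
transitivity (Ex P (fun w => b s w * K F u (X w) (b s w))).
  by congr Ex; apply/funext => w; rewrite /K eb.
have MX : measurable_fun setT X by apply: measurable_funB; [case: Mt|case: Ms].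
rewrite H0 => //.
- rewrite ExD; [|exact: MK..].
  by congr (_ * (_ + _)); congr (Ex P _); apply/funext => w; rewrite /K eb.
- by move=> x; apply: derM => //; exact: der_shift.
- by move=> x; apply: (niceD (nK _ _ x nf nu) (nK _ _ x nF nu')).1.
- by move=> x; case: (nK _ _ x nF nu).
- by move=> x; apply: (niceD (nK _ _ x nf nu) (nK _ _ x nF nu')).2.
- exact: mK.
- by apply: measurable_funD; exact: mK.
- exact: MK.
- by apply: momentsD; exact: MK.
Qed.

(* With [x = b s], integrating by parts twice against the Gaussian law of [x] turns
   [2 g(x) v] into [x^2 G v / s^2 - G v / s - 2 x G v' / s + G v'']. *)
Lemma bpath_decorrelation (g F G v v1 v2 : R -> R) s t A L : 0 < s -> s <= t ->
  t - s <= s -> der F (fun x => 2 * g x) -> der G F -> nice g ->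
  (forall x, `|G x| <= A) -> der v v1 -> der v1 v2 -> nice v2 ->
  (forall x, `|v2 x| <= L) -> v1 0 = 0 -> v 0 = 0 ->
  `|Ex P (fun w => g (b s w) * v (b t w))| <= 9 * (A * L).
Proof.
move=> s0 st ts dF dG ng GA dv dv1 nv2 v2L v10 v0.
have t0 : 0 <= t by rewrite (le_trans (ltW s0)).
have Ms : moments P (b s) by apply: (bpath_moments bm); exact: ltW.
have Mt : moments P (b t) by exact: (bpath_moments bm).
have n2g : nice (fun x => 2 * g x) by exact: niceZ.
have nF : nice F by apply: (nice_der dF); case: n2g.
have nG : nice G by apply: (nice_der dG); case: nF.
have nv1 : nice v1 by apply: (nice_der dv1); case: nv2.
have nv : nice v by apply: (nice_der dv); case: nv1.
have v1L x : `|v1 x| <= L * `|x| by exact: (der_linear_growth dv1).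
have L0 : 0 <= L by exact: le_trans (v2L 0).
have A0 : 0 <= A by exact: le_trans (GA 0).
have vL x : `|v x| <= L * x ^+ 2.
  have [c cx e] := der_MVT 0 x dv.
  have [c1 _] := between_norm cx; rewrite normr0 (max_idPr (normr_ge0 _)) in c1.
  rewrite v0 !subr0 in e; rewrite e normrM -real_normK ?num_real// expr2 mulrA.
  by rewrite ler_wpM2r// (le_trans (v1L c))// ler_wpM2l.
pose xG x := x * G x.
have dxG : der xG (fun x => G x + x * F x).
  by apply: (der_eq (derM (@der_id R) dG)) => x; rewrite mul1r.
have nid := @nice_id R.
have nxG : nice xG by exact: niceM.
have nxF : nice (fun x => x * F x) by exact: niceM.
have nd : nice (fun x => G x + x * F x) by exact: niceD.
(* Stein's identity for [F v], for [x G v] and for [G v1]; eliminating the mixed terms expresses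
   [2 E (g v)] through [G], [v], [v1] and [v2] alone. *)
have e1 := bpath_stein_shift s0 st nF n2g nv nv1 dF dv.
have e2 := bpath_stein_shift s0 st nxG nd nv nv1 dxG dv.
have e3 := bpath_stein_shift s0 st nG nF nv1 nv2 dG dv1.
have MM p q : nice p -> nice q -> moments P (fun w => p (b s w) * q (b t w)).
  by move=> np nq; apply: momentsM; exact: nice_moments.
have e2' : Ex P (fun w => (G (b s w) + b s w * F (b s w)) * v (b t w)) =
    Ex P (fun w => G (b s w) * v (b t w)) + Ex P (fun w => b s w * (F (b s w) * v (b t w))).
  rewrite -ExD; first by congr Ex; apply/funext => w; ring.
    exact: MM.
  by apply: momentsM => //; exact: MM.
rewrite e2' in e2.
have exG : Ex P (fun w => xG (b s w) * v1 (b t w)) = Ex P (fun w => b s w * (G (b s w) * v1 (b t w))).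
  by congr Ex; apply/funext => w; rewrite /xG; ring.
rewrite exG in e2.
have e4 : Ex P (fun w => 2 * g (b s w) * v (b t w)) = 2 * Ex P (fun w => g (b s w) * v (b t w)).
  by rewrite -ExZ; [congr Ex; apply/funext => w; ring|exact: MM].
rewrite e4 in e1.
pose Z w := s ^- 2 * (b s w * (xG (b s w) * v (b t w))) - s^-1 * (G (b s w) * v (b t w))
  - 2 * s^-1 * (b s w * (G (b s w) * v1 (b t w))) + G (b s w) * v2 (b t w).
have M1 : moments P (fun w => b s w * (xG (b s w) * v (b t w))) by apply: momentsM => //; exact: MM.
have M2 : moments P (fun w => b s w * (G (b s w) * v1 (b t w))) by apply: momentsM => //; exact: MM.
have M3 := MM _ _ nG nv; have M4 := MM _ _ nG nv2.
have MZ : moments P Z.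
  apply: momentsD => //; apply: momentsB; last exact: momentsZ.
  by apply: momentsB; exact: momentsZ.
have key : 2 * Ex P (fun w => g (b s w) * v (b t w)) = Ex P Z.
  rewrite /Z ExD//; last by apply: momentsB; [apply: momentsB|]; exact: momentsZ.
  rewrite ExB; [|by apply: momentsB; exact: momentsZ|exact: momentsZ].
  rewrite ExB; [|exact: momentsZ..].
  rewrite !ExZ//.
  move: e1 e2 e3.
  set a1 := Ex P (fun w => b s w * (F _ * _)); set a2 := Ex P (fun w => g _ * _).
  set a3 := Ex P (fun w => F _ * v1 _); set a4 := Ex P (fun w => b s w * (xG _ * _)).
  set a5 := Ex P (fun w => G _ * v _); set a6 := Ex P (fun w => b s w * (G _ * v1 _)).
  set a7 := Ex P (fun w => G _ * v2 _) => E1 E2 E3.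
  have -> : 2 * a2 = s^-1 * a1 - a3 by rewrite E1; field; rewrite gt_eqF.
  have -> : a1 = s^-1 * a4 - a5 - a6 by rewrite E2; field; rewrite gt_eqF.
  have -> : a3 = s^-1 * a6 - a7 by rewrite E3; field; rewrite gt_eqF.
  by field; rewrite gt_eqF.
suff HZ : `|Ex P Z| <= 18 * (A * L).
  by move: HZ; rewrite -key normrM (ger0_norm (ler0n _ _)); lra.
apply: (le_trans (Ex_norm_le MZ)).
pose y w := b t w - b s w.
have My : moments P y by exact: momentsB.
(* A majorant of [|Z|], from [|v(z)| <= L z^2], [|v1(z)| <= L |z|] and [z^2 <= 2 (x^2 + y^2)]. As
   [t - s <= s], its terms contribute at most [6 + 2 + 5 + 4 + 1 = 18] times [A L]. *)
pose U w := A * L * (2 * s ^- 2 * b s w ^+ 4 + 2 * s ^- 2 * (b s w ^+ 2 * y w ^+ 2)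
   + 5 * s^-1 * b s w ^+ 2 + 4 * s^-1 * y w ^+ 2 + 1).
have Mx m : moments P (fun w => b s w ^+ m) by exact: momentsX.
have My2 : moments P (fun w => y w ^+ 2) by exact: momentsX.
have Mxy : moments P (fun w => b s w ^+ 2 * y w ^+ 2) by exact: momentsM.
have Mc c : moments P (fun=> c : R) by exact: moments_cst.
have MU : moments P U.
  by apply: momentsZ; repeat first [exact: Mc|exact: momentsZ|apply: momentsD].
have si0 : 0 < s^-1 by rewrite invr_gt0.
apply: (@le_trans _ _ (Ex P U)).
  apply: Ex_le => //; first exact: moments_norm.
  move=> w; rewrite /Z /U /xG -exprVn; set x := b s w.
  have -> : b t w = x + y w by rewrite /y /x; ring.
  set z := x + y w; set i := s^-1.
  have HG : forall c h, `|c| <= L * h -> `|G x * c| <= A * L * h.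
    move=> c h ch; rewrite normrM -mulrA; apply: ler_pM => //; exact: GA.
  have b1 := HG _ _ (vL z).
  have b2 : `|G x * v2 z| <= A * L * 1 by apply: HG; rewrite mulr1.
  have b3 := HG _ _ (v1L z).
  have AL0 : 0 <= A * L by rewrite mulr_ge0.
  have z2 : z ^+ 2 <= 2 * (x ^+ 2 + y w ^+ 2) by have := sqr_ge0 (x - y w); rewrite /z; nra.
  have xz : 2 * (`|x| * `|z|) <= x ^+ 2 + z ^+ 2.
    have := sqr_ge0 (`|x| - `|z|); rewrite sqrrB !real_normK ?num_real//; lra.
  have x20 := sqr_ge0 x; have i20 := sqr_ge0 i.
  apply: (@le_trans _ _ (i ^+ 2 * (x ^+ 2 * `|G x * v z|) + i * `|G x * v z|
      + 2 * i * (`|x| * `|G x * v1 z|) + `|G x * v2 z|)).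
    apply: (le_trans (ler_normD _ _)); apply: lerD => //.
    apply: (le_trans (ler_normB _ _)); apply: lerD; last first.
      by rewrite !normrM (ger0_norm (ler0n _ _)) (gtr0_norm si0).
    apply: (le_trans (ler_normB _ _)); apply: lerD; last by rewrite normrM (gtr0_norm si0).
    rewrite normrM (ger0_norm i20) ler_wpM2l//.
    rewrite (_ : x * (x * G x * v z) = x ^+ 2 * (G x * v z)); last ring.
    by rewrite normrM (ger0_norm x20).
  have c1 : i ^+ 2 * (x ^+ 2 * `|G x * v z|) <= i ^+ 2 * (x ^+ 2 * (A * L * (2 * (x ^+ 2 + y w ^+ 2)))).
    do 2 (apply: ler_wpM2l => //); apply: (le_trans b1); exact: ler_wpM2l.
  have c2 : i * `|G x * v z| <= i * (A * L * (2 * (x ^+ 2 + y w ^+ 2))).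
    apply: ler_wpM2l; first exact: ltW.
    apply: (le_trans b1); exact: ler_wpM2l.
  have c3 : 2 * i * (`|x| * `|G x * v1 z|) <= i * (A * L * (x ^+ 2 + 2 * (x ^+ 2 + y w ^+ 2))).
    rewrite [leLHS](_ : _ = i * (2 * (`|x| * `|G x * v1 z|))); last ring.
    apply: ler_wpM2l; first exact: ltW.
    apply: (@le_trans _ _ (A * L * (2 * (`|x| * `|z|)))).
      rewrite [leRHS](_ : _ = 2 * (`|x| * (A * L * `|z|))); last ring.
      by do 2 (apply: ler_wpM2l => //).
    by apply: ler_wpM2l => //; lra.
  apply: (le_trans (lerD (lerD (lerD c1 c2) c3) b2)).
  rewrite le_eqVlt; apply/orP; left; apply/eqP; ring.
rewrite /U ExZ; last by repeat first [exact: Mc|exact: momentsZ|apply: momentsD].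
rewrite ExD//; last by repeat first [exact: Mc|exact: momentsZ|apply: momentsD].
rewrite ExD; [|by repeat first [exact: Mc|exact: momentsZ|apply: momentsD]|exact: momentsZ].
rewrite ExD; [|by apply: momentsD; exact: momentsZ|exact: momentsZ].
rewrite ExD; [|exact: momentsZ..].
rewrite !ExZ// Ex_cst.
have gs := bm_gaussian_coord bm 0 s0.
have eyy : Ex P (fun w => y w ^+ 2) = t - s by rewrite (bpath_Ex_sqr_inc bm)// ltW.
have exy : Ex P (fun w => b s w ^+ 2 * y w ^+ 2) = s * (t - s).
  rewrite (@indep_Ex_mul _ _ _ P _ _ (b s) y (fun x => x ^+ 2) (fun x => x ^+ 2)) => //.
  - by rewrite (gaussian_var gs) eyy.
  - by case: Ms.
  - by case: My.
  - exact: (bpath_indep_now bm (ltW s0) st).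
rewrite exy eyy (gaussian_pow4 gs) (gaussian_var gs) mulrC ler_wpM2r ?mulr_ge0//.
have r1 : s^-1 * (t - s) <= 1 by rewrite mulrC ler_pdivrMr ?mul1r.
rewrite (_ : 2 * s ^- 2 * (3 * s ^+ 2) = 6); last by field; rewrite gt_eqF.
rewrite (_ : 2 * s ^- 2 * (s * (t - s)) = 2 * (s^-1 * (t - s))); last by field; rewrite gt_eqF.
rewrite (_ : 5 * s^-1 * s = 5); last by field; rewrite gt_eqF.
by rewrite -mulrA; lra.
Qed.

End BrownianStein.

(** * Two-sided bounds for an abstract splitting of the drift *)

Section MeanSquare.
Context {R : realType} {d : measure_display} {T : measurableType d}.
Variable P : probability T R.
Variable omega : R -> T -> 'rV[R]_2.
Hypothesis bm : brownian_motion P omega.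
Notation b := (bpath omega).
Notation mu := (@lebesgue_measure R).

Lemma time_sum_linear_bound (e : R -> R) L delta n : 0 < delta -> nice e ->
  (forall x, `|e x| <= L * `|x|) ->
  Ex P (fun w => time_sum omega delta e n w ^+ 2) <= L ^+ 2 * (n%:R * delta) ^+ 3.
Proof.
move=> dl0 ne eL.
have Mb i := bgrid_moments bm dl0 i.
have Me i : moments P (fun w => e (bgrid omega delta i w)) by exact: nice_moments.
under eq_fun do rewrite /time_sum exprMn.
rewrite ExZ; last exact/momentsX/moments_sum.
apply: (@le_trans _ _ (delta ^+ 2 * (n%:R ^+ 2 * (L ^+ 2 * (n%:R * delta))))); last first.
  by rewrite le_eqVlt; apply/orP; left; apply/eqP; ring.
rewrite ler_wpM2l ?sqr_ge0//; apply: Ex_sqr_sum_le => // i iltn.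
apply: (@le_trans _ _ (Ex P (fun w => L ^+ 2 * bgrid omega delta i w ^+ 2))).
  apply: Ex_le; [exact: momentsX|exact/momentsZ/momentsX|].
  move=> w; rewrite -exprMn -real_normK ?num_real// -[leRHS]real_normK ?num_real//.
  by rewrite lerXn2r ?nnegrE// (le_trans (eL _))// normrM ler_wpM2r// ler_norm.
rewrite ExZ; last exact: momentsX.
rewrite ler_wpM2l ?sqr_ge0// (bpath_Ex_sqr bm); last exact: gpt_ge0.
by rewrite ler_wpM2r ?(ltW dl0)// ler_nat ltnW.
Qed.

(** Each increment is traded for a derivative of [h] at the final time by [bpath_stein_mid]: a
    discrete integration by parts on Wiener space. *)
Lemma stoch_sum_stein (f : nat -> R -> R) (h h' : R -> R) delta n : 0 < delta ->
  (forall i, nice (f i)) -> nice h' -> der h h' ->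
  Ex P (fun w => stoch_sum omega delta f n w * h (bgrid omega delta n w)) =
  delta * \sum_(0 <= i < n) Ex P (fun w => f i (bgrid omega delta i w) * h' (bgrid omega delta n w)).
Proof.
move=> dl0 nf nh' dh.
have nh : nice h by apply: (nice_der dh); case: nh'.
have Mb i := bgrid_moments bm dl0 i.
under eq_fun do rewrite /stoch_sum big_distrl /=.
rewrite Ex_sum; last first.
  move=> i _; apply: momentsM; last exact: nice_moments.
  by apply: momentsM; [exact: nice_moments|exact: (dgrid_moments bm)].
rewrite mulr_sumr; apply: eq_big_nat => i /andP[_ iltn].
rewrite (bpath_stein_mid bm (gpt_ge0 dl0 i) (gpt_ltS dl0 i) (gpt_le dl0 iltn) (nf i) nh nh' dh).
by rewrite gptS.
Qed.

Lemma sqr_sum5_le (x1 x2 x3 x4 x5 : R) :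
  (x1 + (x2 - x3 - x4 + x5)) ^+ 2 <=
  5 * (x1 ^+ 2 + x2 ^+ 2 + x3 ^+ 2 + x4 ^+ 2 + x5 ^+ 2).
Proof.
rewrite -subr_ge0 [leRHS](_ : _ = (x1 - x2) ^+ 2 + (x1 + x3) ^+ 2 + (x1 + x4) ^+ 2
  + (x1 - x5) ^+ 2 + (x2 + x3) ^+ 2 + (x2 + x4) ^+ 2 + (x2 - x5) ^+ 2 + (x3 - x4) ^+ 2
  + (x3 + x5) ^+ 2 + (x4 + x5) ^+ 2); last ring.
by rewrite !addr_ge0 ?sqr_ge0.
Qed.

Lemma ito_const_ge0 (B k0 t : R) : 0 <= t -> 0 <= ito_const B k0 t.
Proof.
move=> t0; rewrite /ito_const.
have := mulr_ge0 t0 (sqr_ge0 k0); have := mulr_ge0 (sqr_ge0 B) (sqr_ge0 t).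
by move=> ? ?; lra.
Qed.

Lemma archi_div (C e : R) : 0 < e -> exists2 n, (0 < n)%N & forall m, (n <= m)%N -> C / m%:R <= e.
Proof.
move=> e0; pose n := (Num.bound (C / e)).+1; exists n => // m nm.
have m0 : 0 < m%:R :> R by rewrite ltr0n (leq_trans _ nm).
rewrite ler_pdivrMr// mulrC -ler_pdivrMr//.
apply: (le_trans (ler_norm _)).
apply: (@le_trans _ _ n%:R); last by rewrite ler_nat.
have := archi_boundP (normr_ge0 (C / e)).
rewrite /n -natr1 => /ltW; rewrite /Num.bound /= normr_id => H.
by rewrite (le_trans H)// lerDl.
Qed.

Variable t : R.
Hypothesis t0 : 0 < t.

Lemma msd_upper (F g g1 kl k : R -> R) (B1 B2 S A L : R) :
  der F (fun x => 2 * g x) -> der g g1 ->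
  (forall x y, `|g1 x - g1 y| <= B1 * `|x - y|) ->
  (forall x y, `|kl x - kl y| <= B2 * `|x - y|) ->
  (forall x, k x = g1 x + kl x) ->
  (forall x, `|g x| <= S) -> (forall x, `|F x - F 0| <= A) ->
  (forall x, `|kl x| <= L * `|x|) ->
  (\int[P]_w ((wpath omega t w + path_int omega k t w) ^+ 2)%:E <=
   (6 * t + 5 * A ^+ 2 + 20 * (S ^+ 2 * t) + 5 * (L ^+ 2 * t ^+ 3))%:E)%E.
Proof.
move=> dF dg g1B klB kE gS FA klL.
have ng1 := nice_lipschitz g1B; have nkl := nice_lipschitz klB.
have ng : nice g by apply: (nice_der dg); case: ng1.
have nF : nice F by apply: (nice_der dF); case: (niceZ 2 ng).
have kB x y : `|k x - k y| <= (B1 + B2) * `|x - y|.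
  rewrite !kE opprD addrACA (le_trans (ler_normD _ _))// mulrDl.
  exact: lerD.
have MW : moments P (wpath omega t) by apply: (bm_moments bm); exact: ltW.
pose C := ito_const B1 (g1 0) t.
have C0 : 0 <= C by apply: ito_const_ge0; exact: ltW.
have t50 : 0 < t / 5 by rewrite divr_gt0.
have [n n0 nC] := archi_div (t * C) t50.
apply: (path_int_msd_le bm kB t0 MW n0) => q.
set N := (n * q.+1)%N; have N0 : (0 < N)%N by rewrite muln_gt0 n0.
have NR : 0 < N%:R :> R by rewrite ltr0n.
set dl := t / N%:R; have dl0 : 0 < dl by rewrite divr_gt0.
have Ndl : N%:R * dl = t by rewrite /dl mulrC divfK// gt_eqF.
have Mb i := bgrid_moments bm dl0 i.
pose e w := F (bgrid omega dl N w) - F 0 - 2 * stoch_sum omega dl (fun=> g) N w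
  - time_sum omega dl g1 N w.
have Ee : Ex P (fun w => e w ^+ 2) <= t / 5.
  apply: (le_trans (discrete_ito bm dl0 N dF dg g1B)).
  rewrite /gpt Ndl -/C; have := nC N (leq_pmulr _ (ltn0Sn q)).
  by rewrite /dl mulrAC.
have MF : moments P (fun w => F (bgrid omega dl N w)) by exact: nice_moments.
have Mst : moments P (stoch_sum omega dl (fun=> g) N) by apply: (stoch_sum_moments bm).
have Mt1 : moments P (time_sum omega dl g1 N) by apply: (time_sum_moments bm).
have Mtl : moments P (time_sum omega dl kl N) by apply: (time_sum_moments bm).
have MF0 : moments P (fun w => F (bgrid omega dl N w) - F 0).
  by apply: momentsB => //; exact: moments_cst.
have Me : moments P e by apply: momentsB => //; apply: momentsB => //; exact: momentsZ.
pose U w := 5 * (wpath omega t w ^+ 2 + (F (bgrid omega dl N w) - F 0) ^+ 2 +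
  (2 * stoch_sum omega dl (fun=> g) N w) ^+ 2 + e w ^+ 2 + time_sum omega dl kl N w ^+ 2).
have M2 : moments P (fun w => (2 * stoch_sum omega dl (fun=> g) N w) ^+ 2) by apply/momentsX/momentsZ.
have MW2 := momentsX 2 MW; have MF2 := momentsX 2 MF0; have Me2 := momentsX 2 Me.
have Ml2 := momentsX 2 Mtl.
apply: (@le_trans _ _ (Ex P U)).
  apply: Ex_le.
  - by apply/momentsX/momentsD => //; apply: (time_sum_moments bm) => //; case: (nice_lipschitz kB).
  - by apply/momentsZ; do 4 (apply: momentsD => //).
  - move=> w; apply: le_trans (sqr_sum5_le _ _ _ _ _).
    rewrite le_eqVlt; apply/orP; left; apply/eqP; congr ((_ + _) ^+ 2).
    have -> : time_sum omega dl k N w = time_sum omega dl g1 N w + time_sum omega dl kl N w.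
      rewrite /time_sum -mulrDr -big_split /=; congr (_ * _).
      by apply: eq_bigr => i _; exact: kE.
    by rewrite /e; ring.
rewrite /U ExZ; last by do 4 (apply: momentsD => //).
rewrite ExD//; last by do 3 (apply: momentsD => //).
rewrite ExD//; last by do 2 (apply: momentsD => //).
rewrite ExD//; last by do 1 (apply: momentsD => //).
rewrite ExD//.
have E1 : Ex P (fun w => wpath omega t w ^+ 2) = t by exact: (gaussian_var (bm_gaussian_coord bm 1 t0)).
have sqr_bound c (x : R) : `|x| <= c -> x ^+ 2 <= c ^+ 2.
  move=> xc; rewrite -real_normK ?num_real// lerXn2r ?nnegrE//.
  exact: le_trans xc.
have E2 : Ex P (fun w => (F (bgrid omega dl N w) - F 0) ^+ 2) <= A ^+ 2.
  rewrite -[leRHS](Ex_cst P); apply: Ex_le => //; first exact: moments_cst.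
  by move=> w; exact: sqr_bound.
have E3 : Ex P (fun w => (2 * stoch_sum omega dl (fun=> g) N w) ^+ 2) <= 4 * (S ^+ 2 * t).
  under eq_fun do rewrite exprMn.
  rewrite ExZ; last exact: momentsX.
  rewrite expr2 -natrM; apply: ler_wpM2l => //.
  rewrite (_ : (fun w => _) = fun w => stoch_sum omega dl (fun=> g) N w * stoch_sum omega dl (fun=> g) N w); last first.
    by apply/funext => w; rewrite expr2.
  rewrite (stoch_sum_isometry bm dl0)// -Ndl mulrA [leRHS]mulrC ler_wpM2l ?(ltW dl0)//.
  rewrite mulrC mulr_natl -[N in leRHS]subn0 -sumr_const_nat.
  apply: ler_sum_nat => i _; rewrite -[leRHS](Ex_cst P); apply: Ex_le.
  - by apply: momentsM; exact: nice_moments.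
  - exact: moments_cst.
  - by move=> w; rewrite -expr2; exact: sqr_bound.
have := time_sum_linear_bound N dl0 nkl klL; rewrite Ndl => E4.
rewrite E1; lra.
Qed.

(* With [X = E ((W + X_t) Z)], [Q = E Z^2] and [V = E ((W + X_t)^2)], the three errors
   [r1], [r2], [r3] cannot compensate [- 2 Q]. *)
Lemma quarter_gap (V Q q A X r1 r2 r3 c : R) : 0 < q -> q ^+ 2 = Q ->
  c <= Q -> `|r1| <= A * q -> 0 <= A -> A ^+ 2 <= 3 * c -> `|r2| <= c / 10 ->
  r3 ^+ 2 <= c / 20 / 20 * Q -> X = - 2 * Q + r1 + r2 + r3 -> X ^+ 2 <= V * Q ->
  c / 10 / 10 <= V.
Proof.
move=> q0 qQ cQ r1A A0 Ac r2c r3c XE XV.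
have Q0 : 0 < Q by rewrite -qQ exprn_gt0.
(* [A^2 <= 3 Q] and [3 <= (7/4)^2]. The errors then add up to at most [7/4 + 1/10 + 1/20 = 19/10] of
   [Q], leaving [X <= - Q / 10]. *)
have Aq : A <= 7 / 4 * q.
  rewrite -ler_sqr ?nnegrE ?mulr_ge0 ?(ltW q0)// exprMn qQ.
  apply: (le_trans Ac); lra.
have r1Q : `|r1| <= 7 / 4 * Q.
  by rewrite (le_trans r1A)// -qQ expr2 mulrA ler_wpM2r// ltW.
have r3Q : `|r3| <= Q / 20.
  rewrite -ler_sqr ?nnegrE ?divr_ge0 ?(ltW Q0)// real_normK ?num_real//.
  apply: (le_trans r3c); rewrite exprMn.
  have : c * Q <= Q * Q by rewrite ler_wpM2r// ltW.
  rewrite expr2 => ?; lra.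
have X1 : X <= - (Q / 10).
  move: r1Q r2c r3Q; rewrite !ler_norml => /andP[_ ?] /andP[_ ?] /andP[_ ?]; rewrite XE; lra.
have X2 : (Q / 10) ^+ 2 <= X ^+ 2.
  have : 0 <= (- X - Q / 10) * (- X + Q / 10) by apply: mulr_ge0; lra.
  lra.
have : Q * (Q / 10 / 10) <= Q * V.
  by rewrite [leRHS]mulrC; apply: le_trans XV; apply: le_trans X2; lra.
rewrite ler_pM2l//; lra.
Qed.

(* The error term [eta] allows [v] to be a finite partial sum of the remaining levels. *)
Lemma msd_lower (G F g g1 v v1 v2 k : R -> R) (B1 Bk A1 A2 L eta c0 : R) :
  der G F -> der F (fun x => 2 * g x) -> der g g1 ->
  (forall x y, `|g1 x - g1 y| <= B1 * `|x - y|) ->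
  (forall x, `|F x| <= A1) -> (forall x, `|G x| <= A2) ->
  der v v1 -> der v1 v2 -> nice v2 -> (forall x, `|v2 x| <= L) -> v1 0 = 0 -> v 0 = 0 ->
  (forall x y, `|k x - k y| <= Bk * `|x - y|) ->
  (forall x, `|k x - g1 x - v1 x| <= eta * `|x|) ->
  0 < c0 -> (forall s, t / 2 <= s -> s <= t -> c0 <= Ex P (fun w => g (b s w) ^+ 2)) ->
  A1 ^+ 2 <= 3 / 2 * (c0 * t) -> 18 * (40 * (A2 * L)) <= c0 -> eta ^+ 2 * t ^+ 2 <= c0 / 40 / 80 ->
  ((c0 * t / 20 / 40)%:E <=
   \int[P]_w ((wpath omega t w + path_int omega k t w) ^+ 2)%:E)%E.
Proof.
move=> dG dF dg g1B FA GA dv dv1 nv2 v2L v10 v00 kB keta c00 gc0 A1c A2c etac.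
have ng1 := nice_lipschitz g1B; have nk := nice_lipschitz kB.
have ng : nice g by apply: (nice_der dg); case: ng1.
have nF : nice F by apply: (nice_der dF); case: (niceZ 2 ng).
have nv1 : nice v1 by apply: (nice_der dv1); case: nv2.
have nv : nice v by apply: (nice_der dv); case: nv1.
pose e x := k x - g1 x - v1 x.
have ne : nice e by apply: niceB => //; exact: niceB.
pose f x := g x + v x; pose f1 x := g1 x + v1 x.
have df : der f f1 by exact: derD.
have nf : nice f by exact: niceD.
have f1B x y : `|f1 x - f1 y| <= (B1 + L) * `|x - y|.
  rewrite /f1 opprD addrACA (le_trans (ler_normD _ _))// mulrDl lerD//.
  exact: der_lipschitz.
(* Ito's formula is applied to [g] and [v] together. The antiderivative [V] may be unbounded:
   [stoch_sum_stein] evaluates the correlation of [Z] with [H (b t)] through the derivative of [H]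
   alone. *)
have [V [dV _]] := primitive nv.1.
pose H x := F x + 2 * V x.
have dH : der H (fun x => 2 * f x).
  by apply: (der_eq (derD dF (derZ 2 dV))) => x; rewrite /f; ring.
have MW : moments P (wpath omega t) by apply: (bm_moments bm); exact: ltW.
pose c := c0 * t / 2.
have c_gt0 : 0 < c by rewrite divr_gt0// mulr_gt0.
pose C := ito_const (B1 + L) (f1 0) t.
have e1 : 0 < c / 40 / 40 by lra.
have e2 : 0 < c / 20 / 20 by lra.
have [m1 m10 H1] := archi_div (t * C) e1.
have [m2 m20 H2] := archi_div (t ^+ 2 * (Bk ^+ 2 * t)) e2.
(* An even number of cells, so that [t / 2] is the grid time of index [m]. *)
pose m := (m1 + m2)%N; pose N := (m + m)%N.
have N0 : (0 < N)%N by rewrite !addn_gt0 m10.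
have m0 : (0 < m)%N by rewrite addn_gt0 m10.
have NR : 0 < N%:R :> R by rewrite ltr0n.
pose dl := t / N%:R; have dl0 : 0 < dl by rewrite divr_gt0.
have Ndl : N%:R * dl = t by rewrite /dl mulrC divfK// gt_eqF.
have mdl : m%:R * dl = t / 2 by rewrite -Ndl /N natrD; field.
have {}H1 : dl * C <= c / 40 / 40.
  by rewrite /dl mulrAC; apply: H1; rewrite /N /m -!addnA leq_addr.
have {}H2 : t ^+ 2 * (Bk ^+ 2 * dl) <= c / 20 / 20.
  have -> : t ^+ 2 * (Bk ^+ 2 * dl) = t ^+ 2 * (Bk ^+ 2 * t) / N%:R by rewrite /dl !mulrA.
  by apply: H2; rewrite /N /m -addnA addnCA leq_addr.
have := path_int_msd_ge bm kB t0 MW N0; rewrite -/dl.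
apply: le_trans; rewrite lee_fin.
(* Passing from the grid to the integral halves the bound and subtracts at most [c / 400]; what
   remains is [c / 200 - c / 400 = c0 t / 800]. *)
suff : c / 10 / 10 <= Ex P (fun w => (wpath omega t w + time_sum omega dl k N w) ^+ 2).
  rewrite /c in H2 *; lra.
have Mb i := bgrid_moments bm dl0 i.
(* The sum [Z] only uses times in [[t / 2, t]], where [gc0] applies. *)
pose zf (i : nat) : R -> R := if (i < m)%N then (fun=> 0) else g.
have nzf i : nice (zf i) by rewrite /zf; case: ifP => // _; exact: nice_cst.
pose Z := stoch_sum omega dl zf N.
have MZ : moments P Z by apply: (stoch_sum_moments bm).
have bN w : bgrid omega dl N w = b t w by rewrite /bgrid /gpt Ndl.
pose Q := Ex P (fun w => Z w ^+ 2).
have ZE h : (forall i, nice (h i)) -> Ex P (fun w => stoch_sum omega dl h N w * Z w) =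
    dl * \sum_(0 <= i < N) Ex P (fun w => h i (bgrid omega dl i w) * zf i (bgrid omega dl i w)).
  by move=> nh; rewrite (stoch_sum_isometry bm dl0).
have QE : Q = dl * \sum_(0 <= i < N) Ex P (fun w => zf i (bgrid omega dl i w) ^+ 2).
  rewrite /Q (_ : (fun w => Z w ^+ 2) = fun w => Z w * Z w); last by apply/funext => w; rewrite expr2.
  by rewrite ZE.
have cQ : c <= Q.
  rewrite QE /c -mulrA -mdl (big_cat_nat (n := m)) ?leq_addr//= mulrDr.
  apply: (@le_trans _ _ (dl * \sum_(m <= i < N) c0)).
    by rewrite sumr_const_nat addnK -mulr_natl le_eqVlt; apply/orP; left; apply/eqP; ring.
  rewrite -[leLHS]add0r lerD//.
    by rewrite mulr_ge0 ?(ltW dl0)// sumr_ge0// => i _; apply: Ex_ge0 => w; exact: sqr_ge0.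
  rewrite ler_wpM2l ?(ltW dl0)//; apply: ler_sum_nat => i /andP[mi iN].
  rewrite /zf ltnNge mi /=; apply: gc0.
    by rewrite -mdl ler_wpM2r ?(ltW dl0)// ler_nat.
  by rewrite -Ndl ler_wpM2r ?(ltW dl0)// ler_nat ltnW.
have Q0 : 0 < Q by exact: lt_le_trans cQ.
pose q := Num.sqrt Q.
have q0 : 0 < q by rewrite sqrtr_gt0.
have qQ : q ^+ 2 = Q by rewrite sqr_sqrtr// ltW.
have A10 : 0 <= A1 by exact: le_trans (FA 0).
pose err w := H (bgrid omega dl N w) - H 0 - 2 * stoch_sum omega dl (fun=> f) N w
  - time_sum omega dl f1 N w.
pose Te := time_sum omega dl e N.
have nH : nice H by apply: (nice_der dH); case: (niceZ 2 nf).
have MTe : moments P Te by apply: (time_sum_moments bm).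
have MH : moments P (fun w => H (bgrid omega dl N w)) by exact: nice_moments.
have Mst : moments P (stoch_sum omega dl (fun=> f) N) by apply: (stoch_sum_moments bm).
have Mt1 : moments P (time_sum omega dl f1 N).
  by apply: (time_sum_moments bm) => //; exact: niceD.
have Merr : moments P err.
  by do 2 apply: momentsB => //; [apply: momentsB => //; exact: moments_cst|exact: momentsZ].
have Eerr : Ex P (fun w => err w ^+ 2) <= c / 40 / 40.
  by apply: (le_trans (discrete_ito bm dl0 N dH df f1B)); rewrite /gpt Ndl.
have ETe : Ex P (fun w => Te w ^+ 2) <= c / 40 / 40.
  apply: (le_trans (time_sum_linear_bound N dl0 ne keta)); rewrite Ndl /c.
  have : t * (eta ^+ 2 * t ^+ 2) <= t * (c0 / 40 / 80) by rewrite ler_pM2l.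
  lra.
pose r1 := Ex P (fun w => F (b t w) * Z w).
(* The first expectation comes from Stein's identity for the [V] part of [H], the second from the
   isometry for the [v] part of the martingale. *)
pose r2 := 2 * (dl * \sum_(0 <= i < N) (Ex P (fun w => zf i (bgrid omega dl i w) * v (b t w)) -
   Ex P (fun w => zf i (bgrid omega dl i w) * v (bgrid omega dl i w)))).
pose r3 := Ex P (fun w => (Te w - err w) * Z w).
have MFb : moments P (fun w => F (b t w)).
  by apply: nice_moments => //; apply: (bpath_moments bm); exact: ltW.
have r1A : `|r1| <= A1 * q.
  rewrite -ler_sqr ?nnegrE ?mulr_ge0 ?(ltW q0)// real_normK ?num_real// exprMn qQ.
  apply: (le_trans (Ex_cauchy_schwarz MFb MZ)); rewrite -/Q ler_wpM2r ?(ltW Q0)//.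
  rewrite -[leRHS](Ex_cst P); apply: Ex_le; [exact: momentsX|exact: moments_cst|].
  by move=> w; rewrite -real_normK ?num_real// lerXn2r ?nnegrE.
have r2c : `|r2| <= c / 10.
  have dec i : (0 <= i < N)%N -> `|Ex P (fun w => zf i (bgrid omega dl i w) * v (b t w)) -
     Ex P (fun w => zf i (bgrid omega dl i w) * v (bgrid omega dl i w))| <= 18 * (A2 * L).
    move=> /andP[_ iN]; rewrite /zf; case: ltnP => mi.
      have z0 (u : T -> R) : Ex P (fun w => 0 * u w) = 0.
        by rewrite (_ : (fun w => 0 * u w) = fun=> 0) ?Ex_cst//; apply/funext => w; rewrite mul0r.
      rewrite !z0 subrr normr0 mulr_ge0// mulr_ge0//; first exact: le_trans (GA 0).
      exact: le_trans (v2L 0).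
    have s0 : 0 < gpt dl i by rewrite mulr_gt0// ltr0n (leq_trans m0).
    have st : gpt dl i <= t by rewrite -Ndl ler_wpM2r ?(ltW dl0)// ler_nat ltnW.
    have s2 : t / 2 <= gpt dl i by rewrite -mdl ler_wpM2r ?(ltW dl0)// ler_nat.
    have ts : t - gpt dl i <= gpt dl i by lra.
    have ss : gpt dl i - gpt dl i <= gpt dl i by rewrite subrr ltW.
    (* No cancellation is sought in the difference: each expectation is at most [9 A2 L], the second
       one as the case [t = s]. *)
    apply: (le_trans (ler_normB _ _)).
    have := bpath_decorrelation bm s0 st ts dF dG ng GA dv dv1 nv2 v2L v10 v00.
    have := bpath_decorrelation bm s0 (lexx _) ss dF dG ng GA dv dv1 nv2 v2L v10 v00.
    rewrite /bgrid; lra.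
  rewrite /r2 normrM (ger0_norm (ler0n _ _)) normrM (gtr0_norm dl0).
  apply: (@le_trans _ _ (2 * (dl * (N%:R * (18 * (A2 * L)))))).
    do 2 (rewrite ler_wpM2l ?(ltW dl0)//).
    apply: (le_trans (ler_norm_sum _ _ _)).
    rewrite [leRHS](_ : _ = \sum_(0 <= i < N) 18 * (A2 * L)); first exact: ler_sum_nat.
    by rewrite sumr_const_nat subn0 -[RHS]mulr_natl.
  rewrite [leLHS](_ : _ = 36 * (A2 * L) * (N%:R * dl)); last ring.
  rewrite Ndl /c.
  have : 18 * (40 * (A2 * L)) * t <= c0 * t by rewrite ler_pM2r.
  lra.
have r3c : r3 ^+ 2 <= c / 20 / 20 * Q.
  have MTE : moments P (fun w => Te w - err w) by exact: momentsB.
  apply: (le_trans (Ex_cauchy_schwarz MTE MZ)); rewrite -/Q ler_wpM2r ?(ltW Q0)//.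
  have := Ex_sqrD_le MTe (momentsN Merr).
  have -> : Ex P (fun w => (- err w) ^+ 2) = Ex P (fun w => err w ^+ 2).
    by congr Ex; apply/funext => w; rewrite sqrrN.
  move=> /le_trans; apply; lra.
pose X := Ex P (fun w => (wpath omega t w + time_sum omega dl k N w) * Z w).
have MT : moments P (time_sum omega dl k N) by apply: (time_sum_moments bm).
(* [Z] is orthogonal to [W] and to constants; Stein's identity evaluates [E (Z H(b t))], and the
   isometry the correlation of [Z] with the martingale of [f]. Since [zf i] is 0 or [g], the product
   of [f] and [zf i] is [zf i ^ 2 + v zf i], which produces [- 2 Q]. *)
have XE : X = - 2 * Q + r1 + r2 + r3.
  have EWZ : Ex P (fun w => wpath omega t w * Z w) = 0.
    rewrite /Z /stoch_sum; under eq_fun do rewrite mulr_sumr.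
    have Mz i : moments P (fun w => zf i (bgrid omega dl i w) * dgrid omega dl i w).
      by apply: momentsM; [exact: nice_moments|exact: (dgrid_moments bm)].
    rewrite Ex_sum; last by move=> i _; exact: momentsM.
    rewrite big_nat big1// => i /andP[_ iN].
    have mz : measurable_fun setT (fun z : R * R => zf i z.1 * z.2).
      apply: measurable_funM => //.
      exact: (measurableT_comp (nice_meas (nzf i)) measurable_fst).
    have := wpath_Ex_orthogonal bm (gpt_ge0 dl0 i) (ltW (gpt_ltS dl0 i)) _ mz (Mz i).
    move=> /(_ t) WO; rewrite -[RHS]WO; first by congr Ex; apply/funext => w; rewrite mulrC.
    by rewrite -Ndl ler_wpM2r ?(ltW dl0)// ler_nat.
  have EcZ : Ex P (fun w => Z w * H 0) = 0.
    rewrite (@stoch_sum_stein zf (fun=> H 0) (fun=> 0) dl N)//; last 2 first.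
    - exact: nice_cst.
    - exact: der_cst.
    rewrite big1 ?mulr0// => i _.
    by rewrite (_ : (fun w => _) = fun=> 0) ?Ex_cst//; apply/funext => w; rewrite mulr0.
  have n2f : nice (fun x => 2 * f x) by exact: niceZ.
  have n2g : nice (fun x => 2 * g x) by exact: niceZ.
  have EHZ := stoch_sum_stein N dl0 nzf n2f dH.
  have EFZ := stoch_sum_stein N dl0 nzf n2g dF.
  have Efz := ZE (fun=> f) (fun=> nf).
  have splitE w : (wpath omega t w + time_sum omega dl k N w) * Z w =
      wpath omega t w * Z w + (Z w * H (bgrid omega dl N w) - Z w * H 0
      - 2 * (stoch_sum omega dl (fun=> f) N w * Z w) + (Te w - err w) * Z w).
    have -> : time_sum omega dl k N w = time_sum omega dl f1 N w + Te w.
      rewrite /Te /time_sum -mulrDr -big_split /=; congr (_ * _).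
      by apply: eq_bigr => i _; rewrite /e /f1; ring.
    by rewrite /err; ring.
  rewrite /X; under eq_fun do rewrite splitE.
  have a1 : moments P (fun w => wpath omega t w * Z w) by exact: momentsM.
  have a2 : moments P (fun w => Z w * H (bgrid omega dl N w)) by exact: momentsM.
  have a3 : moments P (fun w => Z w * H 0) by apply: momentsM => //; exact: moments_cst.
  have a4 : moments P (fun w => stoch_sum omega dl (fun=> f) N w * Z w) by exact: momentsM.
  have a5 : moments P (fun w => (Te w - err w) * Z w) by apply: momentsM => //; exact: momentsB.
  have a23 := momentsB a2 a3; have a24 := momentsB a23 (momentsZ 2 a4).
  rewrite ExD//; last exact: momentsD.
  rewrite ExD// ExB//; last exact: momentsZ.
  rewrite ExB// ExZ// EWZ EcZ -/r3 EHZ Efz add0r subr0; congr (_ + _).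
  have -> : r1 = dl * \sum_(0 <= i < N) Ex P (fun w => zf i (bgrid omega dl i w) * (2 * g (bgrid omega dl N w))).
    by rewrite -EFZ /r1; congr Ex; apply/funext => w; rewrite bN mulrC.
  rewrite QE /r2.
  set S1 := \sum_(_ <= _ < _) _; set S2 := \sum_(_ <= _ < _) _.
  set S3 := \sum_(_ <= _ < _) _; set S4 := \sum_(_ <= _ < _) _; set S5 := \sum_(_ <= _ < _) _.
  suff E : S1 - 2 * S2 = - 2 * S3 + S4 + 2 * S5.
    transitivity (dl * (S1 - 2 * S2)); first ring.
    by rewrite E; ring.
  rewrite /S1 /S2 /S3 /S4 /S5.
  rewrite !mulr_sumr -sumrB -!big_split /=; apply: eq_big_nat => i _.
  have mz := nice_moments (nzf i) (Mb i).
  have mgN := nice_moments ng (Mb N); have mvN := nice_moments nv (Mb N).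
  have mgi := nice_moments ng (Mb i); have mvi := nice_moments nv (Mb i).
  have E1 : Ex P (fun w => zf i (bgrid omega dl i w) * (2 * f (bgrid omega dl N w))) =
     Ex P (fun w => zf i (bgrid omega dl i w) * (2 * g (bgrid omega dl N w))) +
     2 * Ex P (fun w => zf i (bgrid omega dl i w) * v (b t w)).
    rewrite -ExZ; last by apply: momentsM => //; under eq_fun do rewrite -bN.
    rewrite -ExD.
    - by congr Ex; apply/funext => w; rewrite -bN /f; ring.
    - by apply: momentsM => //; exact: momentsZ.
    - by apply/momentsZ/momentsM => //; under eq_fun do rewrite -bN.
  have E2 : Ex P (fun w => f (bgrid omega dl i w) * zf i (bgrid omega dl i w)) =
     Ex P (fun w => zf i (bgrid omega dl i w) ^+ 2) +
     Ex P (fun w => zf i (bgrid omega dl i w) * v (bgrid omega dl i w)).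
    rewrite -ExD; [|exact: momentsX|exact: momentsM].
    congr Ex; apply/funext => w; rewrite /f /zf; case: ifP => _; ring.
  by rewrite E1 E2; ring.
have MWT : moments P (fun w => wpath omega t w + time_sum omega dl k N w) by exact: momentsD.
have XV := Ex_cauchy_schwarz MWT MZ; rewrite -/X -/Q in XV.
have A1c' : A1 ^+ 2 <= 3 * c by rewrite /c; lra.
exact: (quarter_gap q0 qQ cQ r1A A10 A1c' r2c r3c XE XV).
Qed.

End MeanSquare.

(** * The drift of the shear flow *)

Section SeriesDerivative.
Context {R : realType}.

Lemma cvg_dist_le (s : nat -> R) (l c e : R) N : s @ \oo --> l ->
  (forall M, (N <= M)%N -> `|s M - c| <= e) -> `|l - c| <= e.
Proof.
move=> sl H; apply/ler_addgt0Pr => x x0.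
have [M [NM dM]] : exists M, (N <= M)%N /\ `|l - s M| <= x.
  move/cvgrPdist_le : sl => /(_ x x0)[M _ MP].
  by exists (maxn N M); rewrite leq_maxl; split => //; apply: MP; rewrite /= leq_maxr.
have := ler_distD (s M) l c; have := H M NM; lra.
Qed.

(** The induction needs the stronger bound [2 a N - 2 a M], which telescopes. *)
Lemma halving_tail (a : nat -> R) N M : (forall n, 0 <= a n) ->
  (forall n, a n.+1 <= a n / 2) -> \sum_(N <= n < M) a n <= 2 * a N.
Proof.
move=> a0 ah; case: (leqP N M) => [NM|/ltnW MN]; last by rewrite big_geq// mulr_ge0.
suff : \sum_(N <= n < M) a n <= 2 * a N - 2 * a M by have := a0 M; lra.
rewrite -(subnKC NM); elim: (M - N)%N => [|j IH].
  by rewrite addn0 big_geq// subrr.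
rewrite addnS big_nat_recr ?leq_addr//=.
have := ah (N + j)%N; lra.
Qed.

Lemma halving_geometric (a : nat -> R) n : (forall n, a n.+1 <= a n / 2) ->
  a n <= a 0%N * (2^-1) ^+ n.
Proof.
move=> ah; elim: n => [|n IH]; first by rewrite expr0 mulr1.
by apply: (le_trans (ah n)); rewrite exprSr mulrA ler_pM2r// invr_gt0.
Qed.

Lemma halving_cvg0 (a : nat -> R) e : (forall n, 0 <= a n) ->
  (forall n, a n.+1 <= a n / 2) -> 0 < e -> exists N, forall n, (N <= n)%N -> a n <= e.
Proof.
move=> a0 ah e0.
have H := @cvg_geometric R (a 0%N) 2^-1 _.
have {}H : geometric (a 0%N) 2^-1 @ \oo --> (0 : R).
  by apply: H; rewrite ger0_norm ?invr_ge0// invf_lt1// ltr1n.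
move/cvgr0Pnorm_le : H => /(_ e e0)[N _ NP].
exists N => n Nn; apply: (le_trans (halving_geometric n ah)).
by apply: le_trans (NP n Nn); rewrite ler_norm.
Qed.

(** The bounds [a n] concern second derivatives. The vanishing of [u n] and [u1 n] at 0 turns them
    into [a n |x|] for first derivatives and makes both series converge locally uniformly, even if
    the [u n] have growing amplitudes, as the levels of the flow do. *)
Lemma series_termwise_derivative (u u1 u2 : nat -> R -> R) (a : nat -> R) :
  (forall n, der (u n) (u1 n)) -> (forall n, der (u1 n) (u2 n)) ->
  (forall n x, `|u2 n x| <= a n) -> (forall n, u1 n 0 = 0) -> (forall n, u n 0 = 0) ->
  (forall n, a n.+1 <= a n / 2) ->
  exists k : R -> R, [/\ der (fun x => limn (series (u ^~ x))) k,
    forall x y, `|k x - k y| <= 2 * a 0%N * `|x - y| &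
    forall N x, `|k x - \sum_(0 <= n < N) u1 n x| <= 2 * a N * `|x|].
Proof.
move=> du du1 u2a u10 u00 ah.
have a0 n : 0 <= a n by exact: le_trans (u2a n 0).
pose S1 N M x := \sum_(N <= n < M) u1 n x.
have dS1 N M : der (S1 N M) (fun x => \sum_(N <= n < M) u2 n x) by exact: der_sum.
have S2a N M x : `|\sum_(N <= n < M) u2 n x| <= 2 * a N.
  apply: (le_trans (ler_norm_sum _ _ _)); apply: le_trans (halving_tail _ _ a0 ah).
  by apply: ler_sum => n _.
have S10 N M : S1 N M 0 = 0 by rewrite /S1 big1// => n _.
have S1a N M x : `|S1 N M x| <= 2 * a N * `|x|.
  exact: (der_linear_growth (dS1 N M) (S2a N M)).
have cS1 x : cvgn (series (u1 ^~ x)).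
  apply: normed_cvg.
  apply: (@series_le_cvg R _ (fun n => a 0%N * `|x| * 2^-1 ^+ n)).
  - by move=> n; rewrite /= normr_ge0.
  - by move=> n; rewrite mulr_ge0 ?exprn_ge0 ?invr_ge0// mulr_ge0.
  - move=> n; rewrite mulrAC.
    apply: (@le_trans _ _ (a n * `|x|)); last by rewrite ler_wpM2r// halving_geometric.
    exact: (der_linear_growth (du1 n) (u2a n)).
  - apply: (@is_cvg_geometric_series R (a 0%N * `|x|)).
    by rewrite ger0_norm ?invr_ge0// invf_lt1// ltr1n.
pose k x := limn (series (u1 ^~ x)).
have kP x : (fun N => S1 0%N N x) @ \oo --> k x by exact: cS1.
have tail N x : `|k x - S1 0%N N x| <= 2 * a N * `|x|.
  apply: (@cvg_dist_le (fun M => S1 0%N M x) _ _ _ N (kP x)) => M NM.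
  rewrite /S1 (big_cat_nat (n := N))//= addrAC subrr add0r.
  exact: S1a.
have kB x y : `|k x - k y| <= 2 * a 0%N * `|x - y|.
  have kxy : (fun N => S1 0%N N x - S1 0%N N y) @ \oo --> k x - k y.
    by apply: cvgB; exact: kP.
  rewrite -[k x - k y]subr0; apply: (@cvg_dist_le _ _ _ _ 0%N kxy) => M _.
  rewrite subr0; exact: (der_lipschitz (dS1 0%N M) (S2a 0%N M)).
exists k; split => //.
have [ck _] := nice_lipschitz kB.
(* The sum of the [u n] is identified with the primitive of [k] vanishing at 0: its difference from
   a partial sum has a tail of [k] as derivative. *)
have [K [dK K0]] := primitive ck.
suff KE x : limn (series (u ^~ x)) = K x.
  by rewrite (_ : (fun x => _) = K)//; apply/funext.
apply/cvg_lim => //; apply/cvgrPdist_le => e e0.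
have e1 : 0 < e / (2 * (x ^+ 2 + 1)) by rewrite divr_gt0// mulr_gt0// ltr_wpDl ?sqr_ge0.
have [N NP] := halving_cvg0 a0 ah e1.
exists N => // n /= Nn; rewrite /series /=.
pose D z := K z - \sum_(0 <= i < n) u i z.
have dD : der D (fun z => k z - S1 0%N n z) by apply: derB => //; exact: der_sum.
have D0 : D 0 = 0 by rewrite /D K0 big1 ?subrr// => i _.
have [c cx E] := der_MVT 0 x dD.
have [c1 _] := between_norm cx; rewrite normr0 (max_idPr (normr_ge0 _)) in c1.
rewrite D0 !subr0 in E; rewrite -/(D x) E normrM.
apply: (@le_trans _ _ (2 * a n * `|x| * `|x|)).
  by rewrite ler_wpM2r// (le_trans (tail _ _))// ler_wpM2l// mulr_ge0.
rewrite -mulrA -expr2 real_normK ?num_real//.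
have x20 := sqr_ge0 x.
have := NP n Nn; rewrite ler_pdivlMr; last by rewrite mulr_gt0// ltr_wpDl.
have := a0 n; nra.
Qed.

End SeriesDerivative.

(** * The drift of the equation and its explicit solution *)

Section Divergence.
Context {R : realType}.
Variables (r : nat -> int) (gamma : nat -> R) (h : nat -> R -> R).

Lemma derive_coord0 (phi : R -> R) (v x : 'rV[R]_2) : v 0 0 = 1 ->
  'D_v (fun u : 'rV[R]_2 => phi (u 0 0) : R) x = 'D_1 phi (x 0 0).
Proof.
move=> v1; rewrite /derive.
rewrite (_ : (fun z : R => z^-1 *: (((fun u : 'rV[R]_2 => phi (u 0 0)) \o shift x) (z *: v)
    - phi (x 0 0))) =
  (fun z : R => z^-1 *: ((phi \o shift (x 0 0)) (z *: 1) - phi (x 0 0))))//.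
by apply/funext => z; rewrite /= !mxE v1.
Qed.

Lemma derive_coord0_eq0 (phi : R -> R) (v x : 'rV[R]_2) : v 0 0 = 0 ->
  'D_v (fun u : 'rV[R]_2 => phi (u 0 0) : R) x = 0.
Proof.
move=> v0; rewrite /derive.
rewrite (_ : (fun z : R => _) = fun=> 0) ?lim_cst//.
by apply/funext => z; rewrite /= !mxE v0 mulr0 add0r subrr scaler0.
Qed.

Lemma stream_divergence (k : R -> R) (x : 'rV[R]_2) : der (potential r gamma h) k ->
  divergence (stream_matrix r gamma h) x 0 0 = 0 /\
  divergence (stream_matrix r gamma h) x 0 1 = - k (x 0 0).
Proof.
move=> dk; rewrite /divergence !mxE !big_ord_recl !big_ord0 /= !addr0.
have D0 : forall i j : 'I_2, (i == j) -> forall v,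
   'D_v (fun u : 'rV[R]_2 => stream_matrix r gamma h u i j : R) x = 0.
  move=> i j /eqP -> v; rewrite (_ : (fun u => _) = fun=> 0) ?derive_cst//.
  apply/funext => u; rewrite mxE; case: eqP => [->|]//=.
  by case: ifP => // /andP[/eqP ->].
have e1 : lift ord0 ord0 = 1 :> 'I_2 by apply/val_inj.
rewrite !e1; split.
- rewrite (D0 0 ord0)// add0r (_ : (fun u : 'rV[R]_2 => _) = fun u : 'rV[R]_2 => potential r gamma h (u 0 0)).
    by rewrite derive_coord0_eq0// mxE.
  by apply/funext => u; rewrite mxE.
- rewrite (D0 1 1)// addr0 (_ : (fun u : 'rV[R]_2 => _) = fun u : 'rV[R]_2 => - potential r gamma h (u 0 0)).
    rewrite (derive_coord0 (fun z => - potential r gamma h z)) ?mxE//.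
    by have [_ ->] := derN dk (x 0 0).
  by apply/funext => u; rewrite mxE.
Qed.

Context {d : measure_display} {T : measurableType d}.
Variable P : probability T R.

(** The first component of the drift vanishes, so [y . e_1] is [b], and the equation for [y . e_2]
    becomes explicit. *)
Lemma sde_solution (k : R -> R) B (omega y : R -> T -> 'rV[R]_2) t w :
  brownian_motion P omega ->
  der (potential r gamma h) k -> (forall x y, `|k x - k y| <= B * `|x - y|) ->
  solves_sde (stream_matrix r gamma h) omega y -> 0 <= t ->
  y t w 0 1 = wpath omega t w + path_int omega k t w.
Proof.
move=> bm dk kB sy t0.
have y0 s : 0 <= s -> y s w 0 0 = bpath omega s w.
  move=> s0; rewrite (sde_integral sy w 0 s0).
  under eq_Rintegral do rewrite (stream_divergence _ dk).1.
  by rewrite Rintegral_cst//= mul0r subr0.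
rewrite (sde_integral sy w 1 t0); congr (_ + _).
pose phi u := k (bpath omega (Num.max 0 u) w).
have cphi : continuous phi.
  move=> x; apply: (@continuous_comp _ _ _ (fun u : R => bpath omega (Num.max 0 u) w) k).
    exact: (bpath_clamp_continuous bm).
  by have [ck _] := nice_lipschitz kB; exact: ck.
have phiE s : s \in `[0, t]%classic -> bpath omega s w = bpath omega (Num.max 0 s) w.
  by rewrite inE /= in_itv/= => /andP[s0 _]; rewrite (max_idPr s0).
have -> : path_int omega k t w = \int[lebesgue_measure]_(s in `[0, t]) phi s.
  by apply: eq_Rintegral => s /phiE ->.
have -> : \int[lebesgue_measure]_(s in `[0, t])
      divergence (stream_matrix r gamma h) (y s w) 0 1 =
    \int[lebesgue_measure]_(s in `[0, t]) (-1 * phi s).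
  apply: eq_Rintegral => s sx; rewrite (stream_divergence _ dk).2 y0 ?mulN1r /phi ?(phiE s)//.
  by move: sx; rewrite inE /= in_itv/= => /andP[].
rewrite RintegralZl ?mulN1r ?opprK//.
exact: continuous_itv_integrable.
Qed.

End Divergence.

(** * Periodic functions *)

Section PeriodicCell.
Context {R : realType}.
Notation mu := (@lebesgue_measure R).
Implicit Types f g F G : R -> R.
Variable q : R.
Hypothesis q0 : 0 < q.

Definition cell (f : R -> R) : R := \int[mu]_(x in `[0, q]) f x.

Lemma cellD f g : continuous f -> continuous g ->
  cell (fun x => f x + g x) = cell f + cell g.
Proof. by move=> cf cg; apply: RintegralD => //; exact: continuous_itv_integrable. Qed.

Lemma cellZ c f : continuous f -> cell (fun x => c * f x) = c * cell f.
Proof. by move=> cf; apply: RintegralZl => //; exact: continuous_itv_integrable. Qed.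

Lemma cell_le f g : continuous f -> continuous g -> (forall x, f x <= g x) ->
  cell f <= cell g.
Proof. by move=> cf cg fg; apply: le_Rintegral => //; exact: continuous_itv_integrable. Qed.

Lemma continuous_sqr (f : R -> R) : continuous f -> continuous (fun x => f x ^+ 2).
Proof. by move=> cf x; apply: cvgM; exact: cf. Qed.

Lemma continuous_scal c (f : R -> R) : continuous f -> continuous (fun x => c * f x).
Proof. by move=> cf x; apply: cvgM; [exact: cvg_cst|exact: cf]. Qed.

Lemma continuous_add (f g : R -> R) : continuous f -> continuous g ->
  continuous (fun x => f x + g x).
Proof. by move=> cf cg x; apply: cvgD; [exact: cf|exact: cg]. Qed.

(** Minkowski's inequality in [L^2] of a period, from [2 f g <= (B/A) f^2 + (A/B) g^2]; these
    weights reproduce [(A + B)^2] exactly. *)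
Lemma cell_sqr_add_le f g A B : continuous f -> continuous g -> 0 < A -> 0 < B ->
  cell (fun x => f x ^+ 2) <= A ^+ 2 * q -> cell (fun x => g x ^+ 2) <= B ^+ 2 * q ->
  cell (fun x => (f x + g x) ^+ 2) <= (A + B) ^+ 2 * q.
Proof.
move=> cf cg A0 B0 fA gB.
have cf2 := continuous_sqr cf; have cg2 := continuous_sqr cg.
apply: (@le_trans _ _ (cell (fun x => (1 + B / A) * f x ^+ 2 + (1 + A / B) * g x ^+ 2))).
  apply: cell_le; first exact/continuous_sqr/continuous_add.
    by apply: continuous_add; exact: continuous_scal.
  move=> x; rewrite -subr_ge0.
  rewrite (_ : _ - _ = (B * f x - A * g x) ^+ 2 / (A * B)); last by field; rewrite !gt_eqF.
  by rewrite divr_ge0 ?sqr_ge0// mulr_ge0 ?ltW.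
rewrite cellD ?cellZ//; [|exact: continuous_scal..].
have BA : 0 <= 1 + B / A by rewrite addr_ge0// divr_ge0 ?ltW.
have AB : 0 <= 1 + A / B by rewrite addr_ge0// divr_ge0 ?ltW.
apply: (le_trans (lerD (ler_wpM2l BA fA) (ler_wpM2l AB gB))).
by rewrite le_eqVlt; apply/orP; left; apply/eqP; field; rewrite !gt_eqF.
Qed.

(** The same weights with opposite signs. The coefficient [1 - A/B] is nonpositive, so an upper
    bound on [g] is what is required. *)
Lemma cell_sqr_add_ge f g A B : continuous f -> continuous g -> 0 < B -> B <= A ->
  cell (fun x => f x ^+ 2) = A ^+ 2 * q -> cell (fun x => g x ^+ 2) <= B ^+ 2 * q ->
  (A - B) ^+ 2 * q <= cell (fun x => (f x + g x) ^+ 2).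
Proof.
move=> cf cg B0 BA fA gB; have A0 : 0 < A by exact: lt_le_trans BA.
have cf2 := continuous_sqr cf; have cg2 := continuous_sqr cg.
apply: (@le_trans _ _ (cell (fun x => (1 - B / A) * f x ^+ 2 + (1 - A / B) * g x ^+ 2))); last first.
  apply: cell_le; last first.
  - move=> x; rewrite -subr_ge0.
    rewrite (_ : _ - _ = (B * f x + A * g x) ^+ 2 / (A * B)); last by field; rewrite !gt_eqF.
    by rewrite divr_ge0 ?sqr_ge0// mulr_ge0 ?ltW.
  - exact/continuous_sqr/continuous_add.
  - by apply: continuous_add; exact: continuous_scal.
rewrite cellD ?cellZ//; [|exact: continuous_scal..].
have AB : 1 - A / B <= 0 by rewrite subr_le0 ler_pdivlMr// mul1r.
rewrite fA; apply: le_trans (lerD (lexx _) (ler_wnM2l AB gB)).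
by rewrite le_eqVlt; apply/orP; left; apply/eqP; field; rewrite !gt_eqF.
Qed.

Notation per f := (periodic f q).

Lemma per_der F f : der F f -> per f -> F q = F 0 -> per F.
Proof.
move=> dF pf Fq x.
pose D x := F (x + q) - F x.
have dD : der D (fun x => f (x + q) - f x) by apply: derB => //; exact: der_shift.
have D0 : D 0 = 0 by rewrite /D add0r Fq subrr.
have := der_const dD _ D0 x; rewrite /D => H.
by apply/eqP; rewrite -subr_eq0; apply/eqP/H => z; rewrite pf subrr.
Qed.

Lemma per_reduce x : exists y, 0 <= y <= q /\ forall f, per f -> f x = f y.
Proof.
pose z := Num.floor (x / q).
have zx : z%:~R * q <= x by rewrite -ler_pdivlMr// floor_le_tmp.
have xz : x < (z%:~R + 1) * q.
  by rewrite -ltr_pdivrMr//; have := floorD1_gt (x / q); rewrite intrD.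
have perz f : per f -> forall (n : nat) y, f (y + n%:R * q) = f y.
  move=> pf; elim=> [|n IH] y; first by rewrite mul0r addr0.
  by rewrite -natr1 mulrDl mul1r addrA pf IH.
exists (x - z%:~R * q); split; first by lra.
move=> f pf; case: z {zx xz} => n.
  by rewrite -[in LHS](subrK (n%:~R * q) x) (perz f pf n).
by rewrite NegzE mulrNz mulNr opprK (perz f pf n.+1 x).
Qed.

Lemma periodic_correctors (g F0 : R -> R) c : continuous g -> per g -> 0 < c ->
  cell (fun x => g x ^+ 2) = c ^+ 2 * q -> der F0 (fun x => 2 * g x) -> F0 q = F0 0 ->
  exists G F J, [/\ der G F, der F (fun x => 2 * g x), der J (fun x => g x ^+ 2),
    (forall x, J (x + q) = J x + c ^+ 2 * q) &
    (forall x, `|F x| <= 2 * q * c) /\ (forall x, `|G x| <= 2 * q ^+ 2 * c)].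
Proof.
move=> cg pg c0 gc dF0 F0q.
have cg2 := continuous_sqr cg.
have [J [dJ J0]] := primitive cg2.
have Jq : J q = c ^+ 2 * q.
  by rewrite -gc /cell (der_FTC dJ cg2 (ltW q0)) J0 subr0.
have p2g : per (fun x => 2 * g x) by move=> x; rewrite pg.
have pF0 : per F0 by exact: (per_der dF0).
have [G0 [dG0 G00]] := primitive (der_continuous dF0).
(* The mean of [F0] over a period; removing it makes the antiderivative [G] periodic. *)
pose m := G0 q / q.
pose F x := F0 x - m; pose G x := G0 x - m * x.
have dF : der F (fun x => 2 * g x).
  by apply: (der_eq (derB dF0 (der_cst m))) => x; rewrite subr0.
have dG : der G F.
  by apply: (der_eq (derB dG0 (derZ m (@der_id R)))) => x; rewrite mulr1.
have pF : per F by move=> x; rewrite /F pF0.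
have G0' : G 0 = 0 by rewrite /G G00 mulr0 subrr.
have Gq : G q = 0 by rewrite /G /m divfK ?gt_eqF// subrr.
have pG : per G by apply: (per_der dG) => //; rewrite Gq G0'.
have dJt : der (fun x => J x - x * (c ^+ 2)) (fun x => g x ^+ 2 - c ^+ 2).
  by apply: (der_eq (derB dJ (derM (@der_id R) (der_cst (c ^+ 2))))) => x; ring.
have pJt : per (fun x => J x - x * c ^+ 2).
  apply: (per_der dJt) => [x|]; first by rewrite pg.
  by rewrite Jq J0; ring.
(* AM-GM: [2 |g| <= c + g^2 / c], and the right side has mean [2 c] over a period. *)
pose K x := c * x + J x / c.
have dK : der K (fun x => c + g x ^+ 2 / c).
  by apply: (der_eq (derD (derZ c (@der_id R)) (derM dJ (der_cst c^-1)))) => x; ring.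
have gK x : `|2 * g x| <= c + g x ^+ 2 / c.
  rewrite -subr_ge0 normrM (ger0_norm (ler0n _ _)) -[g x ^+ 2]real_normK ?num_real//.
  rewrite (_ : _ - _ = (`|g x| - c) ^+ 2 / c); last by field; rewrite gt_eqF.
  by rewrite divr_ge0 ?sqr_ge0// ltW.
have FK x y : x <= y -> `|F y - F x| <= K y - K x.
  move=> xy; rewrite ler_norml; apply/andP; split.
    have [z _ e] := der_MVT x y (derD dF dK).
    have : 0 <= (2 * g z + (c + g z ^+ 2 / c)) * (y - x).
      apply: mulr_ge0; last by rewrite subr_ge0.
      by have := gK z; rewrite ler_norml => /andP[]; lra.
    by rewrite -e; lra.
  have [z _ e] := der_MVT x y (derB dK dF).
  have : 0 <= (c + g z ^+ 2 / c - 2 * g z) * (y - x).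
    apply: mulr_ge0; last by rewrite subr_ge0.
    by have := gK z; rewrite ler_norml => /andP[]; lra.
  by rewrite -e; lra.
have Kmono x y : x <= y -> K x <= K y.
  by move=> xy; have := FK x y xy; have := normr_ge0 (F y - F x); lra.
have Kq : K q - K 0 = 2 * q * c.
  by rewrite /K Jq J0; field; rewrite gt_eqF.
have osc x y : 0 <= x <= q -> 0 <= y <= q -> `|F x - F y| <= 2 * q * c.
  wlog xy : x y / y <= x => [H|/andP[x1 x2] /andP[y1 y2]].
    have [|/ltW xy] := leP y x; first exact: H.
    by rewrite distrC => ? ?; exact: H.
  apply: (le_trans (FK _ _ xy)); rewrite -Kq.
  by have := Kmono _ _ x2; have := Kmono _ _ y1; lra.
(* Rolle's theorem for the periodic [G]: the centred [F] has a zero, so its oscillation bounds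
   it. *)
have [z0 zq Fz] : exists2 z, 0 <= z <= q & F z = 0.
  have [z zi e] := der_MVT 0 q dG.
  exists z.
    by case/orP: zi => // /andP[z1 z2]; have := lt_le_trans q0 (le_trans z1 z2); rewrite ltxx.
  move: e; rewrite Gq G0' subrr subr0 => /esym/eqP.
  by rewrite mulf_eq0 (gt_eqF q0) orbF => /eqP.
have FB x : `|F x| <= 2 * q * c.
  have [y [y0 yE]] := per_reduce x; rewrite (yE F pF).
  by rewrite -[F y]subr0 -Fz; exact: osc.
exists G, F, J; split => //.
- by move=> x; have /= := pJt x; lra.
- split => // x; have [y [/andP[y1 y2] yE]] := per_reduce x; rewrite (yE G pG).
  have := der_lipschitz dG FB 0 y; rewrite G0' !subr0 (ger0_norm y1) => H.
  apply: (le_trans H).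
  have : 0 <= 2 * q * c * (q - y) by rewrite !mulr_ge0 ?subr_ge0// ltW.
  lra.
Qed.

End PeriodicCell.

Section SmoothPeriodic.
Context {R : realType}.
Implicit Types f : R -> R.

Lemma derivable_der f : (forall x, derivable f x 1) -> der f f^`().
Proof. by move=> df x; rewrite derive1E; apply: derivableP. Qed.

Lemma derivative_unique f f1 f2 x : der f f1 -> der f f2 -> f1 x = f2 x.
Proof. by move=> d1 d2; rewrite -(derE x d1) (derE x d2). Qed.

Lemma periodic_derivative f f1 : der f f1 -> periodic f 1 -> periodic f1 1.
Proof.
move=> df pf x.
have d2 : der f (fun x => f1 (x + 1)).
  have := der_shift 1 df; congr der; apply/funext => y; exact: pf.
exact: (derivative_unique x d2 df).
Qed.

Lemma periodic_bounded f : continuous f -> periodic f 1 ->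
  exists M, forall x, `|f x| <= M.
Proof.
move=> cf pf.
have cn : continuous (fun x => `|f x|).
  by move=> x; apply: (@continuous_comp _ _ _ f (fun y => `|y|)); [exact: cf|exact: norm_continuous].
have [c _ H] := EVT_max ler01 (continuous_subspaceT cn).
exists `|f c| => x; have [y [y01 yE]] := @per_reduce R 1 ltr01 x.
by rewrite (yE f pf); apply: H; rewrite in_itv.
Qed.

Lemma sup_norm_ge f x : (exists M, forall x, `|f x| <= M) -> `|f x| <= sup_norm f.
Proof.
move=> [M fM]; apply: ub_le_sup; last by exists x.
by exists M => _ [y _ <-].
Qed.

Lemma oscillation_ge f x y : (exists M, forall x, `|f x| <= M) ->
  f x - f y <= oscillation f.
Proof.
move=> [M fM]; rewrite /oscillation; apply: lerB.
  apply: ub_le_sup; last by exists x.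
  by exists M => _ [w _ <-]; rewrite (le_trans (ler_norm _)).
apply: ge_inf; last by exists y.
by exists (- M) => _ [w _ <-]; have := fM w; rewrite ler_norml => /andP[].
Qed.

(** [inf] is 0 on a set without an infimum, so a positive value is genuine. *)
Lemma inf_gt0_le (A : set R) x : 0 < inf A -> A x -> inf A <= x.
Proof.
move=> i0 Ax; have [hA|hA] := pselect (has_inf A).
  by apply: ge_inf => //; case: hA.
by move: i0; rewrite (inf_out hA) ltxx.
Qed.

Lemma smooth_der f : smooth f -> der f f^`().
Proof. by move=> sf; apply: derivable_der; exact: (sf 0%N). Qed.

Lemma smooth_der2 f : smooth f -> der f^`() f^`(2).
Proof. by move=> sf; apply: derivable_der; exact: (sf 1%N). Qed.

Lemma smooth_continuous2 f : smooth f -> continuous f^`(2).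
Proof. by move=> sf; apply: (@der_continuous _ _ f^`(3)); apply: derivable_der; exact: (sf 2%N). Qed.

End SmoothPeriodic.

(** * Scale separation *)

Section ShearConsequences.
Context {R : realType}.
Variables (r : nat -> int) (gamma : nat -> R) (h : nat -> R -> R).
Hypothesis shear : shear_flow_assumptions r gamma h.
Hypothesis h10 : forall n, (h n)^`() 0 = 0.
Hypothesis K2b : has_ubound (range (fun n => sup_norm (h n)^`(2))).
Hypothesis gmin2 : 2 < gamma_min gamma.

Notation gmin := (gamma_min gamma).
Notation gmax := (gamma_max gamma).
Notation rmin := (@rho_min R r).
Notation rmax := (@rho_max R r).
Notation sc := (@scale R r).
Notation K0 := (K_0 h).
Notation K2 := (K_2 h).

Lemma gamma_ratio n : gmin <= gamma n.+1 / gamma n <= gmax.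
Proof.
apply/andP; split; last by apply: ub_le_sup; [exact: (shear_gamma_max shear)|exists n].
apply: inf_gt0_le; last by exists n.
by apply: lt_trans (shear_gamma_min shear).
Qed.

Lemma gamma_gt0 n : 0 < gamma n.
Proof.
elim: n => [|n IH]; first by rewrite (shear_gamma0 shear).
have /andP[H _] := gamma_ratio n.
have : 0 < gamma n.+1 / gamma n by apply: lt_le_trans H; apply: lt_trans gmin2.
by rewrite pmulr_lgt0// invr_gt0.
Qed.

Lemma gammaS_ge n : gmin * gamma n <= gamma n.+1.
Proof. by have /andP[H _] := gamma_ratio n; rewrite -ler_pdivlMr// gamma_gt0. Qed.

Lemma gammaS_le n : gamma n.+1 <= gmax * gamma n.
Proof. by have /andP[_ H] := gamma_ratio n; rewrite -ler_pdivrMr// gamma_gt0. Qed.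

Lemma gamma_ge1 n : 1 <= gamma n.
Proof.
elim: n => [|n IH]; first by rewrite (shear_gamma0 shear).
apply: le_trans (gammaS_ge n); have := gmin2; nra.
Qed.

Lemma gmax_gt2 : 2 < gmax.
Proof. by have /andP[H1 H2] := gamma_ratio 0; apply: (lt_le_trans gmin2); exact: le_trans H2. Qed.

(** Adding [gamma n] to [gamma n / (gmin - 1)] gives [gmin * gamma n / (gmin - 1)], at most the
    bound at [n.+1]. *)
Lemma gamma_sum_lt n : \sum_(0 <= i < n) gamma i <= gamma n / (gmin - 1).
Proof.
have g1 : 0 < gmin - 1 by have := gmin2; lra.
elim: n => [|n IH]; first by rewrite big_geq// divr_ge0 ?ltW ?gamma_gt0.
rewrite big_nat_recr//= ler_pdivlMr//.
rewrite ler_pdivlMr// in IH; have := gammaS_ge n; lra.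
Qed.

Lemma gamma_sum_le n : \sum_(0 <= i < n.+1) gamma i <= 2 * gamma n.
Proof.
rewrite big_nat_recr//=; have := gamma_sum_lt n.
have g1 : 0 < gmin - 1 by have := gmin2; lra.
rewrite ler_pdivlMr// => H; have g0 := gamma_gt0 n.
have s0 : 0 <= \sum_(0 <= i < n) gamma i by apply: sumr_ge0 => i _; exact/ltW/gamma_gt0.
have := gmin2; nra.
Qed.

Lemma ratio_bounds n : (0 < n)%N -> rmin <= (r n)%:~R <= rmax.
Proof.
move=> n0; apply/andP; split; last first.
  by apply: ub_le_sup; [exact: (shear_rho_max shear)|exists n].
apply: inf_gt0_le; last by exists n.
by apply: lt_le_trans (shear_rho_min shear).
Qed.

Lemma rmin_ge2 : 2 <= rmin. Proof. exact: shear_rho_min shear. Qed.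

Lemma scale0 : sc 0 = 1.
Proof. by rewrite /scale big_nat1 (shear_r0 shear). Qed.

Lemma scaleS n : sc n.+1 = sc n * (r n.+1)%:~R.
Proof. by rewrite /scale big_nat_recr. Qed.

Lemma scale_gt0 n : 0 < sc n.
Proof.
elim: n => [|n IH]; first by rewrite scale0.
rewrite scaleS mulr_gt0//; have /andP[H _] := ratio_bounds (ltn0Sn n).
by apply: lt_le_trans H; apply: lt_le_trans rmin_ge2.
Qed.

Lemma scaleS_ge n : rmin * sc n <= sc n.+1.
Proof.
rewrite scaleS mulrC ler_pM2l ?scale_gt0//.
by have /andP[] := ratio_bounds (ltn0Sn n).
Qed.

Lemma scaleS_le n : sc n.+1 <= rmax * sc n.
Proof.
rewrite scaleS [leRHS]mulrC ler_pM2l ?scale_gt0//.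
by have /andP[] := ratio_bounds (ltn0Sn n).
Qed.

Lemma scale_ge1 n : 1 <= sc n.
Proof.
elim: n => [|n IH]; first by rewrite scale0.
by apply: le_trans (scaleS_ge n); have := rmin_ge2; nra.
Qed.

Lemma scale_multiple k p : (k <= p)%N -> exists N : nat, sc p = sc k * N%:R.
Proof.
move=> kp; rewrite -(subnKC kp); elim: (p - k)%N => [|j [N IH]].
  by exists 1%N; rewrite addn0 mulr1.
rewrite addnS scaleS IH.
have /andP[H _] := ratio_bounds (ltn0Sn (k + j)).
have : 0 <= (r (k + j).+1)%:~R :> R by apply: le_trans H; apply: le_trans rmin_ge2.
rewrite ler0z; case: (r _) => // m _; exists (N * m)%N.
by rewrite natrM mulrA.
Qed.

Let hb n := fun x => h n x - mean01 (h n).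

Lemma h_der n : der (h n) (h n)^`().
Proof. exact/smooth_der/(shear_smooth shear). Qed.

Lemma h_der2 n : der (h n)^`() (h n)^`(2).
Proof. exact/smooth_der2/(shear_smooth shear). Qed.

Lemma h_continuous n : continuous (h n).
Proof. exact: der_continuous (h_der n). Qed.

Lemma h_bounded n : exists M, forall x, `|h n x| <= M.
Proof. by apply: periodic_bounded; [exact: h_continuous|exact: (shear_periodic shear)]. Qed.

Lemma h2_continuous n : continuous (h n)^`(2).
Proof. exact/smooth_continuous2/(shear_smooth shear). Qed.

Lemma h2_le n x : `|(h n)^`(2) x| <= K2.
Proof.
have p1 := periodic_derivative (h_der n) (shear_periodic shear n).
have p2 := periodic_derivative (h_der2 n) p1.
apply: (@le_trans _ _ (sup_norm (h n)^`(2))).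
  by apply: sup_norm_ge; apply: periodic_bounded => //; exact: h2_continuous.
by apply: ub_le_sup => //; exists n.
Qed.

Lemma K2_ge0 : 0 <= K2. Proof. exact: le_trans (h2_le 0 0). Qed.

Lemma h_osc n x y : `|h n x - h n y| <= K0.
Proof.
have osc u v : h n u - h n v <= K0.
  apply: (le_trans (oscillation_ge u v (h_bounded n))).
  by apply: ub_le_sup; [exact: (shear_K0 shear)|exists n].
by rewrite ler_norml lerNl opprB !osc.
Qed.

Lemma K0_ge0 : 0 <= K0. Proof. exact: le_trans (h_osc 0 0 0). Qed.

Lemma mean_cell n : mean01 (h n) = cell 1 (h n). Proof. by []. Qed.

Lemma cell_cst (q c : R) : 0 < q -> cell q (fun=> c) = c * q.
Proof.
move=> q0; rewrite /cell Rintegral_cst//= lebesgue_measure_itv/= lte_fin q0.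
by rewrite oppr0 adde0.
Qed.

Lemma cell1_cst (c : R) : cell 1 (fun=> c) = c.
Proof. by rewrite cell_cst ?mulr1. Qed.

Lemma cst_continuous (c : R) : continuous (fun _ : R => c).
Proof. by move=> x; exact: cvg_cst. Qed.

Lemma hb_der n : der (hb n) (h n)^`().
Proof. by apply: (der_eq (derB (h_der n) (der_cst _))) => x; rewrite subr0. Qed.

Lemma hb_continuous n : continuous (hb n).
Proof. exact: der_continuous (hb_der n). Qed.

Lemma hb_le n x : `|hb n x| <= K0.
Proof.
have ch : continuous (h n) := @h_continuous n.
have cc (c : R) : continuous (fun _ : R => c) := @cst_continuous c.
have H1 : cell 1 (fun=> h n x - K0) <= cell 1 (h n).
  by apply: cell_le => // y; have := h_osc n x y; rewrite ler_norml => /andP[]; lra.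
have H2 : cell 1 (h n) <= cell 1 (fun=> h n x + K0).
  by apply: cell_le => // y; have := h_osc n x y; rewrite ler_norml => /andP[]; lra.
rewrite !cell1_cst in H1 H2.
by rewrite /hb mean_cell ler_norml; apply/andP; split; lra.
Qed.

Lemma hb_mean n : cell 1 (hb n) = 0.
Proof.
have ch : continuous (h n) := @h_continuous n.
rewrite /hb (@cellD R 1 (h n) (fun=> - mean01 (h n)))//; last exact: cst_continuous.
by rewrite cell1_cst -mean_cell subrr.
Qed.

Lemma hb_var n : cell 1 (fun x => hb n x ^+ 2) = 1.
Proof. exact: (shear_variance shear n). Qed.

(** The [g] of the overview. Centring the levels changes no derivative, so [small_scale1] is also
    the partial sum of the uncentred [level1]. *)
Definition small_scale (p : nat) (x : R) : R :=
  \sum_(0 <= n < p.+1) gamma n * hb n (x / sc n).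
Definition small_scale1 (p : nat) (x : R) : R :=
  \sum_(0 <= n < p.+1) gamma n / sc n * derive1 (h n) (x / sc n).
Definition level (n : nat) (x : R) := gamma n * h n (x / sc n).
Definition level1 (n : nat) (x : R) := gamma n / sc n * derive1 (h n) (x / sc n).
Definition level2 (n : nat) (x : R) := gamma n / sc n ^+ 2 * derive1n 2 (h n) (x / sc n).
Definition amp (n : nat) : R := K2 * (gamma n / sc n ^+ 2).

Lemma level_der n : der (level n) (level1 n).
Proof.
apply: (der_eq (derZ (gamma n) (der_scale (sc n) (h_der n)))) => x.
by rewrite /level1; ring.
Qed.

Lemma level1_der n : der (level1 n) (level2 n).
Proof.
apply: (der_eq (derZ (gamma n / sc n) (der_scale (sc n) (h_der2 n)))) => x.
by rewrite /level2; field; rewrite gt_eqF// scale_gt0.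
Qed.

Lemma level2_le n x : `|level2 n x| <= amp n.
Proof.
have q0 : 0 < gamma n / sc n ^+ 2 by rewrite divr_gt0 ?exprn_gt0 ?gamma_gt0 ?scale_gt0.
by rewrite /level2 /amp normrM (gtr0_norm q0) mulrC ler_pM2r// h2_le.
Qed.

Lemma level10 n : level1 n 0 = 0.
Proof. by rewrite /level1 mul0r h10 mulr0. Qed.

Lemma level0 n : level n 0 = 0.
Proof. by rewrite /level mul0r (shear_h0 shear) mulr0. Qed.

Lemma level2_continuous n : continuous (level2 n).
Proof.
move=> x; apply: cvgM; first exact: cvg_cst.
apply: (@continuous_comp _ _ _ (fun y : R => y / sc n) (h n)^`(2)); last exact: h2_continuous.
by apply: cvgM; [exact: cvg_id|exact: cvg_cst].
Qed.

Lemma small_scale_der p : der (small_scale p) (small_scale1 p).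
Proof.
apply: der_sum => n; apply: (der_eq (derZ (gamma n) (der_scale (sc n) (hb_der n)))) => x.
by ring.
Qed.

Lemma small_scale_le p x : `|small_scale p x| <= 2 * K0 * gamma p.
Proof.
apply: (le_trans (ler_norm_sum _ _ _)).
apply: (@le_trans _ _ (\sum_(0 <= n < p.+1) K0 * gamma n)).
  apply: ler_sum => n _; rewrite normrM (gtr0_norm (gamma_gt0 n)) mulrC.
  by rewrite ler_pM2r ?gamma_gt0// hb_le.
rewrite -mulr_sumr; have := ler_wpM2l K0_ge0 (gamma_sum_le p); lra.
Qed.

(* The scales are nested multiples of one another, so [scale p] is a common period. *)
Lemma rescaled_periodic (f : R -> R) k p : periodic f 1 -> (k <= p)%N ->
  periodic (fun x => f (x / sc k)) (sc p).
Proof.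
move=> pf kp x; have [N ->] := scale_multiple kp.
have -> : (x + sc k * N%:R) / sc k = x / sc k + 1 *+ N.
  by field; rewrite gt_eqF// scale_gt0.
exact: periodicn.
Qed.

Lemma hb_periodic n : periodic (hb n) 1.
Proof. by move=> x; rewrite /hb (shear_periodic shear). Qed.

Lemma small_scale_periodic p : periodic (small_scale p) (sc p).
Proof.
move=> x; rewrite /small_scale; apply: eq_big_nat => n /andP[_ np].
by congr (_ * _); exact: (rescaled_periodic (hb_periodic n)).
Qed.

(** Each centred profile has mean 0, hence a 1-periodic primitive, and [scale p] is a multiple of
    [scale n]. *)
Lemma small_scale_primitive p : exists F0, der F0 (fun x => 2 * small_scale p x) /\ F0 (sc p) = F0 0.
Proof.
have ex n : exists Hb, der Hb (hb n) /\ periodic Hb 1.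
  have [Hb [dHb Hb0]] := primitive (@hb_continuous n).
  exists Hb; split => //; apply: (@per_der R 1 _ _ dHb (hb_periodic n)).
  apply/eqP; rewrite -subr_eq0 -(der_FTC dHb (@hb_continuous n) ler01).
  exact/eqP/hb_mean.
have [Hb HbP] := choice ex.
exists (fun x => \sum_(0 <= n < p.+1) 2 * gamma n * sc n * Hb n (x / sc n)); split.
  have := @der_sum R nat (index_iota 0 p.+1) xpredT
    (fun n x => 2 * gamma n * sc n * Hb n (x / sc n)) (fun n x => 2 * (gamma n * hb n (x / sc n))) _.
  move=> H; apply: (der_eq (H _)) => [n|x]; last by rewrite mulr_sumr.
  apply: (der_eq (derZ (2 * gamma n * sc n) (der_scale (sc n) (HbP n).1))) => x.
  by field; rewrite gt_eqF// scale_gt0.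
apply: eq_big_nat => n /andP[_ np]; congr (_ * _).
have := @rescaled_periodic (Hb n) n p (HbP n).2 np 0.
by rewrite add0r => <-.
Qed.

Let w n := fun x => gamma n * hb n (x / sc n).

Lemma w_continuous n : continuous (w n).
Proof. exact: der_continuous (derZ (gamma n) (der_scale (sc n) (hb_der n))). Qed.

(** If [J] is a primitive of [hb n ^+ 2], unit variance makes [J x - x] periodic, so [J] increases
    by [N] over [N] periods. *)
Lemma w_cell n p : (n <= p)%N -> cell (sc p) (fun x => w n x ^+ 2) = gamma n ^+ 2 * sc p.
Proof.
move=> np; have chb2 := continuous_sqr (@hb_continuous n).
have [J [dJ J0]] := primitive chb2.
have J1 : J 1 = 1.
  by have := hb_var n; rewrite /cell (der_FTC dJ chb2 ler01) J0 subr0.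
have JN x N : J (x + N%:R) = J x + N%:R.
  have pJ : periodic (fun x => J x - x) 1.
    apply: (@per_der R 1 _ _ (derB dJ (@der_id R))) => [y|].
      by rewrite hb_periodic.
    by rewrite J1 J0 !subrr.
  have := periodicn pJ N x; rewrite /=; lra.
have [N eN] := scale_multiple np.
have s0 := scale_gt0 n.
have dW : der (fun x => gamma n ^+ 2 * sc n * J (x / sc n)) (fun x => w n x ^+ 2).
  apply: (der_eq (derZ (gamma n ^+ 2 * sc n) (der_scale (sc n) dJ))) => x.
  by rewrite /w; field; rewrite gt_eqF.
rewrite /cell (der_FTC dW (continuous_sqr (@w_continuous n)) (ltW (scale_gt0 p))).
rewrite mul0r J0 mulr0 subr0 eN (_ : sc n * N%:R / sc n = 0 + N%:R); last first.
  by field; rewrite gt_eqF.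
by rewrite JN J0 add0r; ring.
Qed.

(** The levels may be correlated, so the triangle inequality is used. The induction closes as in
    [gamma_sum_lt]. *)
Lemma w_sum_cell j p : (j <= p)%N ->
  cell (sc p) (fun x => (\sum_(0 <= n < j) w n x) ^+ 2) <= (gamma j / (gmin - 1)) ^+ 2 * sc p.
Proof.
have g1 : 0 < gmin - 1 by have := gmin2; lra.
have s0 := scale_gt0 p.
have cS i : continuous (fun x => \sum_(0 <= n < i) w n x).
  by apply: der_continuous; apply: der_sum => n; exact: (derZ (gamma n) (der_scale (sc n) (hb_der n))).
elim: j => [_|j IH jp].
  rewrite (_ : cell _ _ = 0); first by rewrite mulr_ge0 ?sqr_ge0 ?ltW.
  rewrite /cell; under eq_Rintegral do rewrite big_geq// expr0n.
  by rewrite Rintegral_cst//= mul0r.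
rewrite (_ : (fun x => _) = (fun x => (\sum_(0 <= n < j) w n x + w j x) ^+ 2)); last first.
  by apply/funext => x; rewrite big_nat_recr.
have gj0 : 0 < gamma j / (gmin - 1) by rewrite divr_gt0// gamma_gt0.
apply: (@le_trans _ _ ((gamma j / (gmin - 1) + gamma j) ^+ 2 * sc p)).
  apply: cell_sqr_add_le => //; [exact: w_continuous|exact: gamma_gt0|exact/IH/ltnW|].
  by rewrite w_cell// ltnW.
rewrite ler_pM2r// lerXn2r ?nnegrE//.
- by rewrite addr_ge0// ltW// gamma_gt0.
- by rewrite divr_ge0 ?ltW// gamma_gt0.
rewrite [leLHS](_ : _ = gmin * gamma j / (gmin - 1)); last by field; rewrite gt_eqF.
by rewrite ler_pM2r ?invr_gt0// gammaS_ge.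
Qed.

(** The top level has root mean square [gamma p], the lower ones together at most
    [gamma p / (gmin - 1)]; [gmin > 2] leaves a positive fraction. *)
Lemma small_scale_cell_ge p :
  ((1 - (gmin - 1)^-1) * gamma p) ^+ 2 * sc p <= cell (sc p) (fun x => small_scale p x ^+ 2).
Proof.
have g1 : 0 < gmin - 1 by have := gmin2; lra.
rewrite (_ : (fun x => _) = (fun x => (w p x + \sum_(0 <= n < p) w n x) ^+ 2)); last first.
  by apply/funext => x; rewrite /small_scale big_nat_recr//= addrC.
rewrite (_ : (1 - (gmin - 1)^-1) * gamma p = gamma p - gamma p / (gmin - 1)); last by ring.
apply: cell_sqr_add_ge.
- exact: w_continuous.
- by apply: der_continuous; apply: der_sum => n; exact: (derZ (gamma n) (der_scale (sc n) (hb_der n))).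
- by rewrite divr_gt0// gamma_gt0.
- by rewrite ler_pdivrMr// ler_peMr ?ltW ?gamma_gt0//; have := gmin2; lra.
- exact: w_cell.
- exact: w_sum_cell.
Qed.

Local Notation shear_factor := (1 - (gmin - 1)^-1).
Local Notation sep := (gmax / rmin ^+ 2).
Local Notation thr := (threshold gamma h).

Lemma shear_factor_gt0 : 0 < shear_factor.
Proof. by rewrite subr_gt0 invf_lt1; have := gmin2; lra. Qed.

Lemma shear_factor_le1 : shear_factor <= 1.
Proof. by rewrite lerBlDr lerDl invr_ge0; have := gmin2; lra. Qed.

(** [c] is the root mean square of [small_scale p] over the period [scale p]. *)
Lemma small_scale_correctors p : exists c, [/\ 0 < c, shear_factor * gamma p <= c,
  c <= 2 * K0 * gamma p & exists G F J, [/\ der G F, der F (fun x => 2 * small_scale p x),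
    der J (fun x => small_scale p x ^+ 2), (forall x, J (x + sc p) = J x + c ^+ 2 * sc p) &
    (forall x, `|F x| <= 2 * sc p * c) /\ (forall x, `|G x| <= 2 * sc p ^+ 2 * c)]].
Proof.
have q0 := scale_gt0 p; have g0 := gamma_gt0 p; have a0 := shear_factor_gt0.
have cg : continuous (small_scale p) := der_continuous (small_scale_der p).
have ag0 : 0 < shear_factor * gamma p by rewrite mulr_gt0.
pose m := cell (sc p) (fun x => small_scale p x ^+ 2) / sc p.
have mge : (shear_factor * gamma p) ^+ 2 <= m by rewrite ler_pdivlMr// small_scale_cell_ge.
have S0 : 0 <= 2 * K0 * gamma p by rewrite mulr_ge0 ?(ltW g0)// mulr_ge0// K0_ge0.
have mle : m <= (2 * K0 * gamma p) ^+ 2.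
  rewrite ler_pdivrMr// -(cell_cst _ q0); apply: cell_le => //.
  - exact: continuous_sqr.
  - exact: cst_continuous.
  - move=> x; rewrite -real_normK ?num_real// lerXn2r ?nnegrE//.
    exact: small_scale_le.
have m0 : 0 < m by apply: lt_le_trans mge; rewrite exprn_gt0.
have cm : Num.sqrt m ^+ 2 = m by rewrite sqr_sqrtr// ltW.
have c0 : 0 < Num.sqrt m by rewrite sqrtr_gt0.
exists (Num.sqrt m); split => //.
- by rewrite -[leLHS]ger0_norm ?(ltW ag0)// -sqrtr_sqr ler_wsqrtr.
- by rewrite -[leRHS]ger0_norm// -sqrtr_sqr ler_wsqrtr.
have [F0 [dF0 F00]] := small_scale_primitive p.
apply: (periodic_correctors q0 cg (@small_scale_periodic p) c0 _ dF0 F00).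
by rewrite cm /m mulfVK// gt_eqF.
Qed.

Lemma amp_ge0 n : 0 <= amp n.
Proof. by rewrite mulr_ge0 ?K2_ge0// divr_ge0 ?sqr_ge0// ltW// gamma_gt0. Qed.

Lemma ampS_le n : amp n.+1 <= sep * amp n.
Proof.
rewrite /amp [leRHS]mulrCA; apply: ler_wpM2l; first exact: K2_ge0.
rewrite mulrACA -invfM -exprMn.
have r0 : 0 < rmin by apply: lt_le_trans rmin_ge2.
apply: ler_pM; rewrite ?invr_ge0 ?sqr_ge0 ?(ltW (gamma_gt0 _))//; first exact: gammaS_le.
have s0 := scale_gt0 n; have rs0 : 0 < rmin * sc n by rewrite mulr_gt0.
by rewrite lef_pV2 ?posrE ?exprn_gt0 ?scale_gt0// lerXn2r ?nnegrE ?scaleS_ge// ltW// scale_gt0.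
Qed.

(** Up to a factor 2 this is [q^2 sup |v''|], which separation of scales makes a small multiple of
    [gamma p]. *)
Lemma scale_sqr_ampS p : sc p ^+ 2 * amp p.+1 <= K2 * sep * gamma p.
Proof.
have q0 := scale_gt0 p.
have -> : K2 * sep * gamma p = sc p ^+ 2 * (sep * amp p).
  by rewrite /amp; field; rewrite !gt_eqF//; apply: lt_le_trans rmin_ge2.
by rewrite ler_pM2l ?exprn_gt0// ampS_le.
Qed.

Lemma threshold_ge16 : 16 <= thr.
Proof.
have a0 := shear_factor_gt0; have a1 := shear_factor_le1.
have : 1 <= shear_factor ^- 2 by rewrite invf_ge1 ?exprn_gt0// exprn_ile1// ltW.
have := sqr_ge0 (K_0 h); rewrite /threshold; set u := _ ^- 2; set v := _ ^+ 2 => v0 u1; nra.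
Qed.

Lemma scale_ge_nat n : n%:R <= sc n.
Proof.
elim: n => [|n IH]; first by rewrite ltW// scale_gt0.
apply: le_trans (scaleS_ge n); have := rmin_ge2; have := scale_ge1 n.
rewrite -natr1; nra.
Qed.

Lemma scale_index_bounds t : thr < t ->
  thr * sc (scale_index r gamma h t) ^+ 2 < t /\
  t <= thr * sc (scale_index r gamma h t).+1 ^+ 2.
Proof.
move=> tt; have th := threshold_ge16.
pose Q n := thr * sc n ^+ 2 < t.
have exQ : exists n, Q n by exists 0%N; rewrite /Q scale0 expr1n mulr1.
have ubQ n : Q n -> (n <= Num.bound t)%N.
  rewrite /Q => Qn; rewrite -(ler_nat R); apply: (le_trans (scale_ge_nat n)).
  have t0 : 0 <= t by lra.
  apply: ltW; apply: lt_trans (archi_boundP t0); apply: le_lt_trans Qn.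
  have := scale_ge1 n; nra.
pose m := ex_maxn exQ ubQ.
have [Qm mmax] : Q m /\ forall n, Q n -> (n <= m)%N by rewrite /m; case: ex_maxnP.
have -> : scale_index r gamma h t = m.
  rewrite /scale_index /supremum; case: ifPn => [/eqP E|_].
    by have : [set n | Q n] m by []; rewrite /Q E.
  apply: xget_subset1; last exact: is_subset1_supremums.
  by split => [n|n]; [exact: mmax|apply].
split => //; rewrite leNgt; apply/negP => /mmax; by rewrite ltnn.
Qed.

(** * The anomalous exponent *)

Local Notation nu t := (anomalous_exponent r gamma h t).

Lemma gamma_le_scale_sqr p : sep <= 2^-1 -> gamma p <= sc p ^+ 2.
Proof.
have r0 : 0 < rmin by apply: lt_le_trans rmin_ge2.
rewrite ler_pdivrMr ?exprn_gt0// => gr.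
have r20 := sqr_ge0 rmin.
elim: p => [|p IH]; first by rewrite scale0 (shear_gamma0 shear) expr1n.
apply: (le_trans (gammaS_le p)); apply: (@le_trans _ _ ((rmin * sc p) ^+ 2)).
  rewrite exprMn; apply: ler_pM => //; [have := gmax_gt2; lra|exact/ltW/gamma_gt0|lra].
have s0 := scale_gt0 p.
by rewrite lerXn2r ?nnegrE ?scaleS_ge// ?(ltW (scale_gt0 _))// mulr_ge0// ltW.
Qed.

(** The exponent solves [R_p^e = gamma_p]. At [p = 0] both logarithms are 0, and the value
    [0 / 0 = 0] satisfies the same equation. *)
Lemma scale_powR_exponent p : sep <= 2^-1 ->
  let e := ln (gamma p) / ln (sc p) in [/\ 0 <= e, e <= 2 & sc p `^ e = gamma p].
Proof.
move=> sep_le; case: p => [|p] /=.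
  by rewrite scale0 (shear_gamma0 shear) ln1 mul0r powRr0.
have s1 : 1 < sc p.+1.
  by apply: lt_le_trans (scaleS_ge p); have := rmin_ge2; have := scale_ge1 p; nra.
have l0 : 0 < ln (sc p.+1) by rewrite ln_gt0.
split.
- by rewrite divr_ge0 ?(ltW l0)// ln_ge0// gamma_ge1.
- rewrite ler_pdivrMr// mulr_natl -lnXn ?scale_gt0// ler_ln ?posrE ?gamma_gt0 ?exprn_gt0 ?scale_gt0//.
  exact: gamma_le_scale_sqr.
- by rewrite /powR gt_eqF ?scale_gt0// mulfVK ?gt_eqF// lnK// posrE gamma_gt0.
Qed.

Lemma rmax_ge2 : 2 <= rmax.
Proof. by have /andP[H1 H2] := ratio_bounds (ltn0Sn 0); rewrite (le_trans rmin_ge2)// (le_trans H1). Qed.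

(** [t] lies between [R_p^2] and [D R_p^2] with [D = thr * rmax^2 >= 1]. Raised to the power [nu],
    these become [gamma_p^2] and [D^nu gamma_p^2], and [nu <= 2] gives [D^nu <= D^2]. *)
Lemma exponent_comparison t (p := scale_index r gamma h t) : sep <= 2^-1 -> thr < t ->
  t * gamma p ^+ 2 <= t `^ (1 + nu t) /\
  t `^ (1 + nu t) <= t * ((thr * rmax ^+ 2) ^+ 2 * gamma p ^+ 2).
Proof.
move=> sep_le tt; have [lo hi] := scale_index_bounds tt.
have th := threshold_ge16; have t0 : 0 < t by lra.
have [n0 n2 sE] := scale_powR_exponent p sep_le.
rewrite -/p in lo hi; rewrite -/(nu t) in n0 n2 sE.
have s0 := scale_gt0 p; have s20 : 0 < sc p ^+ 2 by rewrite exprn_gt0.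
have r1 : 1 <= rmax ^+ 2 by rewrite exprn_ege1//; have := rmax_ge2; lra.
have D1 : 1 <= thr * rmax ^+ 2 by nra.
have s2E : (sc p ^+ 2) `^ nu t = gamma p ^+ 2.
  by rewrite expr2 powRM ?(ltW s0)// sE expr2.
rewrite powRD; last by rewrite (gt_eqF t0) implybT.
rewrite powRr1 ?(ltW t0)// !ler_pM2l//; split.
  rewrite -s2E; apply: ge0_ler_powR; rewrite ?nnegrE ?(ltW t0) ?(ltW s20)//.
  nra.
apply: (@le_trans _ _ ((thr * rmax ^+ 2 * sc p ^+ 2) `^ nu t)).
  apply: ge0_ler_powR; rewrite ?nnegrE ?(ltW t0)//; first by rewrite mulr_ge0 ?(ltW s20)//; lra.
  apply: (le_trans hi); rewrite -mulrA ler_wpM2l//; first by lra.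
  by rewrite -exprMn lerXn2r ?nnegrE ?scaleS_le ?(ltW (scale_gt0 _))// mulr_ge0 ?(ltW s0)//; have := rmax_ge2; lra.
rewrite powRM ?(ltW s20)//; last by lra.
rewrite s2E ler_pM2r ?exprn_gt0 ?gamma_gt0// -(@powR_mulrn _ (thr * rmax ^+ 2) 2); last by lra.
by rewrite ler_powR.
Qed.

(** * The abstract bounds applied to the shear flow *)

Section MeanSquareDisplacement.
Context {d : measure_display} {T : measurableType d}.
Variable P : probability T R.
Variable omega : R -> T -> 'rV[R]_2.
Hypothesis bm : brownian_motion P omega.
Hypothesis sep_le : sep <= 2^-1.

Lemma amp_halving n : amp n.+1 <= amp n / 2.
Proof. by apply: (le_trans (ampS_le n)); rewrite mulrC ler_wpM2l// amp_ge0. Qed.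

Lemma shear_potential_derivative : exists k : R -> R, [/\ der (potential r gamma h) k,
    forall x y, `|k x - k y| <= 2 * amp 0%N * `|x - y| &
    forall N x, `|k x - \sum_(0 <= n < N) level1 n x| <= 2 * amp N * `|x|].
Proof.
exact: (series_termwise_derivative level_der level1_der level2_le level10 level0 amp_halving).
Qed.

Variable k : R -> R.
Hypothesis kB : forall x y, `|k x - k y| <= 2 * amp 0%N * `|x - y|.
Hypothesis kS : forall N x, `|k x - \sum_(0 <= n < N) level1 n x| <= 2 * amp N * `|x|.
Variables (t : R) (p : nat).
Hypothesis t_ge : 16 * sc p ^+ 2 <= t.

Let t0 : 0 < t.
Proof. by apply: lt_le_trans t_ge; rewrite mulr_gt0// exprn_gt0// scale_gt0. Qed.

Lemma small_scale1_lipschitz x y :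
  `|small_scale1 p x - small_scale1 p y| <= (\sum_(0 <= n < p.+1) amp n) * `|x - y|.
Proof.
apply: (@der_lipschitz _ _ (fun x => \sum_(0 <= n < p.+1) level2 n x)).
  by apply: der_sum => n; exact: level1_der.
move=> z; apply: (le_trans (ler_norm_sum _ _ _)); apply: ler_sum => n _; exact: level2_le.
Qed.

Lemma shear_msd_lower : 18 * (40 * (24 * (K2 * sep))) <= shear_factor ->
  (((shear_factor * gamma p) ^+ 2 / 6 * t / 20 / 40)%:E <=
   \int[P]_w ((wpath omega t w + path_int omega k t w) ^+ 2)%:E)%E.
Proof.
move=> small; have q0 := scale_gt0 p; have g0 := gamma_gt0 p; have a0 := shear_factor_gt0.
have [c [c0 cge cle [G [F [J [dG dF dJ Jq [FA GA]]]]]]] := small_scale_correctors p.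
have c20 : 0 < c ^+ 2 by rewrite exprn_gt0.
apply: (@le_trans _ _ (c ^+ 2 / 6 * t / 20 / 40)%:E).
  rewrite lee_fin !ler_pM2r ?invr_gt0//.
  by rewrite lerXn2r ?nnegrE ?(ltW c0)// mulr_ge0 ?ltW.
(* Truncating the large levels at [N] leaves [eta = 2 amp N]; then [(eta t)^2 <= c^2 / 22500], below
   the tolerance [c^2 / 6 / 40 / 80 = c^2 / 19200]. *)
have e0 : 0 < c / (t * (30 * 10)) by rewrite divr_gt0// mulr_gt0// mulr_gt0.
have [N' NP] := halving_cvg0 amp_ge0 amp_halving e0.
pose N := maxn N' p.+1.
have ampN : amp N <= c / (t * (30 * 10)) by apply: NP; exact: leq_maxl.
pose v x := \sum_(p.+1 <= n < N) level n x.
pose v1 x := \sum_(p.+1 <= n < N) level1 n x.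
pose v2 x := \sum_(p.+1 <= n < N) level2 n x.
have v2L x : `|v2 x| <= 2 * amp p.+1.
  apply: (le_trans (ler_norm_sum _ _ _)); apply: le_trans (halving_tail _ _ amp_ge0 amp_halving).
  by apply: ler_sum => n _; exact: level2_le.
have nv2 : nice v2.
  split; last exact: polygrowth_bounded v2L.
  apply: continuous_big => [|n _]; [exact: add_continuous|exact: level2_continuous].
apply: (@msd_lower R d T P omega bm t t0 G F (small_scale p) (small_scale1 p) v v1 v2 k
  _ _ (2 * sc p * c) (2 * sc p ^+ 2 * c) (2 * amp p.+1) (2 * amp N) (c ^+ 2 / 6)
  dG dF (small_scale_der p) small_scale1_lipschitz FA GA _ _ nv2 v2L _ _ kB).
- by apply: der_sum => n; exact: level_der.
- by apply: der_sum => n; exact: level1_der.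
- by rewrite /v1 big1// => n _; exact: level10.
- by rewrite /v big1// => n _; exact: level0.
- move=> x; have := kS N x.
  by rewrite (big_cat_nat (n := p.+1))//= ?leq_maxr// opprD addrA.
- by rewrite divr_gt0.
- move=> s s1 s2; have s0 : 0 < s by have := t0; lra.
  have -> : c ^+ 2 / 6 = c ^+ 2 * sc p / sc p / 6 by rewrite mulfK// gt_eqF.
  apply: (gaussian_periodic_lb (bm_gaussian_coord bm 0 s0) q0 _ dJ _ (M := (2 * K0 * gamma p) ^+ 2)) => //.
  + by have := sqr_ge0 (sc p); have := t_ge; lra.
  + by apply: continuous_sqr; exact: der_continuous (small_scale_der p).
  + move=> x; rewrite sqr_ge0/= -real_normK ?num_real// lerXn2r ?nnegrE ?small_scale_le//.
    by rewrite mulr_ge0 ?(ltW g0)// mulr_ge0// K0_ge0.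
(* With [c0 = c^2 / 6] the condition reads [4 q^2 c^2 <= c^2 t / 4], that is [16 q^2 <= t]: the
   factor 16 of the threshold is spent here. *)
- have := ler_wpM2l (ltW c20) t_ge; rewrite (_ : (2 * sc p * c) ^+ 2 = 4 * (c ^+ 2 * sc p ^+ 2)); last by ring.
  by move: (c ^+ 2) (sc p ^+ 2) => u1 u2; lra.
(* [A2 L = 4 q^2 c * amp p.+1] and [c0 = c^2 / 6] combine into the factor [4 * 6 = 24]. *)
- have Kc : 18 * (40 * (24 * (K2 * sep * gamma p))) <= c.
    by apply: le_trans cge; have := ler_wpM2r (ltW g0) small; lra.
  have := ler_wpM2l (ltW c0) (scale_sqr_ampS p); have := ler_wpM2l (ltW c0) Kc.
  by move: (sc p ^+ 2) (amp p.+1) (K2 * sep * gamma p) => u1 u2 u3; rewrite expr2; lra.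
- have At : amp N * t <= c / (30 * 10).
    have := ler_wpM2r (ltW t0) ampN; congr (_ <= _).
    by field; rewrite gt_eqF.
  have A0 : 0 <= amp N * t by rewrite mulr_ge0 ?amp_ge0 ?ltW.
  have : (amp N * t) ^+ 2 <= (c / (30 * 10)) ^+ 2 by rewrite lerXn2r ?nnegrE// divr_ge0 ?ltW.
  rewrite !exprMn !exprVn; have := c20; move: (c ^+ 2) (amp N ^+ 2) (t ^+ 2) => u1 u2 u3; lra.
Qed.

(** The boundary term gives [5 (4 q c)^2 <= 5 c^2 t <= 20 K0^2 gamma_p^2 t], the martingale
    [80 K0^2 gamma_p^2 t]. For the large levels, [t <= tau R_{p+1}^2] bounds [amp p.+1 * t] by
    [K2 gmax tau gamma_p]. *)
Lemma shear_msd_upper tau : t <= tau * sc p.+1 ^+ 2 ->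
  (\int[P]_w ((wpath omega t w + path_int omega k t w) ^+ 2)%:E <=
   ((6 + 100 * K0 ^+ 2 + 20 * (K2 * gmax * tau) ^+ 2) * t * gamma p ^+ 2)%:E)%E.
Proof.
move=> ttau; have q0 := scale_gt0 p; have g0 := gamma_gt0 p; have a0 := shear_factor_gt0.
have [c [c0 cge cle [G [F [J [dG dF dJ Jq [FA GA]]]]]]] := small_scale_correctors p.
have klB x y : `|(k x - small_scale1 p x) - (k y - small_scale1 p y)| <=
    (2 * amp 0 + \sum_(0 <= n < p.+1) amp n) * `|x - y|.
  rewrite (_ : _ - _ = (k x - k y) - (small_scale1 p x - small_scale1 p y)); last by ring.
  by rewrite (le_trans (ler_normB _ _))// mulrDl lerD// small_scale1_lipschitz.
apply: (le_trans (@msd_upper R d T P omega bm t t0 F (small_scale p) (small_scale1 p)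
  (fun x => k x - small_scale1 p x) k _ _ (2 * K0 * gamma p) (4 * sc p * c) (2 * amp p.+1)
  dF (small_scale_der p) small_scale1_lipschitz klB _ (small_scale_le p) _ (kS p.+1))).
- by move=> x; rewrite addrC subrK.
- move=> x; apply: (le_trans (ler_normB _ _)); have := FA x; have := FA 0; lra.
rewrite lee_fin; have K00 := K0_ge0.
have c2 : c ^+ 2 <= 4 * K0 ^+ 2 * gamma p ^+ 2.
  rewrite (_ : 4 * _ * _ = (2 * K0 * gamma p) ^+ 2); last by ring.
  by rewrite lerXn2r ?nnegrE ?(ltW c0)// (le_trans (ltW c0)).
have At : amp p.+1 * t <= K2 * gmax * tau * gamma p.
  have s0 := scale_gt0 p.+1.
  have H : t / sc p.+1 ^+ 2 <= tau by rewrite ler_pdivrMr// exprn_gt0.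
  have t1 : 0 <= t / sc p.+1 ^+ 2 by rewrite divr_ge0 ?sqr_ge0 ?ltW.
  have tau0 := le_trans t1 H.
  rewrite (_ : _ * t = K2 * (gamma p.+1 * (t / sc p.+1 ^+ 2))); last by rewrite /amp; ring.
  rewrite -!mulrA ler_wpM2l ?K2_ge0// [leRHS](_ : _ = gmax * gamma p * tau); last by ring.
  by rewrite ler_pM ?gammaS_le// ltW// gamma_gt0.
have A0 : 0 <= amp p.+1 * t by rewrite mulr_ge0 ?amp_ge0 ?ltW.
have At2 : (amp p.+1 * t) ^+ 2 <= (K2 * gmax * tau * gamma p) ^+ 2.
  by rewrite lerXn2r ?nnegrE// (le_trans A0).
have g1 : 1 <= gamma p ^+ 2 by rewrite exprn_ege1// gamma_ge1.
have := ler_wpM2r (ltW t0) At2; have := ler_wpM2r (ltW t0) c2.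
have := ler_wpM2l (sqr_ge0 c) t_ge; have := ler_wpM2l (ltW t0) g1.
move: (amp p.+1) => A.
rewrite !exprMn (_ : t ^+ 3 = t ^+ 2 * t); last by rewrite exprSr.
move: (c ^+ 2) (K0 ^+ 2) (gamma p ^+ 2) (K2 ^+ 2) (gmax ^+ 2) (tau ^+ 2) (A ^+ 2) (sc p ^+ 2) => u1 u2 u3 u4 u5 u6 u7 u8.
lra.
Qed.

End MeanSquareDisplacement.

End ShearConsequences.

Unset Implicit Arguments.

Theorem theorem3p3 (R : realType) :
  exists C0 : R -> R -> R -> R,
  exists (C1 : R -> R) (C2 : R -> R -> R -> R -> R) (C3 : R -> R -> R)
         (C4 : R -> R -> R -> R),
  [/\ forall z, 0 < C1 z,
      forall z k0 k2 gmax, 0 < C2 z k0 k2 gmax,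
      forall z k0, 0 < C3 z k0
    & forall z k0 rmax, 0 < C4 z k0 rmax] /\
  forall (r : nat -> int) (gamma : nat -> R) (h : nat -> R -> R),
  shear_flow_assumptions r gamma h ->
  Num.sqrt (gamma_max gamma) < rho_min r ->
  (forall n, (h n)^`() 0 = 0) ->
  has_ubound (range (fun n => sup_norm (h n)^`(2))) ->
  forall z : R, 2 < z -> z <= gamma_min gamma ->
  C0 z (K_0 h) (K_2 h) < rho_min r ^+ 2 * (gamma_max gamma)^-1 ->
  forall (d : measure_display) (T : measurableType d) (P : probability T R)
         (omega y : R -> T -> 'rV[R]_2),
  brownian_motion P omega ->
  solves_sde (stream_matrix r gamma h) omega y ->
  forall t : R, C3 z (K_0 h) <= t ->
  let p := scale_index r gamma h t in
  let nu := anomalous_exponent r gamma h t in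
  let c1 := C1 z in
  let c2 := C2 z (K_0 h) (K_2 h) (gamma_max gamma) in
  let c4 := C4 z (K_0 h) (rho_max r) in
  let msd := expectation P (fun w => (y t w 0 1) ^+ 2) in
  ((c1 * t * gamma p ^+ 2)%:E <= msd /\
   msd <= (c2 * t * gamma p ^+ 2)%:E /\
   (c4 * t `^ (1 + nu))%:E <= msd /\
   msd <= (c2 * t `^ (1 + nu))%:E)%E.
Proof.
(* The branch [z <= 2] only serves to make the constants positive everywhere. *)
pose af (z : R) := if 2 < z then 1 - (z - 1)^-1 else 1.
have af0 z : 0 < af z by rewrite /af; case: ifPn => // z2; rewrite subr_gt0 invf_lt1; lra.
(* The threshold with [z] in place of [gamma_min]: an upper bound for [threshold] that depends on
   [z] and [K_0] only. *)
pose tau z k0 := 16 * (1 + k0 ^+ 2) * af z ^- 2.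
have tau0 z k0 : 0 < tau z k0.
  by rewrite mulr_gt0 ?invr_gt0 ?exprn_gt0// mulr_gt0// ltr_wpDr ?sqr_ge0.
pose C1 z := af z ^+ 2 / 6 / 20 / 40.
have C10 z : 0 < C1 z by rewrite !divr_gt0// exprn_gt0.
pose C2 z k0 k2 gmax := 6 + 100 * k0 ^+ 2 + 20 * (k2 * gmax * tau z k0) ^+ 2.
(* The extra 1 makes [threshold < t] strict, as [scale_index_bounds] requires. *)
pose C3 z k0 := tau z k0 + 1.
(* Compensates the loss [(threshold * rho_max^2)^2] of [exponent_comparison]; [1 + rmax^2] keeps the
   denominator positive for every real [rmax]. *)
pose C4 z k0 rmax := C1 z / (tau z k0 * (1 + rmax ^+ 2)) ^+ 2.
(* The summand [2] makes the amplitudes of the second derivatives halve from one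
   level to the next; the other one is the smallness condition of
   [shear_msd_lower]. *)
pose C0 z (k0 k2 : R) := 2 + 18 * (40 * (24 * (`|k2| / af z))).
have C4_den z k0 rmax : 0 < tau z k0 * (1 + rmax ^+ 2).
  by rewrite mulr_gt0// ltr_wpDr ?sqr_ge0.
exists C0, C1, C2, C3, C4; split.
  split => // [z k0 k2 gmax|z k0|z k0 rmax].
  - have := sqr_ge0 k0; have := sqr_ge0 (k2 * gmax * tau z k0).
    by rewrite /C2; move: (_ ^+ 2) (_ ^+ 2) => u v; lra.
  - by rewrite addr_gt0.
  - by rewrite divr_gt0// exprn_gt0.
move=> r gamma h shear _ h10 K2b z z2 zg sepC d T P omega y bm sy t tC p nu c1 c2 c4 msd.
have gmin2 : 2 < gamma_min gamma := lt_le_trans z2 zg.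
set gmax := gamma_max gamma in sepC c2 *; set rmin := rho_min r in sepC.
have gmax0 : 0 < gmax by apply: lt_trans (gmax_gt2 shear gmin2).
have rmin0 : 0 < rmin by apply: lt_le_trans (rmin_ge2 shear).
have K20 : 0 <= K_2 h := K2_ge0 shear K2b.
pose sep := gmax / rmin ^+ 2.
have sep0 : 0 < sep by rewrite divr_gt0// exprn_gt0.
(* In the form [sep * C0 < 1] the two nonnegative summands can be read off separately: [sep < 1/2],
   and the smallness of [K_2 * sep]. *)
have sepC0 : sep * C0 z (K_0 h) (K_2 h) < 1.
  rewrite -[ltRHS](_ : sep * (rmin ^+ 2 * gmax^-1) = 1) ?ltr_pM2l//.
  by rewrite /sep; field; rewrite !gt_eqF.
rewrite /C0 (ger0_norm K20) in sepC0.
have Ka0 : 0 <= K_2 h / af z by rewrite divr_ge0// ltW.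
have prod0 : 0 <= sep * (K_2 h / af z) by rewrite mulr_ge0// ltW.
have sep_le : sep <= 2^-1 by lra.
have afE : af z = 1 - (z - 1)^-1 by rewrite /af z2.
have af_le : af z <= 1 - (gamma_min gamma - 1)^-1.
  by rewrite afE lerB// lef_pV2 ?posrE; lra.
have small : 18 * (40 * (24 * (K_2 h * sep))) <= 1 - (gamma_min gamma - 1)^-1.
  apply: le_trans af_le.
  rewrite (_ : K_2 h * sep = sep * (K_2 h / af z) * af z); last by field; rewrite gt_eqF.
  have := ler_wpM2r (ltW (af0 z)) (_ : sep * (K_2 h / af z) * (18 * (40 * 24)) <= 1).
  by move=> H; have := H ltac:(lra); lra.
have thr_le : threshold gamma h <= tau z (K_0 h).
  rewrite /threshold /tau ler_wpM2l ?mulr_ge0 ?addr_ge0 ?sqr_ge0//.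
  rewrite lef_pV2 ?posrE ?exprn_gt0// ?(lt_le_trans (af0 z))//.
  by rewrite lerXn2r ?nnegrE ?(ltW (af0 z))// (le_trans _ af_le) ?ltW.
have thr_lt : threshold gamma h < t.
  by apply: le_lt_trans thr_le _; apply: lt_le_trans tC; rewrite ltrDl.
have thr16 := threshold_ge16 h gmin2.
have [lo hi] := scale_index_bounds shear gmin2 thr_lt; rewrite -/p in lo hi.
have t0 : 0 < t by lra.
have [k [dk kB kS]] := shear_potential_derivative shear h10 K2b gmin2 sep_le.
have msdE : msd = (\int[P]_w ((wpath omega t w + path_int omega k t w) ^+ 2)%:E)%E.
  rewrite /msd unlock; apply: eq_integral => w _.
  by rewrite (sde_solution w bm dk kB sy (ltW t0)).
have t_ge : 16 * scale r p ^+ 2 <= t.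
  by apply: le_trans (ltW lo); rewrite ler_wpM2r ?sqr_ge0.
have t_le : t <= tau z (K_0 h) * scale r p.+1 ^+ 2.
  by apply: (le_trans hi); rewrite ler_wpM2r ?sqr_ge0.
have g0 := gamma_gt0 shear gmin2 p.
have lower : ((c1 * t * gamma p ^+ 2)%:E <= msd)%E.
  rewrite msdE; apply: le_trans (shear_msd_lower shear h10 K2b gmin2 bm sep_le kB kS t_ge small).
  have : (af z * gamma p) ^+ 2 <= ((1 - (gamma_min gamma - 1)^-1) * gamma p) ^+ 2.
    have := af0 z; have := af_le => a1 a2.
    by rewrite lerXn2r ?nnegrE ?ler_pM2r// mulr_ge0 ?(ltW g0)//; lra.
  move=> /(ler_wpM2r (ltW t0)); rewrite lee_fin /c1 /C1.
  rewrite (_ : (af z * gamma p) ^+ 2 = af z ^+ 2 * gamma p ^+ 2); last by ring.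
  by move: (_ ^+ 2) (af z ^+ 2) (gamma p ^+ 2) => u v1 v; lra.
have upper : (msd <= (c2 * t * gamma p ^+ 2)%:E)%E.
  rewrite msdE; exact: (shear_msd_upper shear K2b gmin2 bm kB kS t_ge t_le).
have [E1 E2] := exponent_comparison shear gmin2 sep_le thr_lt; rewrite -/p -/nu in E1 E2.
split; [exact: lower|split; [exact: upper|split]].
- apply: le_trans lower; rewrite lee_fin.
  have c40 : 0 < c4 by rewrite divr_gt0// exprn_gt0.
  apply: (le_trans (ler_wpM2l (ltW c40) E2)).
  rewrite (_ : c1 * t * _ = t * gamma p ^+ 2 * c1); last by ring.
  rewrite (_ : c4 * _ = t * gamma p ^+ 2 * (c4 * (threshold gamma h * rho_max r ^+ 2) ^+ 2)); last by ring.
  apply: ler_wpM2l; first by rewrite mulr_ge0 ?(ltW t0)// sqr_ge0.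
  rewrite /c4 /C4 mulrAC ler_pdivrMr ?exprn_gt0// ler_pM2l//.
  rewrite lerXn2r ?nnegrE ?(ltW (C4_den _ _ _))//; first by rewrite mulr_ge0 ?sqr_ge0//; lra.
  by rewrite ler_pM ?sqr_ge0//; lra.
- apply: (le_trans upper); rewrite lee_fin -mulrA ler_wpM2l//.
  rewrite /c2 /C2; have := sqr_ge0 (K_0 h); have := sqr_ge0 (K_2 h * gmax * tau z (K_0 h)).
  by move: (_ ^+ 2) (_ ^+ 2) => u v; lra.
Qed.
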